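(* Let $I\subset\mathbb R$ be a bounded open interval, $n\ge1$, $\lambda>0$, $h\in L^2(I,\mathbb R^n)$. Let $F=f\circ\varphi$, where $f\colon[0,\infty)\to[0,\infty)$ is convex, non-decreasing and of linear growth, and $\varphi\colon\mathbb R^n\to[0,\infty)$ is a coercive anisotropy. Let $u$ be the minimizer of $\mathcal E(w)=\lambda\mathcal F(w)+\frac12\int_I|w-h|^2\,d\mathcal L^1$ over $w\in L^2(I,\mathbb R^n)$. Suppose that $h\in BV(U,\mathbb R^n)$ for an open interval $U\subset I$. Then $|u_x^s|\le\big(\tfrac{c_\varphi^+}{c_\varphi^-}\big)^2|h_x^s|$ in the sense of Borel measures on $U$, i.e. $$|u_x^s|(E)\le\Big(\frac{c_\varphi^+}{c_\varphi^-}\Big)^2|h_x^s|(E)\quad\text{for any Borel set }E\subset U.$$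
   Context: An anisotropy on $\mathbb R^n$ is a convex function $\varphi\colon\mathbb R^n\to[0,\infty)$ that is positively $1$-homogeneous: $\varphi(tp)=t\varphi(p)$ for $p\in\mathbb R^n$, $t\ge0$. Put $c_\varphi^+=\max_{p\ne0}\varphi(p)/|p|$, $c_\varphi^-=\min_{p\neq0}\varphi(p)/|p|$; $\varphi$ is coercive if $c_\varphi^->0$. A function $G$ (on $\mathbb R^n$ or on $[0,\infty)$) is of linear growth if $C^-|\xi|+B^-\le G(\xi)\le C^+|\xi|+B^+$ for all $\xi$, with constants $C^\pm>0$, $B^\pm\in\mathbb R$. For a convex $F\colon\mathbb R^n\to[0,\infty)$ of linear growth the functional $\mathcal F\colon L^2(I,\mathbb R^n)\to[0,\infty]$ is $$\mathcal F(w)=\inf\Big\{\liminf_{\ell\to\infty}\int_I F(w^\ell_x)\,d\mathcal L^1:\ (w^\ell)\subset C^1(I,\mathbb R^n),\ w^\ell\to w\text{ in }L^1_{loc}(I,\mathbb R^n)\Big\}.$$ $\mathcal F$ is finite exactly on $L^2(I,\mathbb R^n)\cap BV(I,\mathbb R^n)$, where $\mathcal F(w)=\int_I F(w_x^{ac})\,d\mathcal L^1+\int_I F^\infty\big(\tfrac{w_x^s}{|w_x^s|}\big)\,d|w_x^s|$; here $w_x$ is the distributional derivative (an $\mathbb R^n$-valued measure) with Lebesgue decomposition $w_x=w_x^{ac}\mathcal L^1+w_x^s$, and $F^\infty(\nu)=\lim_{t\to\infty}F(t\nu)/t$. The functional $\mathcal E$ has a unique minimizer in $L^2(I,\mathbb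 R^n)$. $|\mu|$ denotes the (Euclidean) total variation measure of a vector measure $\mu$. *)

(* Defs.v *)
From HB Require Import structures.
From mathcomp Require Import all_boot all_order all_algebra.
From mathcomp Require Import all_classical all_reals all_analysis.

Set Implicit Arguments.
Unset Strict Implicit.
Unset Printing Implicit Defensive.

Import Order.TTheory GRing.Theory Num.Theory.
Import numFieldNormedType.Exports.

Local Open Scope classical_set_scope.
Local Open Scope ring_scope.

(* The library norm on 'rV[R]_n is the sup norm, hence this definition. *)
Definition enorm (R : realType) (n : nat) (v : 'rV[R]_n) : R :=
  Num.sqrt (\sum_(i < n) v ord0 i ^+ 2).

Definition anisotropy (R : realType) (n : nat) (phi : 'rV[R]_n -> R) : Prop :=
  [/\ forall p, 0 <= phi p,
      convex_function [set: 'rV[R]_n] phi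
    & forall (t : R) p, 0 <= t -> phi (t *: p) = t * phi p].

(* For an anisotropy and n >= 1 the supremum and infimum are attained. *)
Definition cplus (R : realType) (n : nat) (phi : 'rV[R]_n -> R) : R :=
  sup [set phi p / enorm p | p in [set p | p != 0]].

Definition cminus (R : realType) (n : nat) (phi : 'rV[R]_n -> R) : R :=
  inf [set phi p / enorm p | p in [set p | p != 0]].

Definition coercive (R : realType) (n : nat) (phi : 'rV[R]_n -> R) : Prop :=
  0 < cminus phi.

Definition linear_growth (R : realType) (f : R -> R) : Prop :=
  exists Cm Cp Bm Bp : R, [/\ 0 < Cm, 0 < Cp &
    forall t, 0 <= t -> Cm * t + Bm <= f t <= Cp * t + Bp].

Definition L1 (R : realType) (n : nat) (D : set R) (w : R -> 'rV[R]_n) : Prop :=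
  forall i, (@lebesgue_measure R).-integrable D (fun x => (w x ord0 i)%:E).

Definition L2 (R : realType) (n : nat) (D : set R) (w : R -> 'rV[R]_n) : Prop :=
  (forall i, measurable_fun D (fun x => w x ord0 i)) /\
  (\int[@lebesgue_measure R]_(x in D) (enorm (w x) ^+ 2)%:E < +oo)%E.

Definition C1 (R : realType) (n : nat) (D : set R) (w : R -> 'rV[R]_n) : Prop :=
  forall x, D x -> derivable w x 1 /\ {for x, continuous (derive1 w)}.

Definition cvg_L1loc (R : realType) (n : nat) (D : set R)
    (w : nat -> R -> 'rV[R]_n) (w0 : R -> 'rV[R]_n) : Prop :=
  forall K : set R, compact K -> K `<=` D ->
    (\int[@lebesgue_measure R]_(x in K) (enorm (w l x - w0 x))%:E)%E
      @[l --> \oo] --> 0%E.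

Definition relaxed (R : realType) (n : nat) (D : set R) (F : 'rV[R]_n -> R)
    (w : R -> 'rV[R]_n) : \bar R :=
  ereal_inf [set limn_einf
      (fun l => \int[@lebesgue_measure R]_(x in D) (F (derive1 (v l) x))%:E)%E
    | v in [set v : nat -> R -> 'rV[R]_n |
        (forall l, C1 D (v l)) /\ cvg_L1loc D v w]].

Definition energy (R : realType) (n : nat) (D : set R) (F : 'rV[R]_n -> R)
    (lambda : R) (h w : R -> 'rV[R]_n) : \bar R :=
  (lambda%:E * relaxed D F w
   + (2^-1)%:E *
     \int[@lebesgue_measure R]_(x in D) (enorm (w x - h x) ^+ 2)%:E)%E.

Definition is_minimizer (R : realType) (n : nat) (D : set R)
    (F : 'rV[R]_n -> R) (lambda : R) (h u : R -> 'rV[R]_n) : Prop :=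
  L2 D u /\
  forall w, L2 D w -> (energy D F lambda h u <= energy D F lambda h w)%E.

(* A finite R^n-valued Borel measure is given by its components. *)
Definition vmeasure (R : realType) (n : nat) :=
  'I_n -> {charge set (measurableTypeR R) -> \bar R}.

Section charge_integral.
Context (R : realType) (nu : {charge set (measurableTypeR R) -> \bar R}).

Let P := projT1 (cid (Hahn_decomposition nu)).
Let N := projT1 (cid (projT2 (cid (Hahn_decomposition nu)))).
Let nuPN : hahn_decomposition nu P N :=
  projT2 (cid (projT2 (cid (Hahn_decomposition nu)))).

(* The value does not depend on the chosen Hahn decomposition. *)
Definition charge_integral (f : R -> R) : R :=
  \int[jordan_pos nuPN]_(x in setT) f x - \int[jordan_neg nuPN]_(x in setT) f x.

End charge_integral.

Definition test_function (R : realType) (U : set R) (psi : R -> R) : Prop :=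
  [/\ forall k x, derivable (derive1n k psi) x 1,
      compact (closure [set x | psi x != 0])
    & closure [set x | psi x != 0] `<=` U].

(* A measure on U is encoded by its extension by zero to the whole line. *)
Definition distr_derivative (R : realType) (n : nat) (U : set R)
    (w : R -> 'rV[R]_n) (Dw : vmeasure R n) : Prop :=
  forall i,
    (forall A : set (measurableTypeR R),
       measurable A -> A `&` U = set0 -> Dw i A = 0%E) /\
    (forall psi, test_function U psi ->
       \int[@lebesgue_measure R]_(x in U) (w x ord0 i * derive1 psi x)
       = - charge_integral (Dw i) psi).

Definition BV (R : realType) (n : nat) (U : set R) (w : R -> 'rV[R]_n) : Prop :=
  L1 U w /\ exists Dw : vmeasure R n, distr_derivative U w Dw.

(* m = g L^1 + s with g integrable and s concentrated on a null set. *)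
Definition singular_part (R : realType) (n : nat) (m s : vmeasure R n) : Prop :=
  (exists2 g : R -> 'rV[R]_n, L1 setT g &
     forall i (A : set (measurableTypeR R)), measurable A ->
       m i A =
       (\int[@lebesgue_measure R]_(x in A) (g x ord0 i)%:E + s i A)%E) /\
  (exists N : set (measurableTypeR R),
     [/\ measurable N, lebesgue_measure N = 0%E &
       forall i (A : set (measurableTypeR R)), measurable A ->
         A `&` N = set0 -> s i A = 0%E]).

Definition total_variation_measure (R : realType) (n : nat)
    (m : vmeasure R n) (E : set R) : \bar R :=
  ereal_sup [set (\sum_(0 <= k <oo) (enorm (\row_i fine (m i (B k))))%:E)%E
    | B in [set B : nat -> set (measurableTypeR R) |
        [/\ forall k, measurable (B k), trivIset setT B
          & \bigcup_k B k = E]]].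

(* Main.v *)
Require Import Defs.
From HB Require Import structures.
From mathcomp Require Import all_boot all_order all_algebra.
From mathcomp Require Import all_classical all_reals all_analysis.
From mathcomp Require Import measurable_realfun ring lra.

Import Order.TTheory GRing.Theory Num.Theory.
Import numFieldNormedType.Exports.

Local Open Scope classical_set_scope.
Local Open Scope ring_scope.

(* Write L for the slope of f at infinity and z(y) = - (1/lambda) int_y^b (u - h).
   Adding to u a steep smooth step at y in direction p costs at most L phi(p), so the
   minimality of u gives z(y).p <= L phi(p) for all p; hence theta z(y).p <= F(p) + C
   for theta < 1.  Damping u' by the factor 1 - t chi on an interval [x, xi[ gives, for
   every q with q.p <= F(p) + C for all p, the inequality
     int_[x,xi[ (z - q).dDu >= - (F(0) + C) (xi - x).
   A covering argument makes it pointwise on Lebesgue null sets: with q = theta z(y) and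
   theta -> 1, the density nu_u of Du with respect to m = |Du| + |Dh| satisfies there
   nu_u(x).(z(x) - z(y)) >= 0 for all y and m-almost every x.  Since lambda z' = u - h,
   the left-continuous representative V of u - h has nu_u(x).V(x) >= 0 and
   nu_u(x).V(xi) <= 0 for some xi > x arbitrarily close to x, that is
   nu_u(x).(Du - Dh)([x,xi[) <= 0.  Covering again, nu_u.(nu_u - nu_h) <= 0, hence
   |nu_u| <= |nu_h| on the null set carrying the singular parts: the comparison holds
   with the constant 1 <= (c+/c-)^2.

   For u in BV, take C^1 functions converging to u almost everywhere with bounded
   variations; the lower limit P of their variation functions makes both P and P - u
   nondecreasing, and Du is a difference of Lebesgue-Stieltjes measures. *)

(** [relaxed] is handled directly as an infimum over C^1 sequences. A competitor is built along each
    approximating sequence, and both the competitor and its cost must pass to the L^1_loc limit;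
    hence the perturbations are affine in u and are written without u'.

    Heuristically z(y).p <= L phi(p) for all y and p, and on the singular part of Du the flux
    saturates this bound in the direction nu_u. So nu_u(x).z is maximal at x, and the two signs of
    nu_u.V are the one-sided derivative tests at this maximum. At that stage the anisotropy has
    disappeared: what remains is the Euclidean pairing of nu_u with u - h, coming from the fidelity
    term, and this explains the constant 1.

    The factor theta < 1 is forced because L phi - F can be unbounded, for instance for f(t) = t -
    log(1 + t). The constant C may blow up as theta -> 1, but for each fixed theta the error (F(0) +
    C)(xi - x) is a multiple of Lebesgue measure, harmless on a null set, and theta runs over a
    sequence.

    Intervals have the form [x, xi[ because Du([x, xi[) is the increment of the left-continuous
    function x -> Du(]-oo, x[). *)

Notation leb := lebesgue_measure.

(** * Covering by right intervals *)

Section regularity.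
Context (R : realType) (mu : {measure set (measurableTypeR R) -> \bar R}).
Hypothesis mufin : (mu setT < +oo)%E.

Lemma finite_measure_cvg0 (F : nat -> set (measurableTypeR R)) (e : R) : 0 < e ->
  (forall k, measurable (F k)) -> nonincreasing_seq F -> \bigcap_k F k = set0 ->
  exists k, (mu (F k) < e%:E)%E.
Proof.
move=> e0 mF niF F0.
have := @nonincreasing_cvg_mu _ _ _ mu F.
rewrite F0 measure0 => /(_ _ mF _ niF) H.
have {}H : mu (F x) @[x --> \oo] --> 0%E.
  apply: H => //; apply: le_lt_trans mufin; apply: le_measure; rewrite ?inE//.
have : \forall k \near \oo, (mu (F k) < e%:E)%E.
  apply: (H [set x | (x < e%:E)%E]); apply: open_nbhs_nbhs; split; [exact: open_ereal_lt_ereal|by rewrite /= lte_fin].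
by move=> [k _ /(_ k (leqnn _))]; exists k.
Qed.

(** Inner and outer approximation are kept together because complementation exchanges them. The sets
    with this property then form a sigma-algebra, and it contains the rays that generate the Borel
    sets. *)
Definition regular_set (A : set (measurableTypeR R)) :=
  forall e : R, 0 < e -> exists K O : set R, [/\ closed K, open O, K `<=` A, A `<=` O
    & (mu (O `\` K) <= e%:E)%E].

Lemma regular_set_itv x : regular_set `]x, +oo[%classic.
Proof.
move=> e e0.
pose F (k : nat) : set (measurableTypeR R) := `]x, x + k.+1%:R^-1[%classic.
have [k kP] : exists k : nat, (mu (F k) < e%:E)%E.
  apply: finite_measure_cvg0 => //.
  - by move=> k; exact: measurable_itv.
  - move=> p q pq; apply/subsetPset; apply: subset_itvl; rewrite bnd_simp.
    by rewrite lerD2l lef_pV2 ?posrE// ler_nat.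
  - apply/seteqP; split => // y H; have := H 0%N I; rewrite /F/= in_itv/= => /andP[xy _].
    have [n] := @ltr_add_invr R x y xy.
    by have := H n I; rewrite /F/= in_itv/= => /andP[_ /ltW]; rewrite leNgt => /negP.
exists `[x + k.+1%:R^-1, +oo[%classic, `]x, +oo[%classic; split => //.
- exact: interval_closed.
- move=> y /=; rewrite !in_itv/= !andbT; apply: lt_le_trans.
  by rewrite ltrDl invr_gt0.
- apply/ltW; apply: le_lt_trans kP; apply: le_measure; rewrite ?inE//.
    by apply: measurableD => //; exact: measurable_itv.
    exact: measurable_itv.
  move=> y; rewrite /F/= !in_itv/= !andbT => -[-> /negP]; rewrite -ltNge //.
Qed.

Lemma regular_setC A : regular_set A -> regular_set (~` A).
Proof.
move=> rA e e0; have [K [V [cK oO KA AO KOe]]] := rA e e0.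
exists (~` V), (~` K); split.
- exact: open_closedC.
- exact: closed_openC.
- exact: subsetC.
- exact: subsetC.
- by rewrite setDE setCK setIC -setDE.
Qed.

Lemma regular_set_bigcup (A : nat -> set (measurableTypeR R)) :
  (forall k, regular_set (A k)) -> regular_set (\bigcup_k A k).
Proof.
move=> rA e e0.
have e20 k : 0 < e / 2 / (2 ^ k.+1)%:R :> R by rewrite !divr_gt0// ltr0n expn_gt0.
have /choice[KO HKO] : forall k, exists KO : set R * set R, [/\ closed KO.1, open KO.2, KO.1 `<=` A k, A k `<=` KO.2
    & (mu (KO.2 `\` KO.1) <= (e / 2 / (2 ^ k.+1)%:R)%:E)%E].
  by move=> k; have [K [V H]] := rA k _ (e20 k); exists (K, V).
have mK k : measurable ((KO k).1 : set (measurableTypeR R)).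
  by apply: closed_measurable; case: (HKO k).
have mO k : measurable ((KO k).2 : set (measurableTypeR R)).
  by apply: open_measurable; case: (HKO k).
(* The union of all inner sets need not be closed. A finite part of it is closed and misses a set of
   measure less than [e / 2]; the other half of the error is shared out geometrically among the
   pieces. *)
pose Kn (n : nat) : set R := \bigcup_(k < n) (KO k).1.
have mKn n : measurable (Kn n : set (measurableTypeR R)) by apply: bigcup_measurable.
have [n nP] : exists n, (mu ((\bigcup_k (KO k).1) `\` Kn n) < (e / 2)%:E)%E.
  apply: finite_measure_cvg0; first exact: divr_gt0.
  - by move=> k; apply: measurableD => //; exact: bigcupT_measurable.
  - move=> p q pq; apply/subsetPset; apply: setDS.
    by move=> x [k /= kp kx]; exists k => //=; exact: leq_trans pq.
  - apply/seteqP; split => // x H; have [[k _ kx] _] := H 0%N I.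
    by have [_ ] := H k.+1 I; apply; exists k => /=.
exists (Kn n), (\bigcup_k (KO k).2); split.
- by apply: closed_bigcup => [|i _]; [exact: finite_II|case: (HKO i)].
- by apply: bigcup_open => i _; case: (HKO i).
- by move=> x [k _ kx]; exists k => //; case: (HKO k) => _ _ + _ _; apply.
- by apply: subset_bigcup => k _; case: (HKO k).
have mU : measurable (\bigcup_k (KO k).1 : set (measurableTypeR R)) by exact: bigcupT_measurable.
have mD k : measurable ((KO k).2 `\` (KO k).1 : set (measurableTypeR R)) by exact: measurableD.
apply: (@le_trans _ _ (mu ((\bigcup_k ((KO k).2 `\` (KO k).1)) `|` ((\bigcup_k (KO k).1) `\` Kn n)))).
  apply: le_measure; rewrite ?inE//.
  - by apply: measurableD => //; exact: bigcupT_measurable.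
  - apply: measurableU; [exact: bigcupT_measurable|exact: measurableD].
  - move=> x [[k _ kx] nx]; have [[j _ jx]|nx'] := pselect ((\bigcup_k (KO k).1) x).
      by right; split => //; exists j.
    by left; exists k => //; split => // kx'; apply: nx'; exists k.
apply: (le_trans (measureU2 _ _ _)).
- exact: bigcupT_measurable.
- exact: measurableD.
rewrite [in leRHS](splitr e) EFinD leeD//; last exact: ltW.
apply: (le_trans (measure_sigma_subadditive _ mD (bigcupT_measurable _ mD) (fun x h => h))).
apply: (@le_trans _ _ (\sum_(0 <= k <oo) (e / 2 / (2 ^ k.+1)%:R)%:E)%E).
  by apply: lee_nneseries => // k _; case: (HKO k).
have := @epsilon_trick0 R (e / 2) xpredT; apply.
by rewrite divr_ge0// ltW.
Qed.

Lemma measurable_regular A : measurable A -> regular_set A.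
Proof.
move=> mA; have {}mA : (@RGenOInfty.G R).-sigma.-measurable A by rewrite -RGenOInfty.measurableE.
apply: (smallest_sub _ _ mA); last by move=> _ [x ->]; exact: regular_set_itv.
split.
- move=> e e0; exists set0, set0; split; [exact: closed0|exact: open0|by []|by []|].
  by rewrite setDv measure0 lee_fin ltW.
- by move=> B rB; rewrite setTD; exact: regular_setC.
- exact: regular_set_bigcup.
Qed.

(** The bound [M] makes K compact, so that a sweep of the line from [- M] to [M + 1] meets all of
    it. *)
Lemma inner_regular_bounded (A : set (measurableTypeR R)) (e : R) : measurable A -> 0 < e ->
  exists (K : set R) (M : R), [/\ closed K, K `<=` A, K `<=` `[- M, M], 0 < M & (mu (A `\` K) < e%:E)%E].
Proof.
move=> mA e0; have [|K [V [cK oO KA AO KOe]]] := measurable_regular A mA (e / 2).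
  exact: divr_gt0.
pose F (k : nat) : set (measurableTypeR R) := ~` `[- k.+1%:R, k.+1%:R]%classic.
have [k kP] : exists k, (mu (F k) < (e / 2)%:E)%E.
  apply: finite_measure_cvg0; first exact: divr_gt0.
  - by move=> k; apply: measurableC; exact: measurable_itv.
  - move=> p q pq; apply/subsetPset; apply: subsetC; apply: subset_itv; rewrite bnd_simp ?lerN2 ler_nat //.
  - apply/seteqP; split => // x H; have := H (Num.truncn `|x|) I; apply => /=.
    rewrite in_itv/= -ler_norml; apply: ltW; exact: truncnS_gt.
have mK : measurable (K : set (measurableTypeR R)) by exact: closed_measurable.
have mKO : measurable (V `\` K : set (measurableTypeR R)).
  by apply: measurableD => //; exact: open_measurable.
have mF : measurable (F k) by apply: measurableC; exact: measurable_itv.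
exists (K `&` `[- k.+1%:R, k.+1%:R]), k.+1%:R; split => //.
- by apply: closedI => //; exact: interval_closed.
- by move=> x [/KA].
apply: (@le_lt_trans _ _ (mu ((V `\` K) `|` F k))).
  apply: le_measure; rewrite ?inE.
  - by apply: measurableD => //; apply: measurableI => //; exact: measurable_itv.
  - exact: measurableU.
  - move=> x [Ax nx]; have [Kx|nKx] := pselect (K x); last by left; split => //; exact: AO.
    by right => xk; apply: nx; split.
apply: (le_lt_trans (measureU2 _ _ _)) => //.
by rewrite (splitr e) EFinD lee_ltD// ge0_fin_numE// (le_lt_trans KOe)// ltry.
Qed.

End regularity.

Section covering.
Context (R : realType) (rho : {charge set (measurableTypeR R) -> \bar R}).

(* For a compact K inside A, consider the t such that K below t lies in sets J close
   to K with rho J <= d, for every d > 0: adjoining an interval [t, y[ with rho [t, y[ <= 0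
   lets the supremum of these t advance, so it exceeds K. *)
Lemma charge_le0_of_right_itv (A : set (measurableTypeR R)) : measurable A ->
  (forall x, A x -> forall e, 0 < e -> exists y : R, [/\ x < y, y < x + e
     & (rho `[x, y[%classic <= 0)%E]) ->
  (rho A <= 0)%E.
Proof.
move=> mA HA.
have [P [N PN]] := Hahn_decomposition rho.
pose gam : {measure set (measurableTypeR R) -> \bar R} := charge_variation PN.
have gamE B : measurable B -> (`|rho B| <= gam B)%E.
  by move=> mB; exact: abse_charge_variation.
have gfin B : measurable B -> gam B \is a fin_num.
  by move=> mB; rewrite /gam/= fin_numD; apply/andP; split; exact: fin_num_measure.
have gT : (gam setT < +oo)%E by rewrite -ge0_fin_numE//; exact: gfin.
have rfin B : measurable B -> rho B \is a fin_num.
  by move=> mB; exact: fin_num_measure.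
apply/lee_addgt0Pr => e0 e0_gt0; rewrite add0e.
pose e := e0 / 3.
have e_gt0 : 0 < e by rewrite divr_gt0.
have [K [M [cK KA KM M_gt0 AKe]]] := inner_regular_bounded _ _ gT _ _ mA e_gt0.
have mK : measurable (K : set (measurableTypeR R)) by exact: closed_measurable.
(* Keeping J inside a neighbourhood of K with small excess measure makes the part of J outside A
   small for [gam], so that [rho A] stays close to [rho J]. *)
pose V (k : nat) : set (measurableTypeR R) := [set x | exists2 y, K y & `|x - y| < k.+1%:R^-1].
have mV k : measurable (V k).
  rewrite (_ : V k = \bigcup_(y in K) ball y (k.+1%:R^-1)); last first.
    by apply/seteqP; split => x [y Ky xy]; exists y => //; move: xy; rewrite -ball_normE/= distrC.
  by apply: open_measurable; apply: bigcup_open => y _; exact: ball_open.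
have mVK k : measurable (V k `\` K) by exact: measurableD.
have [k kP] : exists k, (gam (V k `\` K) < e%:E)%E.
  apply: (finite_measure_cvg0 _ _ gT) => //.
  - move=> p q pq; apply/subsetPset; apply: setSD => x [y Ky xy]; exists y => //.
    by apply: (lt_le_trans xy); rewrite lef_pV2 ?posrE// ler_nat.
  - apply/seteqP; split => // x H; have [_ nKx] := H 0%N I.
    apply: nKx; apply: cK => B /nbhs_ballP[r /= r0 rB].
    have [n nr] := @ltr_add_invr R 0 r r0; rewrite add0r in nr.
    have [[y Ky xy] _] := H n I; exists y; split => //; apply: rB.
    by rewrite -ball_normE/=; exact: lt_trans nr.
pose good (t : R) := forall d : R, 0 < d -> exists J : set (measurableTypeR R),
  [/\ measurable J, K `&` `]-oo, t[ `<=` J, J `<=` V k `&` `]-oo, t[ & (rho J <= d%:E)%E].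
have gM : good (- M).
  move=> d d0; exists set0; split => //.
  - by move=> x [/KM /=]; rewrite !in_itv/= => /andP[+ _]; rewrite leNgt => /negbTE ->.
  - by rewrite charge0 lee_fin ltW.
pose S := [set t | [/\ - M <= t, t <= M + 1 & good t]].
have SM : S (- M) by split => //; lra.
have supS : has_sup S by split; [exists (- M)|exists (M + 1) => t []].
pose s := sup S.
have Ms : - M <= s by apply: ub_le_sup => //; case: supS.
have sM : s <= M + 1 by apply: ge_sup; [exists (- M)|move=> t []].
have step (t t' : R) (J W : set (measurableTypeR R)) : measurable J -> measurable W ->
    J `<=` V k `&` `]-oo, t[ -> W `<=` V k `&` `[t, t'[ -> t <= t' ->
    (J `|` W `<=` V k `&` `]-oo, t'[%classic) /\ (rho (J `|` W) = rho J + rho W)%E.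
  move=> mJ mW Jt Wt tt'; split.
    move=> x [/Jt[Vx]|/Wt[Vx]]; rewrite /= !in_itv/= => xt; split => //=.
      exact: lt_le_trans tt'.
    by case/andP : xt.
  rewrite chargeU//; apply/seteqP; split => // x [/Jt[_ +] /Wt[_ +]].
  by rewrite /= !in_itv/= => + /andP[+ _]; rewrite leNgt => ->.
(* The supremum itself is good: for t close to s the missing interval [t, s[ has small variation,
   and the part of it in the neighbourhood of K is added to J. *)
have gs : good s.
  move=> d d0.
  pose F (n : nat) : set (measurableTypeR R) := `[s - n.+1%:R^-1, s[%classic.
  have mF n : measurable (F n) by exact: measurable_itv.
  have [n nP] : exists n, (gam (F n) < (d / 2)%:E)%E.
    apply: (finite_measure_cvg0 _ _ gT) => //; first exact: divr_gt0.
    - move=> p q pq; apply/subsetPset; apply: subset_itvr; rewrite bnd_simp.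
      by rewrite lerD2l lerN2 lef_pV2 ?posrE// ler_nat.
    - apply/seteqP; split => // x H; have := H 0%N I; rewrite /F/= in_itv/= => /andP[_ xs].
      have [m] := @ltr_add_invr R x s xs.
      have := H m I; rewrite /F/= in_itv/= => /andP[+ _].
      by rewrite lerBlDr leNgt => /negbTE ->.
  have [|t St nt] := @sup_adherent R S n.+1%:R^-1 _ supS; first by rewrite invr_gt0.
  have ts : t <= s by apply: ub_le_sup => //; case: supS.
  have [tM tM' gt] := St.
  have [|J [mJ KJ JV Jd]] := gt (d / 2); first exact: divr_gt0.
  have mW : measurable (`[t, s[%classic `&` V k : set (measurableTypeR R)).
    by apply: measurableI => //; exact: measurable_itv.
  have [] := step t s J (`[t, s[%classic `&` V k) mJ mW JV _ ts; first by rewrite setIC.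
  move=> sub add; exists (J `|` (`[t, s[%classic `&` V k)); split => //.
  - exact: measurableU.
  - move=> x [Kx]; rewrite /= in_itv/= => xs; have [xt|tx] := ltP x t.
      by left; apply: KJ; split => //=; rewrite in_itv/=.
    right; split; first by rewrite /= in_itv/= tx.
    by exists x => //; rewrite subrr normr0 invr_gt0.
  - rewrite add [in leRHS](splitr d) EFinD leeD//.
    apply: (le_trans (lee_abs _)); apply: (le_trans (gamE _ mW)).
    apply: ltW; apply: le_lt_trans nP; apply: le_measure; rewrite ?inE//.
    move=> x [/= + _]; rewrite /F/= !in_itv/= => /andP[tx ->]; rewrite andbT.
    by apply: le_trans tx; apply: ltW.
(* Once s has reached [M + 1], beyond K, the set J contains K, and A and J differ by two sets of
   variation at most e. *)
have [sltM|Mles] := ltP s (M + 1); last first.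
  have {Mles sM} sE : s = M + 1 by apply/eqP; rewrite eq_le sM.
  have [J [mJ KJ JV Jd]] := gs e e_gt0.
  have KJ' : K `<=` J.
    move=> x Kx; apply: KJ; split => //=; rewrite in_itv/= sE.
    by have := KM _ Kx; rewrite /= in_itv/= => /andP[_ xM]; lra.
  have rAJ : rho A = (rho J + rho (A `\` J) - rho (J `\` A))%E.
    have -> : rho A = (rho (A `&` J) + rho (A `\` J))%E by rewrite addeC -chargeDI.
    have -> : rho J = (rho (J `&` A) + rho (J `\` A))%E by rewrite addeC -chargeDI.
    rewrite setIC.
    have := rfin _ (measurableI _ _ mJ mA); have := rfin _ (measurableD mJ mA); have := rfin _ (measurableD mA mJ).
    move: (rho (J `&` A)) (rho (J `\` A)) (rho (A `\` J)) => [x||]// [y||]// [z||]// _ _ _.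
    by rewrite -!EFinD; congr EFin; ring.
  have h1 : (rho (A `\` J) <= e%:E)%E.
    apply: (le_trans (lee_abs _)); apply: (le_trans (gamE _ (measurableD mA mJ))).
    apply: ltW; apply: le_lt_trans AKe; apply: le_measure; rewrite ?inE//; try exact: measurableD.
    exact: setDS.
  have h2 : (- rho (J `\` A) <= e%:E)%E.
    apply: (le_trans (lee_abs _)); rewrite abseN; apply: (le_trans (gamE _ (measurableD mJ mA))).
    apply: ltW; apply: le_lt_trans kP; apply: le_measure; rewrite ?inE//; try exact: measurableD.
    by move=> x [/JV[Vx _] nA]; split => // /KA.
  rewrite rAJ (_ : e0 = e + e + e); last by rewrite /e; field.
  by rewrite !EFinD; apply: leeD => //; apply: leeD.
exfalso.
suff [t' [st' gt']] : exists t', s < t' /\ S t'.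
  have : t' <= s by apply: ub_le_sup => //; case: supS.
  by rewrite leNgt st'.
(* At a point of K the hypothesis gives an interval of nonpositive charge, taken shorter than
   1/(k+1) to stay in [V k]. Off K there is a gap of K to the right of s, and the same J serves up
   to the end of the gap. *)
have [Ks|nKs] := pselect (K s).
  have [|y [sy ys yr]] := HA s (KA _ Ks) (Num.min (k.+1%:R^-1) (M + 1 - s)).
    by rewrite lt_min invr_gt0 ltr0n/= subr_gt0.
  have [yk yM] : y - s < k.+1%:R^-1 /\ y < M + 1.
    have := ys; rewrite -ltrBlDl lt_min => /andP[? ?]; split => //; lra.
  exists y; split => //; split; [lra|exact: ltW|].
  move=> d d0; have [J [mJ KJ JV Jd]] := gs d d0.
  have mW : measurable (`[s, y[%classic : set (measurableTypeR R)) by exact: measurable_itv.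
  have [] := step s y J `[s, y[%classic mJ mW JV _ (ltW sy).
    move=> x xsy; split => //; exists s => //.
    move: xsy; rewrite /= in_itv/= => /andP[sx xy]; rewrite ger0_norm ?subr_ge0//.
    by apply: lt_trans yk; rewrite ltrD2r.
  move=> sub add; exists (J `|` `[s, y[%classic); split => //.
  - exact: measurableU.
  - move=> x [Kx]; rewrite /= in_itv/= => xy; have [xs|sx] := ltP x s.
      by left; apply: KJ; split => //=; rewrite in_itv/=.
    by right; rewrite /= in_itv/= sx.
  - by rewrite add -[leRHS]adde0 leeD.
have : nbhs s (~` K) by apply: open_nbhs_nbhs; split => //; exact: closed_openC.
move=> /nbhs_ballP[r /= r0 rK].
pose y := s + Num.min (r / 2) (M + 1 - s).
have sy : s < y by rewrite ltrDl lt_min divr_gt0// subr_gt0.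
have yr : y < s + r by rewrite ltrD2l gt_min; apply/orP; left; lra.
have yM : y <= M + 1 by rewrite -lerBrDl ge_min lexx orbT.
exists y; split => //; split => //; first lra.
move=> d d0; have [J [mJ KJ JV Jd]] := gs d d0.
exists J; split => //.
  move=> x [Kx]; rewrite /= in_itv/= => xy; have [xs|sx] := ltP x s.
    by apply: KJ; split => //=; rewrite in_itv.
  by have := rK x _ Kx; case; rewrite -ball_normE/= ltr_norml; apply/andP; split; lra.
move=> x /JV[Vx]; rewrite /= !in_itv/= => xs; split => //=; exact: lt_trans sy.
Qed.

End covering.

(** * Smooth cut-offs *)

Section smooth.
Context (R : realType).
Implicit Types (f g : R -> R) (p : {poly R}).

(** The finite order carries the induction for products: to order k + 1, the derivative of a product
    is a sum of two products that are needed to order k. *)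
Fixpoint smooth_upto (k : nat) f : Prop :=
  if k is k'.+1 then (forall x, derivable f x 1) /\ smooth_upto k' (derive1 f) else True.

Definition smooth f := forall k, smooth_upto k f.

Lemma smooth_derivable f : smooth f -> forall k x, derivable (derive1n k f) x 1.
Proof.
move=> sf k; have := sf k.+1; elim: k f {sf} => [f [? _]//|k ih f [_ /ih H]] x.
by have := H x; rewrite /derive1n iterSr.
Qed.

Lemma smooth_derive1 f : smooth f -> smooth (derive1 f).
Proof. by move=> sf k; have [] := sf k.+1. Qed.

Lemma smooth_primitive f g : (forall x : R, is_derive x 1 f (g x)) -> smooth g -> smooth f.
Proof.
move=> fg sg [//|k]; split => [x|]; first by case: (fg x).
rewrite (_ : derive1 f = g)//; apply/funext => x; rewrite derive1E.
by have [_ ->] := fg x.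
Qed.

Lemma smooth_continuous f : smooth f -> continuous f.
Proof.
move=> sf x; apply: differentiable_continuous; apply/derivable1_diffP.
by have [] := sf 1%N.
Qed.

Lemma smooth_uptoW k f : smooth_upto k.+1 f -> smooth_upto k f.
Proof. by elim: k f => // k ih f [df /ih ?]; split. Qed.

Lemma smooth_uptoD k f g : smooth_upto k f -> smooth_upto k g -> smooth_upto k (f \+ g).
Proof.
elim: k f g => // k ih f g [df sf] [dg sg]; split => [x|]; first exact: derivableD.
rewrite (_ : derive1 _ = derive1 f \+ derive1 g); first exact: ih.
by apply/funext => x /=; rewrite !derive1E deriveD.
Qed.

Lemma smooth_uptoM k f g : smooth_upto k f -> smooth_upto k g -> smooth_upto k (f \* g).
Proof.
elim: k f g => // k ih f g [df sf] [dg sg]; split => [x|]; first exact: derivableM.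
rewrite (_ : derive1 _ = (derive1 f \* g) \+ (f \* derive1 g)).
  by apply: smooth_uptoD; apply: ih => //; apply: smooth_uptoW.
apply/funext => x /=; rewrite !derive1E deriveM// addrC; congr (_ + _).
by rewrite mulrC.
Qed.

Lemma smooth_cst (c : R) : smooth (cst c).
Proof.
move=> k; elim: k c => // k ih c; split => [x|]; first exact: derivable_cst.
rewrite (_ : derive1 _ = cst 0)//; apply/funext => x; exact: derive1_cst.
Qed.

Lemma smoothD f g : smooth f -> smooth g -> smooth (f \+ g).
Proof. by move=> sf sg k; exact: smooth_uptoD. Qed.

Lemma smoothM f g : smooth f -> smooth g -> smooth (f \* g).
Proof. by move=> sf sg k; exact: smooth_uptoM. Qed.

Lemma is_derive_affine f (c d x : R) : derivable f (c * x + d) 1 ->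
  is_derive x 1 (fun x => f (c * x + d)) (c * derive1 f (c * x + d)).
Proof.
move=> df.
have h : is_derive x 1 (fun x => c * x + d) c.
  rewrite -[X in is_derive _ _ _ X]addr0; apply: is_deriveD => /=.
  by rewrite -[X in is_derive _ _ _ X]mulr1; exact: is_deriveZ.
rewrite mulrC; apply: (@is_derive1_comp R f (fun x => c * x + d) x) => //.
by rewrite derive1E; exact: derivableP.
Qed.

Lemma smooth_affine f (c d : R) : smooth f -> smooth (fun x => f (c * x + d)).
Proof.
move=> sf k; elim: k f sf => // k ih f sf.
have df x : derivable f x 1 by have [] := sf 1%N.
split => [x|]; first by case: (is_derive_affine f c d x (df _)).
rewrite (_ : derive1 _ = cst c \* (fun x => derive1 f (c * x + d))).
  by apply: smooth_uptoM; [exact: smooth_cst|apply: ih; exact: smooth_derive1].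
by apply/funext => x; rewrite derive1E; case: (is_derive_affine f c d x (df _)).
Qed.

(** The functions p(1/x) exp(-1/x), extended by zero, are closed under differentiation: p becomes
    X^2 (p - p'). Smoothness of exp(-1/x) thus reduces to differentiability of the whole family. *)
Definition poly_exp p (x : R) : R := if 0 < x then p.[x^-1] * expR (- x^-1) else 0.

(** From exp(y) >= y^(s+1) / (s+1)! at y = 1/x with s = [size p], a power beyond the growth of p.
    Applied to X p, whose function is that of p divided by x, the bound gives the derivative 0 at
    the origin. *)
Lemma poly_exp_bound p : exists2 C : R, 0 < C & forall x, x <= 1 -> `|poly_exp p x| <= C * `|x|.
Proof.
pose S := \sum_(i < size p) `|p`_i|.
have S0 : 0 <= S by apply: sumr_ge0.
exists (S * (size p).+1`!%:R + 1); first by rewrite ltr_wpDl// mulr_ge0.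
move=> x x1; rewrite /poly_exp; case: ifPn => x0; last by rewrite normr0 mulr_ge0// addr_ge0// mulr_ge0.
have xV1 : 1 <= x^-1 by rewrite invr_ge1// ?unitf_gt0.
rewrite normrM (ger0_norm (expR_ge0 _)) (gtr0_norm x0).
have h1 : `|p.[x^-1]| <= S * x^-1 ^+ size p.
  rewrite horner_coef; apply: (le_trans (ler_norm_sum _ _ _)).
  rewrite mulr_suml; apply: ler_sum => i _.
  rewrite normrM ler_wpM2l// ger0_norm ?exprn_ge0 ?invr_ge0 ?(ltW x0)//.
  by rewrite ler_weXn2l//; apply: ltnW; exact: ltn_ord.
have h2 : x^-1 ^+ (size p) * expR (- x^-1) <= (size p).+1`!%:R * x.
  rewrite expRN ler_pdivrMr ?expR_gt0//.
  have := @expR_ge1Dxn R x^-1 (size p); rewrite invr_ge0 (ltW x0) => /(_ isT) h.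
  have h3 : x^-1 ^+ (size p).+1 / (size p).+1`!%:R <= expR x^-1 by apply: le_trans h; rewrite lerDr.
  rewrite ler_pdivrMr ?ltr0n ?fact_gt0// in h3.
  have -> : x^-1 ^+ (size p) = x * x^-1 ^+ (size p).+1 by rewrite exprS mulrA divff ?mul1r// gt_eqF.
  by rewrite [_ * x]mulrC -mulrA ler_wpM2l ?(ltW x0)// mulrC.
apply: (@le_trans _ _ (S * x^-1 ^+ size p * expR (- x^-1))).
  by rewrite ler_wpM2r// expR_ge0.
rewrite -mulrA mulrDl mul1r; apply: (@le_trans _ _ (S * ((size p).+1`!%:R * x))).
  by rewrite ler_wpM2l.
by rewrite mulrA lerDl ltW.
Qed.

Lemma is_derive_poly_exp p (x : R) :
  is_derive x 1 (poly_exp p) (poly_exp ('X^2 * (p - p^`())) x).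
Proof.
have [x0|x0|<-{x}] := ltgtP 0 x.
- have xn0 : x != 0 by rewrite gt_eqF.
  have H : is_derive x 1 (fun x => p.[x^-1] * expR (- x^-1)) (poly_exp ('X^2 * (p - p^`())) x).
    have h1 : is_derive x 1 (fun x : R => x^-1) (- x ^- 2).
      have := @is_deriveV R id x 1 1 xn0 _; rewrite /= scaler1; apply.
    have h2 : is_derive x 1 (fun x : R => p.[x^-1]) (p^`().[x^-1] * (- x ^- 2)).
      exact: (@is_derive1_comp R (horner p) (fun x : R => x^-1) x).
    have h3 : is_derive x 1 (fun x : R => expR (- x^-1)) (expR (- x^-1) * (x ^- 2)).
      apply: (@is_derive1_comp R expR (fun x : R => - x^-1) x).
      by rewrite -[x ^- 2]opprK; exact: is_deriveN.
    have := is_deriveM h2 h3.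
    rewrite (_ : _ + _ = poly_exp ('X^2 * (p - p^`())) x)// /poly_exp x0 !hornerE /GRing.scale/= -exprVn; ring.
  split.
    apply: (@near_eq_derivable _ _ _ (fun x : R => p.[x^-1] * expR (- x^-1) : R)); last by case: H.
    by near=> y; rewrite /poly_exp ifT//; near: y; exact: lt_nbhsr.
  rewrite -[RHS](@derive_val _ _ _ _ _ _ _ H); apply: near_eq_derive.
  by near=> y; rewrite /poly_exp ifT//; near: y; exact: lt_nbhsr.
- rewrite {2}/poly_exp ltNge (ltW x0)/=; split.
    apply: (@near_eq_derivable _ _ _ (cst 0)) => //.
    near=> y; rewrite /poly_exp ifN// -leNgt ltW//; near: y; exact: lt_nbhsl.
  rewrite -[RHS](@derive_cst R R R 0 x 1); apply: near_eq_derive.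
  near=> y; rewrite /poly_exp ifN// -leNgt ltW//; near: y; exact: lt_nbhsl.
- have [C C0 HC] := poly_exp_bound ('X * p).
  have H : (fun h : R => h^-1 *: (poly_exp p (h *: 1 + 0) - poly_exp p 0)) @ 0^' --> (0 : R).
    apply/cvgrPdist_le => e e0; near=> h.
    have hn0 : h != 0 by near: h; exact: nbhs_dnbhs_neq.
    have h1 : h <= 1.
      by apply: le_trans (ler_norm h) _; near: h; exact: dnbhs0_le.
    have pe0 : poly_exp p 0 = 0 by rewrite /poly_exp ltxx.
    have := HC h h1; rewrite sub0r normrN pe0 subr0 addr0 /GRing.scale/= mulr1.
    rewrite (_ : h^-1 * poly_exp p h = poly_exp ('X * p) h); last first.
      by rewrite /poly_exp; case: ifPn => _; rewrite ?mulr0// hornerM hornerX mulrA.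
    move=> /le_trans; apply; rewrite -ler_pdivlMl// mulrC.
    near: h; apply: dnbhs0_le; exact: divr_gt0.
  rewrite [X in is_derive _ _ _ X]/poly_exp ltxx; split; first by apply/cvg_ex; exists 0.
  exact: cvg_lim H.
Unshelve. all: by end_near. Qed.

Lemma smooth_poly_exp p : smooth (poly_exp p).
Proof.
move=> k; elim: k p => // k ih p; split => [x|].
  by case: (is_derive_poly_exp p x).
rewrite (_ : derive1 _ = poly_exp ('X^2 * (p - p^`())))//; apply/funext => x.
by rewrite derive1E; case: (is_derive_poly_exp p x).
Qed.

(** This is exp(-1/x) for x > 0. It stays below 1, so an indicator is reached only in the limit, by
    dilating the argument. *)
Definition step : R -> R := poly_exp 1.

Lemma smooth_step : smooth step. Proof. exact: smooth_poly_exp. Qed.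

Lemma stepE x : step x = if 0 < x then expR (- x^-1) else 0.
Proof. by rewrite /step /poly_exp hornerE mul1r. Qed.

Lemma step_ge0 x : 0 <= step x.
Proof. by rewrite stepE; case: ifP => // _; exact: expR_ge0. Qed.

Lemma step_le1 x : step x <= 1.
Proof.
by rewrite stepE; case: ifP => // x0; rewrite -expR0 ler_expR oppr_le0 invr_ge0 ltW.
Qed.

Lemma step_le0 x : x <= 0 -> step x = 0.
Proof. by rewrite stepE leNgt => /negbTE ->. Qed.

Lemma step_cvg1 (x : R^nat) : x n @[n --> \oo] --> +oo -> step (x n) @[n --> \oo] --> (1 : R).
Proof.
move=> xoo.
have H : expR (- (x n)^-1) @[n --> \oo] --> (1 : R).
  rewrite -[X in _ --> X]expR0; apply: (@continuous_cvg _ _ _ \oo _ (fun n => - (x n)^-1) expR 0); first exact: continuous_expR.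
  rewrite -oppr0; apply: cvgN.
  apply/(gtr0_cvgV0 _ (f := x)) => //.
  by near=> n; near: n; move/cvgryPgt : xoo; exact.
apply: cvg_trans H; apply: near_eq_cvg; near=> n.
by rewrite stepE ifT//; near: n; move/cvgryPgt : xoo; exact.
Unshelve. all: by end_near. Qed.

(* At x = a the first argument equals k.+1, for x < a it tends to -oo: the limit is
   the indicator of the half-open interval [a, b[. *)
Definition cutoff (a b : R) (k : nat) (x : R) : R :=
  step (k.+1%:R ^+ 2 * x + (k.+1%:R - k.+1%:R ^+ 2 * a)) * step (- k.+1%:R * x + k.+1%:R * b).

Lemma smooth_cutoff a b k : smooth (cutoff a b k).
Proof.
apply: (@smoothM (fun x => step (k.+1%:R ^+ 2 * x + (k.+1%:R - k.+1%:R ^+ 2 * a)))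
  (fun x => step (- k.+1%:R * x + k.+1%:R * b))); apply: smooth_affine; exact: smooth_step.
Qed.

Lemma cutoff_ge0 a b k x : 0 <= cutoff a b k x.
Proof. by rewrite mulr_ge0// step_ge0. Qed.

Lemma cutoff_le1 a b k x : cutoff a b k x <= 1.
Proof. by rewrite mulr_ile1// ?step_ge0// step_le1. Qed.

Lemma cutoff_supp (a b : R) k (x : R) : ~ (a - k.+1%:R^-1 <= x <= b) -> cutoff a b k x = 0.
Proof.
move=> /negP; rewrite negb_and -!ltNge => /orP[xa|xb]; rewrite /cutoff.
  rewrite (step_le0 (_ * x + (_ - _))) ?mul0r//.
  have k0 : 0 < k.+1%:R :> R by [].
  rewrite (_ : _ + _ = k.+1%:R ^+ 2 * (x - (a - k.+1%:R^-1))); last first.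
    by field; rewrite gt_eqF.
  by rewrite pmulr_rle0 ?exprn_gt0// subr_le0 ltW.
rewrite [X in _ * X]step_le0 ?mulr0// mulNr addrC -mulrBr pmulr_rle0//; lra.
Qed.

Lemma cutoff_cvg (a b x : R) : cutoff a b k x @[k --> \oo] --> (\1_(`[a, b[%classic) x : R).
Proof.
have kooM (c : R) : 0 < c -> (k.+1%:R * c : R) @[k --> \oo] --> +oo.
  move=> c0; have koo : (k.+1%:R : R) @[k --> \oo] --> +oo.
    by apply: (ger_cvgy _ cvgr_idn); near=> k; rewrite ler_nat.
  apply/cvgryPge => A; near=> k; rewrite -ler_pdivrMr//.
  by near: k; move/cvgryPge : koo; exact.
have [xa|ax] := ltP x a.
  rewrite indicE memNset; last by rewrite /= in_itv/= leNgt xa.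
  apply: cvg_near_cst; near=> k.
  apply: cutoff_supp => /andP[+ _]; apply/negP; rewrite -ltNge.
  have : k.+1%:R^-1 < a - x by near: k; apply: near_infty_natSinv_lt (PosNum _); rewrite subr_gt0.
  by rewrite ltrBrDr addrC ltrBrDr.
have [xb|bx] := ltP x b; last first.
  rewrite indicE memNset; last by rewrite /= in_itv/= ax ltNge bx.
  apply: cvg_near_cst; near=> k.
  by rewrite /cutoff [X in _ * X]step_le0 ?mulr0// mulNr addrC -mulrBr pmulr_rle0//; lra.
rewrite indicE mem_set /= ?in_itv/= ?ax//.
rewrite -[X in _ --> X]mul1r; apply: cvgM; apply: step_cvg1.
  apply: (ger_cvgy _ (kooM 1 ltr01)).
  by near=> k; rewrite mulr1 addrCA -mulrBr lerDl mulr_ge0// ?exprn_ge0// subr_ge0.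
rewrite (_ : (fun _ => _) = (fun k : nat => k.+1%:R * (b - x))).
  by apply: kooM; rewrite subr_gt0.
by apply/funext => k; rewrite mulNr addrC -mulrBr.
Unshelve. all: by end_near. Qed.

Lemma smooth_test_function (U : set R) f (a b : R) : smooth f ->
  (forall x, ~ (a <= x <= b) -> f x = 0) -> `[a, b] `<=` U -> test_function U f.
Proof.
move=> sf fab abU.
have sub : closure [set x | f x != 0] `<=` `[a, b].
  have /closure_id -> : closed (`[a, b]%classic : set R) by exact: interval_closed.
  apply: closure_subset => x /= /eqP fx; rewrite in_itv/=.
  by apply/negPn/negP => /negP h; apply: fx; exact: fab.
split; [exact: smooth_derivable| |exact: subset_trans abU].
apply: (@subclosed_compact _ _ `[a, b]) => //; [exact: closed_closure|exact: segment_compact].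
Qed.

End smooth.

(** * Integration by parts against measures *)

Section fubini.
Context (R : realType).
Notation T := (measurableTypeR R).
Context (m1 : {sigma_finite_measure set T -> \bar R}) (m2 : {sigma_finite_measure set T -> \bar R}).
Variables (g k : R -> R).
Hypothesis ig : m1.-integrable setT (EFin \o g).
Hypothesis ik : m2.-integrable setT (EFin \o k).

(** Its two iterated integrals are the two sides of the integration by parts. The strict inequality
    produces the open rays []-oo, x[] and []y, +oo[], hence left-continuous distribution
    functions. *)
Let f (z : T * T) : \bar R := if (z.2 < z.1)%R then (g z.1 * k z.2)%:E else 0%E.

Let mg : measurable_fun (setT : set T) g.
Proof. by apply/measurable_EFinP; exact: measurable_int ig. Qed.

Let mk : measurable_fun (setT : set T) k.
Proof. by apply/measurable_EFinP; exact: measurable_int ik. Qed.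

Let mf : measurable_fun setT f.
Proof.
apply: measurable_fun_ifT => //.
  by apply: measurable_fun_ltr; [exact: measurable_snd|exact: measurable_fst].
apply/measurable_EFinP; apply: measurable_funM.
  exact: (measurableT_comp mg measurable_fst).
exact: (measurableT_comp mk measurable_snd).
Qed.

Let f_l (x y : R) : f (x, y) = ((fun y => (g x * k y)%:E) \_ `]-oo, x[) y.
Proof.
rewrite /f/= patchE; case: ifPn => [yx|]; first by rewrite mem_set//= in_itv.
by move=> yx; rewrite memNset//= in_itv/=; exact/negP.
Qed.

Let f_r (x y : R) : f (x, y) = ((fun x => (g x * k y)%:E) \_ `]y, +oo[) x.
Proof.
rewrite /f/= patchE; case: ifPn => [yx|]; first by rewrite mem_set//= in_itv/= andbT.
by move=> yx; rewrite memNset//= in_itv/= andbT; exact/negP.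
Qed.

Let ikS (D : set T) : measurable D -> m2.-integrable D (EFin \o k).
Proof. by move=> mD; apply: integrableS ik. Qed.

Let igS (D : set T) : measurable D -> m1.-integrable D (EFin \o g).
Proof. by move=> mD; apply: integrableS ig. Qed.

Let inner_l (x : T) : (\int[m2]_y f (x, y) = (g x * \int[m2]_(y in `]-oo, x[) k y)%:E)%E.
Proof.
under eq_integral do rewrite f_l.
rewrite -integral_mkcond EFinM /Rintegral fineK; last first.
  by apply: integrable_fin_num => //; apply: ikS; exact: measurable_itv.
by rewrite -integralZl//; apply: ikS; exact: measurable_itv.
Qed.

Let inner_r (y : T) : (\int[m1]_x f (x, y) = (k y * \int[m1]_(x in `]y, +oo[) g x)%:E)%E.
Proof.
under eq_integral do rewrite f_r.
rewrite -integral_mkcond EFinM /Rintegral fineK; last first.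
  by apply: integrable_fin_num => //; apply: igS; exact: measurable_itv.
rewrite -integralZl//; last by apply: igS; exact: measurable_itv.
by apply: eq_integral => x _; rewrite -EFinM mulrC.
Qed.

Let intf : (m1 \x m2)%E.-integrable setT f.
Proof.
apply/integrable12ltyP => //.
have kfin : (\int[m2]_y `|(k y)%:E| \is a fin_num)%E.
  by rewrite ge0_fin_numE; [case/integrableP : ik|exact: integral_ge0].
apply: (@le_lt_trans _ _ (\int[m1]_x (`|(g x)%:E| * (\int[m2]_y `|(k y)%:E|)))%E).
  apply: ge0_le_integral => //.
  - by move=> x _; exact: integral_ge0.
  - apply: (@measurable_fun_fubini_tonelli_F _ _ _ _ _ m2 (abse \o f)) => //.
    + exact: measurableT_comp.
    + by move=> z; exact: abse_ge0.
  - apply: emeasurable_funM => //; apply: measurableT_comp => //; exact/measurable_EFinP.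
  - move=> x _; rewrite -ge0_integralZl//; last by apply: measurableT_comp => //; exact/measurable_EFinP.
    apply: ge0_le_integral => //.
    + by apply: measurableT_comp => //; apply: (measurableT_comp mf); exact: measurable_pair1.
    + apply: emeasurable_funM => //; apply: measurableT_comp => //; exact/measurable_EFinP.
    + move=> y _; rewrite /f; case: ifP => _ /=; first by rewrite normrM.
      by rewrite normr0 mule_ge0.
rewrite -(fineK kfin) ge0_integralZr//; last 2 first.
- by apply: measurableT_comp => //; exact/measurable_EFinP.
- by rewrite fineK//; exact: integral_ge0.
rewrite lte_mul_pinfty//; first exact: integral_ge0.
  rewrite ge0_fin_numE; [by case/integrableP : ig|exact: integral_ge0].
by rewrite ltry.
Qed.

Lemma integrable_fubini_left :
  m1.-integrable setT (EFin \o (fun x => g x * \int[m2]_(y in `]-oo, x[) k y)).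
Proof.
apply: eq_integrable (integrable_fubini_F intf) => // x _ /=; exact: inner_l.
Qed.

Lemma Rintegral_fubini :
  \int[m1]_x (g x * \int[m2]_(y in `]-oo, x[) k y) =
  \int[m2]_y (k y * \int[m1]_(x in `]y, +oo[) g x).
Proof.
rewrite /Rintegral; congr fine.
transitivity (\int[m1]_x \int[m2]_y f (x, y))%E.
  by apply: eq_integral => x _; rewrite inner_l.
rewrite (Fubini intf); apply: eq_integral => y _; exact: inner_r.
Qed.

End fubini.

Lemma integrable_mul_bounded d (T : measurableType d) (R : realType)
  (mu : {measure set T -> \bar R}) (D : set T) (k h : T -> R) (C : R) :
  measurable D -> mu.-integrable D (EFin \o k) -> measurable_fun D h ->
  (forall x, D x -> `|h x| <= C) -> mu.-integrable D (EFin \o (fun x => k x * h x)).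
Proof.
move=> mD ik mh hC.
have : mu.-integrable D ((EFin \o k) \* (EFin \o h))%E.
  apply: integrableMl => //; exists C; split; first exact: num_real.
  by move=> M CM x Dx /=; apply: le_trans (hC x Dx) (ltW CM).
by apply: eq_integrable => // x _ /=; rewrite EFinM.
Qed.

Section compactly_supported.
Context (R : realType).
Notation T := (measurableTypeR R).

Lemma itv_continuous_integrable (f : R -> R) (a b : R) : continuous f ->
  leb.-integrable (`[a, b]%classic : set T) (EFin \o f).
Proof.
move=> cf; apply: continuous_compact_integrable; first exact: segment_compact.
exact: continuous_subspaceT.
Qed.

Lemma supp_continuous_integrable (f : R -> R) (a b : R) : continuous f ->
  (forall x, ~ (a <= x <= b) -> f x = 0) ->
  leb.-integrable (setT : set T) (EFin \o f).
Proof.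
move=> cf f0.
rewrite (_ : EFin \o f = (EFin \o f) \_ (`[a, b]%classic)).
  apply/(integrable_mkcond _ _).1; first exact: measurable_itv.
  exact: itv_continuous_integrable.
apply/funext => x; rewrite patchE; case: ifPn => // /negP; rewrite inE/= in_itv/= => h.
by rewrite f0.
Qed.

Lemma supp_continuous_bounded (f : R -> R) (a b : R) : continuous f ->
  (forall x, ~ (a <= x <= b) -> f x = 0) -> exists2 C : R, 0 <= C & forall x, `|f x| <= C.
Proof.
move=> cf f0; have [ab|ba] := leP a b; last first.
  exists 0 => // x; rewrite f0 ?normr0// => /andP[ax xb].
  by have := le_trans ax xb; rewrite leNgt ba.
have [c _ cM] := @EVT_max R (Num.norm \o f) a b ab (continuous_subspaceT (fun x => continuous_comp (cf x) (@norm_continuous _ _ _))).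
exists `|f c| => // x; have [h|/negP h] := boolP (a <= x <= b); first by apply: cM; rewrite in_itv.
by rewrite (f0 _ h) normr0.
Qed.

Lemma supp_derive1 (f : R -> R) (a b : R) :
  (forall x, ~ (a <= x <= b) -> f x = 0) ->
  (forall x, ~ (a <= x <= b) -> derive1 f x = 0).
Proof.
move=> f0 x /negP h.
rewrite derive1E (@near_eq_derive _ _ _ f (cst 0)) ?derive_cst//.
move: h; rewrite negb_and -!ltNge => /orP[xa|bx].
  near=> y; apply: f0; apply/negP; rewrite negb_and -ltNge.
  by apply/orP; left; near: y; exact: lt_nbhsl.
near=> y; apply: f0; apply/negP; rewrite negb_and -!ltNge.
by apply/orP; right; near: y; exact: lt_nbhsr.
Unshelve. all: by end_near. Qed.

Lemma Rintegral_derive1_tail (f : R -> R) (a b y : R) :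
  (forall x, derivable f x 1) -> continuous (derive1 f) ->
  (forall x, ~ (a <= x <= b) -> f x = 0) ->
  \int[leb]_(x in (`]y, +oo[%classic : set T)) derive1 f x = - f y.
Proof.
move=> df cf f0.
pose c := Num.max y b + 1.
have yc : y < c by rewrite ltr_pwDr// le_max lexx.
have bc : b < c by rewrite ltr_pwDr// le_max lexx orbT.
have fc : f c = 0 by apply: f0 => /andP[_]; rewrite leNgt bc.
have f'0 x : c < x -> derive1 f x = 0.
  by move=> cx; apply: (supp_derive1 _ a b) => // /andP[_]; rewrite leNgt (lt_trans bc).
have -> : \int[leb]_(x in (`]y, +oo[%classic : set T)) derive1 f x =
    \int[leb]_(x in (`]y, c]%classic : set T)) derive1 f x.
  rewrite Rintegral_mkcond [RHS]Rintegral_mkcond; apply: eq_Rintegral => x _.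
  rewrite !patchE; have [yx|xy] := ltP y x; last first.
    rewrite !memNset//= in_itv/= ltNge xy//.
  rewrite mem_set/= ?in_itv/= ?yx//; have [xc|cx] := leP x c.
    by rewrite mem_set/= ?in_itv/= ?yx.
  by rewrite memNset/= ?in_itv/= ?yx ?leNgt ?cx// f'0.
rewrite Rintegral_itv_obnd_cbnd; last first.
  apply: integrableS (itv_continuous_integrable _ y c cf) => //; try exact: measurable_itv.
  by apply: subset_itvr; rewrite bnd_simp.
have dc x : {for x, continuous f} by apply: differentiable_continuous; exact/derivable1_diffP.
have LR : derivable_oo_LRcontinuous f y c.
  split => [x _|| ]; [exact: df|exact: cvg_at_right_filter (dc y)|exact: cvg_at_left_filter (dc c)].
have := @continuous_FTC2 _ (derive1 f) f y c yc (continuous_subspaceT cf) LR (fun x _ => erefl).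
by rewrite fc /Rintegral => ->; rewrite -EFinB /= sub0r.
Qed.

Lemma test_function_supp (U : set R) (f : R -> R) : test_function U f ->
  exists M : R, forall x, ~ (- M <= x <= M) -> f x = 0.
Proof.
move=> [_ cf _]; have [M [Mr MP]] := compact_bounded cf.
exists (M + 1) => x nx; apply/eqP/negPn/negP => fx; apply: nx.
have := MP (M + 1) _ x _; rewrite /= -ler_norml; apply; first by rewrite ltrDl.
exact: subset_closure.
Qed.

End compactly_supported.

Section charge_integral_test.
Context (R : realType).
Notation T := (measurableTypeR R).
Implicit Types (nu : {charge set T -> \bar R}) (f : R -> R).

(** Fubini with g = f', whose integral over []y, +oo[] is - f(y). *)
Lemma C1_supp_Rintegral (mu : {sigma_finite_measure set T -> \bar R}) (k f : R -> R) (a b : R) :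
  mu.-integrable setT (EFin \o k) ->
  (forall x, derivable f x 1) -> continuous (derive1 f) ->
  (forall x, ~ (a <= x <= b) -> f x = 0) ->
  \int[mu]_x (k x * f x) =
  - \int[leb]_(x in (setT : set T)) (derive1 f x * \int[mu]_(y in `]-oo, x[) k y).
Proof.
move=> ik df cf f0.
rewrite (Rintegral_fubini _ leb mu) //; last first.
  exact: supp_continuous_integrable cf (supp_derive1 _ _ _ _ f0).
under [in RHS]eq_Rintegral do rewrite (Rintegral_derive1_tail _ _ a b _ df cf f0).
rewrite -[RHS]mulN1r -RintegralZl//.
  by apply: eq_Rintegral => x _; rewrite mulrN mulN1r opprK.
have [C C0 HC] := supp_continuous_bounded R f a b (fun x => (differentiable_continuous ((@derivable1_diffP _ _ _ _).1 (df x)))) f0.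
apply: (integrable_mul_bounded _ _ _ _ _ _ _ C) => //.
  apply: continuous_measurable_fun => x; apply: continuousN.
  by apply: differentiable_continuous; exact/derivable1_diffP.
by move=> x _; rewrite normrN.
Qed.

(** Turns the right-hand side of a distributional derivative into a Lebesgue integral against x ->
    nu(]-oo, x[); from here on a signed measure is treated through this function. *)
Lemma charge_integral_C1 nu f (a b : R) :
  (forall x, derivable f x 1) -> continuous (derive1 f) ->
  (forall x, ~ (a <= x <= b) -> f x = 0) ->
  charge_integral nu f =
  - \int[leb]_(x in (setT : set T)) (derive1 f x * fine (nu `]-oo, x[%classic)).
Proof.
move=> df cf f0; 
(* The formula is proved for every Hahn decomposition, in particular for the one chosen inside
   [charge_integral]; the two Jordan parts then recombine to [nu]. *)
suff H P N (PN : hahn_decomposition nu P N) :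
    \int[jordan_pos PN]_x f x - \int[jordan_neg PN]_x f x =
    - \int[leb]_(x in (setT : set T)) (derive1 f x * fine (nu `]-oo, x[%classic)).
  exact: H.
have h (mu : {finite_measure set T -> \bar R}) : \int[mu]_x f x =
   - \int[leb]_(x in (setT : set T)) (derive1 f x * fine (mu `]-oo, x[%classic)).
  have i1 : mu.-integrable setT (EFin \o (cst 1 : R -> R)) by exact: finite_measure_integrable_cst.
  have := C1_supp_Rintegral mu (cst 1) f a b i1 df cf f0.
  under eq_Rintegral do rewrite mul1r.
  move=> ->; congr (- _); apply: eq_Rintegral => x _.
  by rewrite Rintegral_cst ?mul1r//; exact: measurable_itv.
have i (mu : {finite_measure set T -> \bar R}) : leb.-integrable (setT : set T)
   (EFin \o (fun x => derive1 f x * fine (mu `]-oo, x[%classic))).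
  have i1 : mu.-integrable setT (EFin \o (cst 1 : R -> R)) by exact: finite_measure_integrable_cst.
  have i2 := supp_continuous_integrable _ _ _ _ cf (supp_derive1 _ _ _ _ f0).
  apply: eq_integrable (integrable_fubini_left _ leb mu _ _ i2 i1) => // x _ /=.
  by rewrite Rintegral_cst ?mul1r//; exact: measurable_itv.
rewrite !h -opprD -RintegralB//; congr (- _); apply: eq_Rintegral => x _.
rewrite -mulrBr -fineB.
- by congr (_ * fine _); rewrite (jordan_decomp PN) ?/cadd/= ?cscaleN1//; exact: measurable_itv.
- by apply: fin_num_measure; exact: measurable_itv.
- by apply: fin_num_measure; exact: measurable_itv.
Qed.

End charge_integral_test.

(** * Dominated convergence and pointwise signs from integrals *)

Section dct.
Context d (T : measurableType d) (R : realType) (mu : {measure set T -> \bar R}).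

Lemma Rintegral_dct (D : set T) (f_ : nat -> T -> R) (f G : T -> R) :
  measurable D -> (forall k, measurable_fun D (f_ k)) ->
  (forall x, D x -> f_ k x @[k --> \oo] --> f x) ->
  mu.-integrable D (EFin \o G) -> (forall k x, D x -> `|f_ k x| <= G x) ->
  mu.-integrable D (EFin \o f) /\
  \int[mu]_(x in D) f_ k x @[k --> \oo] --> \int[mu]_(x in D) f x.
Proof.
move=> mD mf cf iG fG.
have mf' : measurable_fun D f by exact: measurable_fun_cvg mf cf.
have H := @dominated_convergence _ _ _ mu D mD (fun k => EFin \o f_ k) (EFin \o f) (EFin \o G).
have [] := H.
- by move=> k; exact/measurable_EFinP.
- exact/measurable_EFinP.
- apply: aeW => x Dx; apply: cvg_EFin; [exact: nearW|exact: cf].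
- exact: iG.
- by apply: aeW => x k Dx; rewrite lee_fin fG.
move=> ifi _ cv; split => //; rewrite /Rintegral.
by apply: fine_cvg; rewrite fineK//; exact: integrable_fin_num.
Qed.

Lemma ae_le0_of_le0_integral (A : set T) (g : T -> R) : measurable A ->
  mu.-integrable setT (EFin \o g) ->
  (forall B, measurable B -> B `<=` A -> (\int[mu]_(x in B) (g x)%:E <= 0)%E) ->
  {ae mu, forall x, A x -> g x <= 0}.
Proof.
move=> mA ig H.
have mg : measurable_fun setT g by apply/measurable_EFinP; exact: measurable_int ig.
pose B := A `&` [set x | 0 < g x].
have mB : measurable B.
  apply: measurableI => //; rewrite -[X in measurable X]setTI.
  by apply: measurable_fun_ltr => //; exact: measurable_cst.
have igB : mu.-integrable B (EFin \o g) by apply: integrableS ig.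
have i0 : (\int[mu]_(x in B) `|(g x)%:E| = 0)%E.
  apply/eqP; rewrite eq_le integral_ge0// andbT.
  apply: le_trans (H B mB _); last by move=> x [].
  rewrite (eq_integral (EFin \o g)) // => x; rewrite inE => -[_ /= gx].
  by rewrite gtr0_norm.
have /ae_eq_integral_abs := i0.
move=> /(_ mB (measurable_int _ igB)); apply: filterS => x h Ax.
rewrite leNgt; apply/negP => gx.
by have /eqP := h (conj Ax gx); rewrite eqe gt_eqF.
Qed.

End dct.

Section intervals.
Context (R : realType).
Notation T := (measurableTypeR R).
Context (mu : {measure set T -> \bar R}).

(** The covering lemma, applied to the charge with density g, passes from the intervals to all Borel
    subsets of A. *)
Lemma ae_le0_of_right_itv (A : set T) (g : R -> R) : measurable A ->
  mu.-integrable setT (EFin \o g) ->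
  (forall x, A x -> forall e, 0 < e -> exists y : R, [/\ x < y, y < x + e &
     \int[mu]_(z in (`[x, y[%classic : set T)) g z <= 0]) ->
  {ae mu, forall x, A x -> g x <= 0}.
Proof.
move=> mA ig HA; apply: ae_le0_of_le0_integral => // B mB BA.
have := charge_le0_of_right_itv R (induced_charge ig : {charge set T -> \bar R}) B mB.
apply => x Bx e e0; have [y [xy ye H]] := HA x (BA _ Bx) e e0.
exists y; split => //; rewrite /induced_charge/= -[X in (X <= _)%E]fineK ?lee_fin//.
apply: integrable_fin_num; first exact: measurable_itv.
by apply: integrableS ig => //; exact: measurable_itv.
Qed.

Lemma measurable_cutoff (D : set T) (a b : R) k : measurable_fun D (cutoff R a b k).
Proof.
by apply: measurable_funTS; apply: continuous_measurable_fun; apply: smooth_continuous; exact: smooth_cutoff.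
Qed.

Lemma cutoff_Rintegral (D : set T) (g : R -> R) (a b : R) : measurable D ->
  mu.-integrable D (EFin \o g) ->
  \int[mu]_(x in D) (g x * cutoff R a b k x) @[k --> \oo] -->
  \int[mu]_(x in D) (g x * \1_(`[a, b[%classic) x).
Proof.
move=> mD ig; have mg : measurable_fun D g by apply/measurable_EFinP; exact: measurable_int ig.
have [|x Dx|||] := @Rintegral_dct _ T R mu D (fun k x => g x * cutoff R a b k x)
  (fun x => g x * \1_(`[a, b[%classic) x) (fun x => `|g x|) mD.
- by move=> k; apply: measurable_funM => //; exact: measurable_cutoff.
- by apply: cvgM; [exact: cvg_cst|exact: cutoff_cvg].
- exact: integrable_norm.
- move=> k x Dx; rewrite normrM ler_piMr// ger0_norm ?cutoff_ge0//; exact: cutoff_le1.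
- by [].
Qed.

Lemma Rintegral_indic (D : set T) (g : R -> R) (A : set T) :
  \int[mu]_(x in D) (g x * \1_A x) = \int[mu]_(x in D `&` A) g x.
Proof.
rewrite Rintegral_mkcondr; apply: eq_Rintegral => x _.
by rewrite patchE indicE; case: ifPn => _; rewrite ?mulr1 ?mulr0.
Qed.

End intervals.

(** * Functions with vanishing distributional derivative *)

Section du_bois_reymond.
Context (R : realType).
Notation T := (measurableTypeR R).

Lemma lebesgue_measure_co (x y : R) : x <= y ->
  @lebesgue_measure R (`[x, y[%classic : set T) = (y - x)%:E.
Proof.
have -> := @lebesgue_measure_itv R `[x, y[.
by rewrite /= lte_fin le_eqVlt => /predU1P[->|->//]; rewrite ltxx subrr.
Qed.

Lemma lebesgue_measure_oo (x y : R) : x <= y ->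
  @lebesgue_measure R (`]x, y[%classic : set T) = (y - x)%:E.
Proof.
have -> := @lebesgue_measure_itv R `]x, y[.
by rewrite /= lte_fin le_eqVlt => /predU1P[->|->//]; rewrite ltxx subrr.
Qed.

Lemma bounded_integrable_oo (x y : R) (f : R -> R) (C : R) : x <= y ->
  measurable_fun (`]x, y[%classic : set T) f -> (forall t, x < t < y -> `|f t| <= C) ->
  leb.-integrable (`]x, y[%classic : set T) (EFin \o f).
Proof.
move=> xy mf fC; apply: measurable_bounded_integrable => //.
  by apply: le_lt_trans (ltry (y - x)); rewrite -(lebesgue_measure_oo _ _ xy); exact: lexx.
exists C; split; first exact: num_real.
move=> M CM t /=; rewrite in_itv/= => txy; apply: le_trans (fC _ txy) (ltW CM).
Qed.

(** The zero mean makes the primitive vanish to the right of the support as well as to the left. *)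
Lemma primitive_smooth (th : R -> R) (a b : R) : smooth R th ->
  (forall x, ~ (a <= x <= b) -> th x = 0) ->
  \int[leb]_(x in (setT : set T)) th x = 0 ->
  exists f, [/\ smooth R f, derive1 f = th & forall x, ~ (a <= x <= b) -> f x = 0].
Proof.
move=> sth th0 ith0.
have cth := smooth_continuous _ _ sth.
have ith := supp_continuous_integrable _ _ _ _ cth th0.
pose f x := \int[leb]_(t in (`]-oo, x]%classic : set T)) th t.
have df x : derivable f x 1 /\ derive1 f x = th x.
  have [||||] := @continuous_FTC1 _ th -oo%O x (x + 1).
  - by rewrite ltrDl.
  - by apply: integrableS ith => //; exact: measurable_itv.
  - by rewrite ltNyr.
  - exact: cth.
  - by [].
have fE : derive1 f = th by apply/funext => x; case: (df x).
have is_df (x : R) : is_derive x 1 f (th x).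
  by have [d1 d2] := df x; rewrite -d2 derive1E; exact: derivableP.
exists f; split => //; first exact: (smooth_primitive _ _ th).
move=> x /negP; rewrite negb_and -!ltNge => /orP[xa|bx].
  rewrite /f; transitivity (\int[leb]_(t in (`]-oo, x]%classic : set T)) (0 : R)); last first.
    by rewrite Rintegral_cst ?mul0r//; exact: measurable_itv.
  apply: eq_Rintegral => t /set_mem; rewrite /= in_itv/= => tx; apply: th0 => /andP[+ _].
  by rewrite leNgt (le_lt_trans tx).
rewrite /f -[RHS]ith0 Rintegral_mkcond; apply: eq_Rintegral => t _.
rewrite patchE; case: ifPn => // /negP; rewrite inE/= in_itv/= => /negP; rewrite -ltNge => xt.
by rewrite th0// => /andP[_]; rewrite leNgt (lt_trans bx).
Qed.

(** Test functions whose derivatives approximate a zero-mean combination of the indicators of two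
    intervals show that the integral of g over an interval is proportional to its length. The
    covering lemma then compares g pointwise with the constant of proportionality. *)
Lemma du_bois_reymond (a b : R) (g : R -> R) : a < b ->
  leb.-integrable (`]a, b[%classic : set T) (EFin \o g) ->
  (forall psi, test_function `]a, b[ psi ->
     \int[leb]_(x in (`]a, b[%classic : set T)) (g x * derive1 psi x) = 0) ->
  exists C : R, {ae (@lebesgue_measure R), forall x, `]a, b[%classic x -> g x = C}.
Proof.
move=> ab ig Hg.
have mD : measurable (`]a, b[%classic : set T) by exact: measurable_itv.
have i1 : leb.-integrable (`]a, b[%classic : set T) (EFin \o (cst 1 : R -> R)).
  by apply: (bounded_integrable_oo _ _ _ 1) => //; [exact: ltW|move=> t _; rewrite normr1].
have supp_cutoff (x y : R) : a < x -> y < b ->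
    \forall k \near \oo, forall z, ~ ((a + x) / 2 <= z <= y) -> cutoff R x y k z = 0.
  move=> ax yb; near=> k => z nz; apply: cutoff_supp => /andP[xz zy]; apply: nz; rewrite zy andbT.
  have : k.+1%:R^-1 < (x - a) / 2.
    by near: k; apply: near_infty_natSinv_lt (PosNum _); rewrite divr_gt0// subr_gt0.
  by move: xz; set v := _^-1 => xz hv; lra.
have key (x1 y1 x2 y2 : R) : a < x1 -> y1 < b -> a < x2 -> y2 < b ->
  \int[leb]_(x in (`]a, b[%classic : set T)) (1 * \1_(`[x2, y2[%classic) x) *
  \int[leb]_(x in (`]a, b[%classic : set T)) (g x * \1_(`[x1, y1[%classic) x) =
  \int[leb]_(x in (`]a, b[%classic : set T)) (1 * \1_(`[x1, y1[%classic) x) *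
  \int[leb]_(x in (`]a, b[%classic : set T)) (g x * \1_(`[x2, y2[%classic) x).
  move=> ax1 yb1 ax2 yb2.
  have c11 := cutoff_Rintegral R leb _ _ x1 y1 mD i1.
  have c12 := cutoff_Rintegral R leb _ _ x2 y2 mD i1.
  have cg1 := cutoff_Rintegral R leb _ _ x1 y1 mD ig.
  have cg2 := cutoff_Rintegral R leb _ _ x2 y2 mD ig.
  have L := cvgM c12 cg1.
  have L' := cvgM c11 cg2.
  apply: (@cvg_unique _ (@Rhausdorff R) _ _ _ _ (L _)); apply: cvg_trans (L' _); apply: near_eq_cvg; near=> k.
  have s1 : forall z, ~ ((a + x1) / 2 <= z <= y1) -> cutoff R x1 y1 k z = 0 by near: k; exact: supp_cutoff.
  have s2 : forall z, ~ ((a + x2) / 2 <= z <= y2) -> cutoff R x2 y2 k z = 0 by near: k; exact: supp_cutoff.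
  rewrite /=.
  set I1 := (X in X * _ = _); set I2 := (X in _ = X * _).
  pose al := Num.min ((a + x1) / 2) ((a + x2) / 2).
  pose be := Num.max y1 y2.
  have s1' z : ~ (al <= z <= be) -> cutoff R x1 y1 k z = 0.
    move=> nz; apply: s1 => /andP[h1 h2]; apply: nz.
    by rewrite ge_min h1/= le_max h2.
  have s2' z : ~ (al <= z <= be) -> cutoff R x2 y2 k z = 0.
    move=> nz; apply: s2 => /andP[h1 h2]; apply: nz.
    by rewrite ge_min h1 orbT/= le_max h2 orbT.
  have sub : `[al, be] `<=` `]a, b[.
    apply: subset_itv; rewrite bnd_simp.
      by rewrite lt_min; apply/andP; split; lra.
    by rewrite gt_max yb1.
  have iT c (cc : continuous c) : (forall z, ~ (al <= z <= be) -> c z = 0) ->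
      \int[leb]_(x in (`]a, b[%classic : set T)) c x = \int[leb]_(x in (setT : set T)) c x.
    move=> cz; rewrite Rintegral_mkcond; apply: eq_Rintegral => z _; rewrite patchE.
    case: ifPn => // /negP; rewrite inE => nz; rewrite cz// => hz; apply: nz.
    by apply: sub; rewrite /= in_itv.
  (* The weights make the integral of [th] vanish, so that it has a compactly supported primitive,
     admissible as a test function. *)
  pose th z := I2 * cutoff R x1 y1 k z + (- I1) * cutoff R x2 y2 k z.
  have sth : smooth R th.
    apply: (@smoothD R (fun z => I2 * cutoff R x1 y1 k z) (fun z => (- I1) * cutoff R x2 y2 k z)).
      by apply: (@smoothM R (cst I2)); [exact: smooth_cst|exact: smooth_cutoff].
    by apply: (@smoothM R (cst (- I1))); [exact: smooth_cst|exact: smooth_cutoff].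
  have th0 z : ~ (al <= z <= be) -> th z = 0.
    by move=> nz; rewrite /th s1'// s2'// !mulr0 addr0.
  have ic1 (h : R -> R) x y : leb.-integrable (`]a, b[%classic : set T) (EFin \o h) ->
     leb.-integrable (`]a, b[%classic : set T) (EFin \o (fun z => h z * cutoff R x y k z)).
    move=> ih; apply: (integrable_mul_bounded _ _ _ _ _ _ _ 1) => //; first exact: measurable_cutoff.
    by move=> z _; rewrite ger0_norm ?cutoff_ge0//; exact: cutoff_le1.
  have lin (h : R -> R) : leb.-integrable (`]a, b[%classic : set T) (EFin \o h) ->
    \int[leb]_(x in (`]a, b[%classic : set T)) (h x * th x) =
    I2 * \int[leb]_(x in (`]a, b[%classic : set T)) (h x * cutoff R x1 y1 k x) +
    (- I1) * \int[leb]_(x in (`]a, b[%classic : set T)) (h x * cutoff R x2 y2 k x).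
    move=> ih; rewrite -!RintegralZl//; try exact: ic1.
    have iZ (s : R) (k0 : R -> R) : leb.-integrable (`]a, b[%classic : set T) (EFin \o k0) ->
        leb.-integrable (`]a, b[%classic : set T) (EFin \o (fun z => s * k0 z)).
      by move=> ik; apply: eq_integrable (integrableZl mD s ik).
    rewrite -RintegralD//; last 2 first.
    - by apply: iZ; exact: ic1.
    - by apply: iZ; exact: ic1.
    by apply: eq_Rintegral => x _; rewrite /th; ring.
  have ith0 : \int[leb]_(x in (setT : set T)) th x = 0.
    rewrite -iT//; last exact: smooth_continuous.
    under eq_Rintegral do rewrite -[th _]mul1r.
    by rewrite (lin (cst 1))// -/I1 -/I2; ring.
  have [f [sf fE f0]] := primitive_smooth _ _ _ sth th0 ith0.
  have := Hg f (smooth_test_function _ _ _ _ _ sf f0 sub).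
  rewrite fE lin// => h; apply/eqP; rewrite eq_sym -subr_eq0 -mulNr; apply/eqP; exact: h.
have [x0 [y0 [ax0 xy0 yb0]]] : exists x0 y0, [/\ a < x0, x0 < y0 & y0 < b].
  by exists ((a + a + b) / 3), ((a + b + b) / 3); split; lra.
pose I0 := \int[leb]_(x in (`]a, b[%classic : set T)) (1 * \1_(`[x0, y0[%classic) x).
pose C := \int[leb]_(x in (`]a, b[%classic : set T)) (g x * \1_(`[x0, y0[%classic) x) / I0.
have len (x y : R) : a < x -> x < y -> y < b ->
   \int[leb]_(z in (`]a, b[%classic : set T)) (1 * \1_(`[x, y[%classic) z) = y - x.
  move=> ax xy yb; rewrite Rintegral_indic setIidr; last first.
    by apply: subset_itv; rewrite bnd_simp// ltW.
  rewrite Rintegral_cst; last exact: measurable_itv.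
  by have := lebesgue_measure_co _ _ (ltW xy) => /= ->; rewrite mul1r.
have I0n : I0 != 0 by rewrite /I0 len// gt_eqF// subr_gt0.
exists C.
have iC : leb.-integrable (`]a, b[%classic : set T) (EFin \o (cst C : R -> R)).
  by apply: (bounded_integrable_oo _ _ _ `|C|) => //; exact: ltW.
have z (s : R) : leb.-integrable (setT : set T) (EFin \o ((fun x => s * (g x - C)) \_ `]a, b[)).
  rewrite -restrict_EFin; apply/(integrable_mkcond _ _).1 => //.
  apply: eq_integrable (integrableZl mD s (integrableB mD ig iC)) => // x _ /=.
(* The integral of g - C over short intervals is zero, so the one-sided criterion applies both for s
   = 1 and for s = -1. *)
have ae (s : R) : {ae leb, forall x, (`]a, b[%classic : set T) x -> ((fun x => s * (g x - C)) \_ `]a, b[) x <= 0}.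
  apply: ae_le0_of_right_itv => // x; rewrite /= in_itv/= => /andP[ax xb] e e0.
  pose y := x + Num.min (e / 2) ((b - x) / 2).
  have xy : x < y by rewrite ltrDl lt_min !divr_gt0// subr_gt0.
  have yb : y < b by apply: (@le_lt_trans _ _ (x + (b - x) / 2)); [rewrite lerD2l ge_min lexx orbT|lra].
  have ye : y < x + e by apply: (@le_lt_trans _ _ (x + e / 2)); [rewrite lerD2l ge_min lexx|lra].
  exists y; split => //.
  have sub : `[x, y[ `<=` `]a, b[ by apply: subset_itv; rewrite bnd_simp// ltW.
  have mJ : measurable (`[x, y[%classic : set T) by exact: measurable_itv.
  under eq_Rintegral => t /set_mem tJ do rewrite patchE (mem_set (sub _ tJ)).
  have igJ : leb.-integrable (`[x, y[%classic : set T) (EFin \o g) by apply: integrableS ig.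
  have iCJ : leb.-integrable (`[x, y[%classic : set T) (EFin \o (cst C : R -> R)) by apply: integrableS iC.
  rewrite RintegralZl//; last first.
    apply: eq_integrable (integrableB mJ igJ iCJ) => // x1 _ /=.
  rewrite RintegralB// Rintegral_cst//; have := lebesgue_measure_co _ _ (ltW xy) => /= ->.
  have := key x y x0 y0 ax yb ax0 yb0; rewrite (len x y)// -/I0 => kE.
  have -> : \int[leb]_(x1 in `[x, y[%classic) g x1 = (y - x) * C.
    rewrite /C mulrA -kE mulrAC divff// mul1r Rintegral_indic setIidr//.
  by rewrite [C * _]mulrC subrr mulr0.
have a1 := ae 1; have a2 := ae (-1).
move: a1 a2; apply: filterS2 => x h1 h2 Dx.
have := h1 Dx; have := h2 Dx; rewrite !patchE mem_set//.
by move=> ? ?; apply/eqP; rewrite eq_le; apply/andP; split; lra.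
Unshelve. all: by end_near. Qed.

End du_bois_reymond.

(** * The integrand *)

Section enorm.
Context (R : realType) (n : nat).
Implicit Types (p q : 'rV[R]_n).

Definition dot p q : R := \sum_(i < n) p ord0 i * q ord0 i.

Lemma enorm_ge0 p : 0 <= enorm p. Proof. exact: sqrtr_ge0. Qed.

Lemma enorm_sq p : enorm p ^+ 2 = dot p p.
Proof.
rewrite sqr_sqrtr; last by apply: sumr_ge0 => i _; exact: sqr_ge0.
by apply: eq_bigr => i _; rewrite expr2.
Qed.

Lemma dotC p q : dot p q = dot q p.
Proof. by apply: eq_bigr => i _; rewrite mulrC. Qed.

Lemma dotDr p q r : dot p (q + r) = dot p q + dot p r.
Proof. by rewrite -big_split; apply: eq_bigr => i _; rewrite mxE mulrDr. Qed.

Lemma dotZr p (a : R) q : dot p (a *: q) = a * dot p q.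
Proof. by rewrite mulr_sumr; apply: eq_bigr => i _; rewrite mxE; ring. Qed.

Lemma dotBr p q r : dot p (q - r) = dot p q - dot p r.
Proof. by rewrite dotDr -scaleN1r dotZr mulN1r. Qed.

Lemma dotDl p q r : dot (p + q) r = dot p r + dot q r.
Proof. by rewrite dotC dotDr ![dot r _]dotC. Qed.

Lemma dotZl p (a : R) q : dot (a *: p) q = a * dot p q.
Proof. by rewrite dotC dotZr dotC. Qed.

Lemma dotBl p q r : dot (p - q) r = dot p r - dot q r.
Proof. by rewrite dotC dotBr ![dot r _]dotC. Qed.

Lemma dot_ge0 p : 0 <= dot p p.
Proof. by rewrite -enorm_sq sqr_ge0. Qed.

Lemma enorm_coord p i : `|p ord0 i| <= enorm p.
Proof.
rewrite -[leLHS]ger0_norm// -ler_sqr ?nnegrE ?enorm_ge0// ger0_norm// enorm_sq -normrX ger0_norm ?sqr_ge0//.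
by rewrite /dot (bigD1 i)//= expr2 lerDl; apply: sumr_ge0 => j _; rewrite -expr2 sqr_ge0.
Qed.

Lemma enorm_le_sum p : enorm p <= \sum_(i < n) `|p ord0 i|.
Proof.
have S0 : 0 <= \sum_(i < n) `|p ord0 i| by exact: sumr_ge0.
rewrite -ler_sqr ?nnegrE ?enorm_ge0// enorm_sq expr2 mulr_suml; apply: ler_sum => i _.
apply: le_trans (ler_norm _) _; rewrite normrM ler_wpM2l//.
by rewrite (bigD1 i)//= lerDl; exact: sumr_ge0.
Qed.

Lemma dot_enorm p q : dot p q <= enorm p * enorm q.
Proof.
have [q0|q0] := eqVneq (dot q q) 0.
  have qi i : q ord0 i = 0.
    apply/eqP; rewrite -normr_eq0 eq_le normr_ge0 andbT.
    apply: le_trans (enorm_coord q i) _.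
    by rewrite -ler_sqr ?nnegrE ?enorm_ge0// enorm_sq q0 expr0n.
  by rewrite /dot big1 ?mulr_ge0 ?enorm_ge0// => i _; rewrite qi mulr0.
have qq : 0 < dot q q by rewrite lt_def q0 dot_ge0.
have := dot_ge0 (p - (dot p q / dot q q) *: q).
rewrite dotBr !dotBl !dotZr !dotZl (dotC q p) => H.
have H2 : dot p q ^+ 2 <= dot p p * dot q q.
  rewrite -ler_pdivrMr//; move: H; set x := dot p q; set y := dot q q in q0 *.
  have -> : x / y * x = x ^+ 2 / y by ring.
  by have -> : x / y * (x / y * y) = x ^+ 2 / y; [field|lra].
have [d0|d0] := leP (dot p q) 0; first by apply: le_trans d0 _; rewrite mulr_ge0 ?enorm_ge0.
by rewrite -ler_sqr ?nnegrE ?(ltW d0) ?mulr_ge0 ?enorm_ge0// exprMn !enorm_sq.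
Qed.

Lemma enorm0 : enorm (0 : 'rV[R]_n) = 0.
Proof. by rewrite /enorm big1 ?sqrtr0// => i _; rewrite mxE expr0n. Qed.

Lemma enorm_gt0 p : p != 0 -> 0 < enorm p.
Proof.
move=> p0; rewrite lt_def enorm_ge0 andbT; apply: contra p0 => /eqP e0.
apply/eqP/rowP => i; rewrite mxE; apply/eqP; rewrite -normr_eq0 eq_le normr_ge0 andbT.
by rewrite -e0 enorm_coord.
Qed.

Lemma enorm_le_normr p : enorm p <= n%:R * `|p|.
Proof.
apply: le_trans (enorm_le_sum p) _.
rewrite mulr_natl -[X in _ *+ X]card_ord -sumr_const; apply: ler_sum => i _.
by rewrite [leRHS]/Num.norm/= mx_normrE; apply: (le_bigmax _ (fun ij => `|p ij.1 ij.2|) (ord0, i)).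
Qed.

End enorm.

Lemma convex_functionE (R : realType) (E : lmodType R) (D : set E) (f : E -> R) :
  convex_function D f -> forall (t : R) x y, D x -> D y -> 0 <= t <= 1 ->
  f (t *: x + (1 - t) *: y) <= t * f x + (1 - t) * f y.
Proof.
move=> cf t x y Dx Dy /andP[t0 t1].
have := cf (Itv01 t0 t1) x y; rewrite !inE => /(_ Dx Dy).
by rewrite /conv/=.
Qed.

Section anisotropy.
Context (R : realType) (n : nat) (phi : 'rV[R]_n -> R).
Hypothesis aphi : anisotropy phi.
Implicit Types (p q : 'rV[R]_n).

Lemma anisotropy_ge0 p : 0 <= phi p. Proof. by case: aphi. Qed.

Lemma anisotropyZ (t : R) p : 0 <= t -> phi (t *: p) = t * phi p.
Proof. by case: aphi => _ _; apply. Qed.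

Lemma anisotropy0 : phi 0 = 0.
Proof. by rewrite -(scale0r 0) anisotropyZ// mul0r. Qed.

Lemma anisotropyD p q : phi (p + q) <= phi p + phi q.
Proof.
have [_ cphi _] := aphi.
have h2 : 0 <= (2^-1 : R) <= 1 by apply/andP; split; lra.
have := convex_functionE _ _ _ _ cphi 2^-1 p q I I h2.
rewrite (_ : 1 - 2^-1 = 2^-1 :> R); last by field.
rewrite -scalerDr anisotropyZ; last by lra.
lra.
Qed.

Lemma anisotropy_sum (J : Type) (s : seq J) (p : J -> 'rV[R]_n) :
  phi (\sum_(i <- s) p i) <= \sum_(i <- s) phi (p i).
Proof.
elim: s => [|i s ih]; first by rewrite !big_nil anisotropy0.
by rewrite !big_cons (le_trans (anisotropyD _ _))// lerD2l.
Qed.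

Lemma anisotropy_bound : exists2 C : R, 0 <= C & forall p, phi p <= C * enorm p.
Proof.
pose e i : 'rV[R]_n := delta_mx ord0 i.
(* Both signs appear because phi is only positively homogeneous and need not be even. *)
exists (\sum_(i < n) (phi (e i) + phi (- e i))).
  by apply: sumr_ge0 => i _; rewrite addr_ge0 ?anisotropy_ge0.
move=> p; rewrite {1}(row_sum_delta p) (le_trans (anisotropy_sum _ _ _))//.
rewrite mulr_suml; apply: ler_sum => i _.
apply: (@le_trans _ _ (`|p ord0 i| * (phi (e i) + phi (- e i)))); last first.
  by rewrite mulrC ler_wpM2l ?addr_ge0 ?anisotropy_ge0// enorm_coord.
have [pi0|pi0] := leP 0 (p ord0 i).
  by rewrite anisotropyZ// ger0_norm// ler_wpM2l// lerDl anisotropy_ge0.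
rewrite -[_ *: _]opprK -scaleNr -scalerN anisotropyZ ?oppr_ge0 ?(ltW pi0)// ltr0_norm//.
by rewrite ler_wpM2l ?oppr_ge0 ?(ltW pi0)// lerDr anisotropy_ge0.
Qed.

Lemma cminus_le p : cminus phi * enorm p <= phi p.
Proof.
have [->|p0] := eqVneq p 0; first by rewrite enorm0 mulr0 anisotropy_ge0.
rewrite -ler_pdivlMr ?enorm_gt0//; apply: ge_inf; last by exists p.
by exists 0 => _ [q _ <-]; rewrite divr_ge0 ?anisotropy_ge0 ?enorm_ge0.
Qed.

Lemma cminus_le_cplus : (1 <= n)%N -> cminus phi <= cplus phi.
Proof.
move=> n1; pose p : 'rV[R]_n := delta_mx ord0 (Ordinal n1).
have p0 : p != 0.
  by apply/eqP => /rowP/(_ (Ordinal n1)); rewrite !mxE !eqxx => /eqP; rewrite oner_eq0.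
apply: (@le_trans _ _ (phi p / enorm p)); first by rewrite ler_pdivlMr ?enorm_gt0// cminus_le.
have [C C0 HC] := anisotropy_bound.
apply: ub_le_sup; last by exists p.
by exists C => _ [q q0 <-]; rewrite ler_pdivrMr ?enorm_gt0.
Qed.

Lemma ratio_ge1 : (1 <= n)%N -> coercive phi -> 1 <= (cplus phi / cminus phi) ^+ 2.
Proof.
move=> n1 cphi; have h := cminus_le_cplus n1.
have : 1 <= cplus phi / cminus phi by rewrite ler_pdivlMr ?mul1r.
by move=> h1; rewrite exprn_ege1.
Qed.

End anisotropy.

Section integrand.
Context (R : realType) (f : R -> R).
Hypothesis f_ge0 : forall t, 0 <= t -> 0 <= f t.
Hypothesis f_convex : convex_function (`[0, +oo[%classic : set R) f.
Hypothesis f_nd : forall s t, 0 <= s -> s <= t -> f s <= f t.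
Hypothesis f_growth : linear_growth f.

Lemma convex_slope (s t r : R) : 0 <= s -> s < t -> t < r ->
  (f t - f s) / (t - s) <= (f r - f t) / (r - t).
Proof.
move=> s0 st tr.
have r0 : 0 <= r by lra.
have h : 0 <= (r - t) / (r - s) <= 1.
  by rewrite divr_ge0 ?subr_ge0//=; [rewrite ler_pdivrMr; lra|lra|lra].
have := convex_functionE _ _ _ _ f_convex ((r - t) / (r - s)) s r _ _ h.
rewrite /= !in_itv/= s0 r0 => /(_ isT isT).
have rs : r - s != 0 by rewrite gt_eqF// subr_gt0; lra.
rewrite /GRing.scale/=.
have -> : (r - t) / (r - s) * s + (1 - (r - t) / (r - s)) * r = t by field.
have -> : (r - t) / (r - s) * f s + (1 - (r - t) / (r - s)) * f r =
   ((r - t) * f s + (t - s) * f r) / (r - s) by field.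
rewrite ler_pdivlMr; last by lra.
by move=> H; rewrite ler_pdivrMr ?subr_gt0// mulrAC ler_pdivlMr ?subr_gt0//; lra.
Qed.

Definition slopes := [set m : R | exists s t, [/\ 0 <= s, s < t & m = (f t - f s) / (t - s)]].

Lemma slopes_has_sup : has_sup slopes.
Proof.
split; first by exists ((f 1 - f 0) / (1 - 0)), 0, 1.
have [Cm [Cp [Bm [Bp [Cm0 Cp0 H]]]]] := f_growth.
exists Cp => _ [s [t [s0 st ->]]].
set m := _ / _; rewrite leNgt; apply/negP => mC.
have t0 : 0 <= t by lra.
have mC0 : 0 < m - Cp by lra.
(* A chord of slope m > Cp ending at t forces f(t + d) >= f(t) + m d; the distance d is chosen so
   that this exceeds Cp (t + d) + Bp. *)
pose K := `|Bp| + `|f t| + Cp * t.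
pose d := 1 + K / (m - Cp).
have K0 : 0 <= K by rewrite !addr_ge0// mulr_ge0// ltW.
have d0 : 0 < d by rewrite ltr_wpDr// divr_ge0// ltW.
have hd : (m - Cp) * d = (m - Cp) + K by rewrite /d; field; rewrite gt_eqF.
have := convex_slope s t (t + d) s0 st; rewrite -/m addrAC subrr add0r ler_pdivlMr//.
rewrite ltrDl => /(_ d0) H1.
have /H/andP[_ H2] : 0 <= t + d by lra.
have h1 := ler_norm Bp; have h2 := ler_norm (- f t); rewrite normrN in h2.
rewrite /K in hd; nra.
Qed.

(** The slope L of f at infinity, that is, the limit of f(t)/t. As a supremum of chord slopes it
    bounds every increment of f from above and is approximated by single chords. *)
Definition recession := sup slopes.

Lemma slope_le s t : 0 <= s -> 0 <= t -> f (s + t) <= f s + recession * t.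
Proof.
move=> s0; rewrite le_eqVlt => /predU1P[<-|t0]; first by rewrite addr0 mulr0 addr0.
have : (f (s + t) - f s) / (s + t - s) <= recession.
  apply: ub_le_sup; first by case: slopes_has_sup.
  by exists s, (s + t); split => //; rewrite ltrDl.
rewrite addrAC subrr add0r ler_pdivrMr//; lra.
Qed.

Lemma recession_ge0 : 0 <= recession.
Proof.
have := slope_le 0 1 (lexx 0) ler01; have := f_nd 0 (0 + 1) (lexx 0); rewrite lerDl ler01 => /(_ isT).
lra.
Qed.

(** For theta < 1 and L > 0 some chord is steeper than theta L. Beyond its right end t, f stays
    above the line of slope theta L through (t, f(t)); before t the constant theta L t suffices, as
    f >= 0. *)
Lemma recession_lower (th : R) : 0 <= th -> th < 1 ->
  exists2 C : R, 0 <= C & forall s, 0 <= s -> th * recession * s <= f s + C.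
Proof.
move=> th0 th1; have [r0|r0] := leP recession 0.
  exists 0 => // s s0; rewrite addr0 (le_trans _ (f_ge0 _ s0))//.
  by rewrite mulr_le0_ge0// mulr_ge0_le0.
have [|m [s [t [s0 st mE]]] hm] := @sup_adherent _ slopes ((1 - th) * recession) _ slopes_has_sup.
  by rewrite mulr_gt0// subr_gt0.
have {}hm : th * recession < m by move: hm; rewrite -/recession; lra.
have t0 : 0 < t by lra.
have thr : 0 <= th * recession by rewrite mulr_ge0// ltW.
exists (th * recession * t); first by rewrite mulr_ge0// ltW.
move=> r rr0; have [rt|tr] := leP r t.
  by apply: (@le_trans _ _ (th * recession * t)); [rewrite ler_wpM2l|rewrite lerDr f_ge0].
have := convex_slope s t r s0 st tr; rewrite -mE ler_pdivlMr ?subr_gt0// => H.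
have ft := f_ge0 t (ltW t0).
have : th * recession * (r - t) <= m * (r - t) by rewrite ler_wpM2r// ?subr_ge0 ltW.
lra.
Qed.

Lemma convex0 (t s : R) : 0 <= t <= 1 -> 0 <= s -> f ((1 - t) * s) <= (1 - t) * f s + t * f 0.
Proof.
move=> t01 s0; have := convex_functionE _ _ _ _ f_convex t 0 s _ _ t01.
rewrite /= !in_itv/= lexx s0 /GRing.scale/= mulr0 add0r => /(_ isT isT); lra.
Qed.

End integrand.

Section composite.
Context (R : realType) (n : nat) (f : R -> R) (phi : 'rV[R]_n -> R).
Hypothesis f_ge0 : forall t, 0 <= t -> 0 <= f t.
Hypothesis f_convex : convex_function (`[0, +oo[%classic : set R) f.
Hypothesis f_nd : forall s t, 0 <= s -> s <= t -> f s <= f t.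
Hypothesis f_growth : linear_growth f.
Hypothesis aphi : anisotropy phi.
Notation F := (f \o phi).
Notation L := (recession R f).

Let phi0 p : 0 <= phi p := anisotropy_ge0 _ _ _ aphi p.

Lemma F_ge0 p : 0 <= F p. Proof. exact: f_ge0. Qed.

(** Monotonicity of f turns the subadditivity of phi into a bound that depends on q alone: this is
    the cost of a jump q, whatever the derivative p already present. *)
Lemma F_add p q : F (p + q) <= F p + L * phi q.
Proof.
apply: (@le_trans _ _ (f (phi p + phi q))).
  by apply: f_nd => //; exact: anisotropyD.
exact: slope_le.
Qed.

Lemma F_scale p (t : R) : 0 <= t <= 1 -> F ((1 - t) *: p) <= (1 - t) * F p + t * F 0.
Proof.
move=> t01; rewrite /= (anisotropy0 _ _ _ aphi) (anisotropyZ _ _ _ aphi); last by case/andP: t01; lra.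
exact: convex0.
Qed.

Lemma F_lower (th : R) : 0 <= th -> th < 1 ->
  exists2 C : R, 0 <= C & forall p, th * (L * phi p) <= F p + C.
Proof.
move=> th0 th1; have [C C0 H] := recession_lower R f f_ge0 f_convex f_growth th th0 th1.
by exists C => // p; rewrite mulrA; exact: H.
Qed.

Lemma F_continuous : continuous (F : 'rV[R]_n -> R).
Proof.
have [C C0 HC] := anisotropy_bound _ _ _ aphi.
have L0 := recession_ge0 _ _ f_convex f_nd f_growth.
have lip p q : F p - F q <= L * C * n%:R * `|q - p|.
  rewrite lerBlDl -[X in F X](subrK q) addrC; apply: le_trans (F_add _ _) _.
  rewrite lerD2l -!mulrA ler_wpM2l//; apply: le_trans (HC _) _.
  by rewrite ler_wpM2l// distrC enorm_le_normr.
move=> p; have FF : Filter (nbhs p) := nbhs_filter p.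
apply/(@cvgrPdist_le _ _ _ (nbhs p) FF) => e e0.
have K0 : 0 <= L * C * n%:R by rewrite !mulr_ge0.
have K1 : 0 < L * C * n%:R + 1 by lra.
have H : \forall q \near p, `|p - q| <= e / (L * C * n%:R + 1).
  by apply: (@cvgr_dist_le _ _ _ (nbhs p) FF id p); [exact: cvg_id|exact: divr_gt0].
apply: filterS H => q hq.
have h3 : L * C * n%:R * `|p - q| <= e.
  apply: (@le_trans _ _ ((L * C * n%:R + 1) * `|p - q|)); first by rewrite ler_wpM2r// lerDl.
  by rewrite mulrC -ler_pdivlMr.
have := lip p q; have := lip q p; rewrite [in X in _ -> X -> _]distrC => h1 h2.
by rewrite ler_norml; apply/andP; split; lra.
Qed.

Lemma F_growth_below : coercive phi ->
  exists2 c : R, 0 < c & exists C : R, forall p, c * enorm p <= F p + C.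
Proof.
move=> cphi; have [Cm [Cp [Bm [Bp [Cm0 Cp0 H]]]]] := f_growth.
exists (Cm * cminus phi); first exact: mulr_gt0.
exists (- Bm) => p; have /andP[h _] := H (phi p) (phi0 p).
have := cminus_le _ _ _ aphi p; rewrite -(ler_pM2l Cm0) /=; lra.
Qed.

End composite.

(** * Perturbing the relaxed functional *)

Section limits.
Context (R : realType).

Lemma limn_einf_add_le (x y : nat -> \bar R) (b : nat -> R) (B : R) :
  (forall l, (x l <= y l + (b l)%:E)%E) -> b l @[l --> \oo] --> B ->
  (limn_einf x <= limn_einf y + B%:E)%E.
Proof.
move=> xy bB; apply/lee_addgt0Pr => e e0.
rewrite -addeA -EFinD addeC -limn_einf_shift// !limn_einf_lim.
apply: lee_lim; [exact: is_cvg_einfs|exact: is_cvg_einfs|].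
have : \forall l \near \oo, b l <= B + e.
  have := cvgr_le B bB; apply; by rewrite ltrDl.
move=> [N _ HN]; exists N => // m /= Nm.
apply: le_ereal_inf_tmp => _ /= [k mk <-].
apply: (@le_trans _ _ (x k)); first by apply: ereal_inf_lbound; exists k.
apply: le_trans (xy k) _; rewrite addeC; apply: leeD => //.
by rewrite lee_fin; apply: HN => /=; exact: leq_trans mk.
Qed.

(** The two infima are compared sequence by sequence: every sequence admissible for u is turned into
    one admissible for w, at an extra cost tending to B. *)
Lemma relaxed_le (n : nat) (D : set R) (F : 'rV[R]_n -> R) (u w : R -> 'rV[R]_n) (B : R) :
  (forall v : nat -> R -> 'rV[R]_n, (forall l, C1 D (v l)) -> cvg_L1loc D v u ->
     exists (v' : nat -> R -> 'rV[R]_n) (b : nat -> R),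
     [/\ forall l, C1 D (v' l), cvg_L1loc D v' w, b l @[l --> \oo] --> B &
     forall l, (\int[@lebesgue_measure R]_(x in D) (F (derive1 (v' l) x))%:E <=
       \int[@lebesgue_measure R]_(x in D) (F (derive1 (v l) x))%:E + (b l)%:E)%E]) ->
  (relaxed D F w <= relaxed D F u + B%:E)%E.
Proof.
move=> H; rewrite -leeBlDr//; apply: le_ereal_inf_tmp => _ [v [vC1 vu] <-].
have [v' [b [v'C1 v'w bB le]]] := H v vC1 vu.
rewrite leeBlDr//; apply: le_trans (limn_einf_add_le _ _ _ _ le bB).
by apply: ereal_inf_lbound; exists v'.
Qed.

End limits.

Section C1_functions.
Context (R : realType) (n : nat).
Notation T := (measurableTypeR R).
Implicit Types (w v : R -> 'rV[R]_n).

Lemma derive1_coord w (x : R) i : derivable w x 1 ->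
  derivable (fun y => w y ord0 i) x 1 /\ derive1 (fun y => w y ord0 i) x = derive1 w x ord0 i.
Proof.
move=> dw; have /derivable_mxP dwi := dw.
by split; [exact: dwi|rewrite !derive1E derive_mx// mxE].
Qed.

Lemma derivable_row (E : 'I_n -> R -> R) (x : R) :
  (forall i, derivable (E i) x 1) -> derivable (fun y => \row_i E i y) x 1 /\
  derive1 (fun y => \row_i E i y) x = \row_i derive1 (E i) x.
Proof.
move=> dE; have h i j : (fun y => (\row_k E k y) i j) = E j by apply/funext => y; rewrite mxE.
have dr : derivable (fun y => \row_i E i y) x 1.
  by apply/derivable_mxP => i j; rewrite h.
split => //; apply/rowP => i; rewrite mxE derive1E derive_mx// mxE derive1E.
by rewrite (h ord0 i).
Qed.

Lemma C1_coord (D : set R) w i : C1 D w -> forall x, D x ->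
  [/\ derivable (fun y => w y ord0 i) x 1, {for x, continuous (fun y => w y ord0 i)} &
   {for x, continuous (fun y => derive1 w y ord0 i)}].
Proof.
move=> Cw x Dx; have [dw cw] := Cw x Dx.
have [di _] := derive1_coord w x i dw.
split => //; first by apply: differentiable_continuous; exact/derivable1_diffP.
exact: (continuous_comp cw (@coord_continuous _ _ _ _ _ _)).
Qed.

Lemma C1_near (D : set R) w (g : R -> 'rV[R]_n) : open D ->
  (forall x, D x -> derivable w x 1 /\ derive1 w x = g x) ->
  (forall x, D x -> {for x, continuous g}) -> C1 D w.
Proof.
move=> oD dw cg x Dx; split; first by case: (dw x Dx).
have nD : nbhs x D by exact: open_nbhs_nbhs.
rewrite /prop_for /continuous_at; have [_ ->] := dw x Dx.
apply: cvg_trans (cg x Dx); apply: near_eq_cvg.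
by apply: filterS nD => y Dy; have [_ ->] := dw y Dy.
Qed.

Lemma C1_measurable (D : set R) (F : 'rV[R]_n -> R) v : open D -> continuous F -> C1 D v ->
  measurable_fun (D : set T) (fun x => F (derive1 v x)).
Proof.
move=> oD cF Cv; apply: open_continuous_measurable_fun => // x /set_mem Dx.
by have [_ cv] := Cv x Dx; exact: (continuous_comp cv (cF _)).
Qed.

Lemma C1_integrable_itv (D : set R) w i (al be : R) : C1 D w -> `[al, be] `<=` D ->
  leb.-integrable (`[al, be]%classic : set T) (EFin \o (fun x => w x ord0 i)).
Proof.
move=> Cw sD; apply: continuous_compact_integrable; first exact: segment_compact.
apply: continuous_in_subspaceT => x /set_mem xab.
by have [] := C1_coord D w i Cw x (sD _ xab).
Qed.

End C1_functions.

Section enorm_more.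
Context (R : realType) (n : nat).
Notation T := (measurableTypeR R).
Implicit Types (p q : 'rV[R]_n).

Lemma enorm_triangle p q : enorm (p + q) <= enorm p + enorm q.
Proof.
rewrite -ler_sqr ?nnegrE ?addr_ge0 ?enorm_ge0// enorm_sq dotDr !dotDl -!enorm_sq (dotC R n q p).
have := dot_enorm R n p q; rewrite sqrrD; lra.
Qed.

Lemma enormZ (c : R) p : enorm (c *: p) = `|c| * enorm p.
Proof.
rewrite /enorm -(sqrtr_sqr c) -sqrtrM ?sqr_ge0//; congr Num.sqrt.
by rewrite mulr_sumr; apply: eq_bigr => i _; rewrite mxE exprMn.
Qed.

Lemma enorm_measurable d (T' : measurableType d) (D : set T') (w : T' -> 'rV[R]_n) :
  (forall i, measurable_fun D (fun x => w x ord0 i)) ->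
  measurable_fun D (fun x => enorm (w x)).
Proof.
move=> mw.
have ms : measurable_fun (setT : set R) (@Num.sqrt R).
  by apply: continuous_measurable_fun; exact: sqrt_continuous.
apply: (measurableT_comp ms).
by apply: measurable_sum => i; apply: measurable_funX.
Qed.

Lemma enorm_integrable d (T' : measurableType d) (mu : {measure set T' -> \bar R}) (D : set T') (w : T' -> 'rV[R]_n) :
  measurable D -> (forall i, mu.-integrable D (EFin \o (fun x => w x ord0 i))) ->
  mu.-integrable D (EFin \o (fun x => enorm (w x))).
Proof.
move=> mD iw.
have mw i : measurable_fun D (fun x => w x ord0 i).
  by apply/measurable_EFinP; exact: measurable_int (iw i).
have : mu.-integrable D (fun x => \sum_(i < n) `|(w x ord0 i)%:E|)%E.
  by apply: integrable_sum => // i _; exact: integrable_abse (iw i).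
apply: le_integrable => //; first by apply/measurable_EFinP; exact: enorm_measurable.
move=> x Dx /=; rewrite ger0_norm ?enorm_ge0// sumEFin abse_EFin lee_fin ger0_norm ?sumr_ge0//.
exact: enorm_le_sum.
Qed.

End enorm_more.

(** * Damping the derivative on an interval *)

Section damping.
Context (R : realType) (n : nat) (a b al be : R) (chi : R -> R).
Notation T := (measurableTypeR R).
Notation D := (`]a, b[%classic).
Hypothesis (aal : a < al) (albe : al < be) (beb : be < b).
Hypothesis schi : smooth R chi.
Hypothesis chi_supp : forall x, ~ (al < x < be) -> chi x = 0.
Hypothesis chi01 : forall x, 0 <= chi x <= 1.
Implicit Types (u v w : R -> 'rV[R]_n).

(** The nonlocal term in chi u' = (chi u)' - chi' u. It is bounded uniformly in x by the L^1 norm of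
    u on [al, be], so that L^1_loc convergence of u passes to it. *)
Definition damp_int u i (x : R) : R :=
  \int[leb]_(s in (`]-oo, x[%classic : set T)) (derive1 chi s * u s ord0 i).

(* The direction with derivative - chi u', written without derivatives of u. *)
Definition damp u : R -> 'rV[R]_n := fun x => \row_i (damp_int u i x - chi x * u x ord0 i).

Let sub : `[al, be] `<=` D.
Proof. by apply: subset_itv; rewrite bnd_simp. Qed.

Let oD : open (D : set R). Proof. exact: interval_open. Qed.
Let mD : measurable (D : set T). Proof. exact: measurable_itv. Qed.
Let mK : measurable (`[al, be]%classic : set T). Proof. exact: measurable_itv. Qed.

Let cchi : continuous chi. Proof. exact: smooth_continuous. Qed.
Let cchi' : continuous (derive1 chi).
Proof. by apply: smooth_continuous; exact: smooth_derive1. Qed.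

Lemma dampchi_supp x : ~ (al <= x <= be) -> chi x = 0.
Proof. by move=> nx; apply: chi_supp => /andP[h1 h2]; apply: nx; rewrite !ltW. Qed.

Let chi'_supp x : ~ (al <= x <= be) -> derive1 chi x = 0.
Proof. by apply: supp_derive1; exact: dampchi_supp. Qed.

Lemma damp_bound : exists2 M : R, 0 <= M & forall x, `|derive1 chi x| <= M.
Proof. exact: supp_continuous_bounded cchi' chi'_supp. Qed.

Definition locint u := forall i, leb.-integrable (`[al, be]%classic : set T) (EFin \o (fun x => u x ord0 i)).

Let patchK (k : R -> R) (v : R -> R) : (forall x, ~ (al <= x <= be) -> k x = 0) ->
  (fun s => k s * v s) = (fun s => k s * v s) \_ `[al, be].
Proof.
move=> k0; apply/funext => x; rewrite patchE; case: ifPn => // /negP; rewrite inE/= in_itv/= => nx.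
by rewrite k0 ?mul0r.
Qed.

Lemma damp_integrable u i : locint u ->
  leb.-integrable (setT : set T) (EFin \o (fun s => derive1 chi s * u s ord0 i)).
Proof.
move=> iu; have [M M0 HM] := damp_bound.
rewrite (patchK (derive1 chi) (fun s => u s ord0 i))// -restrict_EFin.
apply/(integrable_mkcond _ _).1 => //.
rewrite (_ : _ \o _ = EFin \o (fun s => u s ord0 i * derive1 chi s)); last first.
  by apply/funext => s /=; rewrite mulrC.
apply: (integrable_mul_bounded _ _ _ _ _ _ _ M) => //.
by apply: measurable_funTS; exact: continuous_measurable_fun.
Qed.

Lemma damp_int_bound u i (M : R) x : 0 <= M -> (forall x, `|derive1 chi x| <= M) -> locint u ->
  `|damp_int u i x| <= M * \int[leb]_(s in (`[al, be]%classic : set T)) enorm (u s).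
Proof.
move=> M0 HM iu; have iK := damp_integrable u i iu.
have mI : measurable (`]-oo, x[%classic : set T) by exact: measurable_itv.
apply: (le_trans (le_normr_Rintegral mI (integrableS _ _ _ iK))) => //.
have iKn := integrable_norm iK.
apply: (@le_trans _ _ (\int[leb]_(s in (setT : set T)) `|derive1 chi s * u s ord0 i|)).
  rewrite Rintegral_mkcond; apply: le_Rintegral => //.
    by rewrite -restrict_EFin; apply/(integrable_mkcond _ _).1 => //; exact: integrableS iKn.
  by move=> s _; rewrite patchE; case: ifP => // _; exact: normr_ge0.
have iEu := enorm_integrable R n _ _ leb _ _ mK iu.
have -> : (fun s => `|derive1 chi s * u s ord0 i|) = (fun s => `|derive1 chi s| * `|u s ord0 i|).
  by apply/funext => s; rewrite normrM.
rewrite (patchK (fun s => `|derive1 chi s|) (fun s => `|u s ord0 i|)); last first.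
  by move=> y ny; rewrite chi'_supp ?normr0.
rewrite -Rintegral_mkcond -RintegralZl//; apply: le_Rintegral => //.
- have : leb.-integrable (`[al, be]%classic : set T)
      (EFin \o (Num.norm \o (fun s => derive1 chi s * u s ord0 i))).
    by apply: integrableS iKn.
  by apply: eq_integrable => // s _ /=; rewrite normrM.
- by apply: eq_integrable (integrableZl mK M iEu).
- by move=> s _; rewrite ler_pM// enorm_coord.
Qed.

Lemma damp_int_measurable u i : locint u -> measurable_fun (D : set T) (damp_int u i).
Proof.
move=> iu.
have i1 : leb.-integrable (setT : set T) (EFin \o (\1_D : R -> R)).
  exact: (@integrable_indic_itv R a b false true).
have := integrable_fubini_left _ leb leb _ _ i1 (damp_integrable u i iu).
move=> /measurable_int/measurable_EFinP/(@measurable_funTS _ _ _ _ D).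
apply: eq_measurable_fun => x xD; rewrite indicE xD mul1r//.
Qed.

Lemma damp_int_FTC u i x : C1 D u -> D x ->
  derivable (damp_int u i) x 1 /\ derive1 (damp_int u i) x = derive1 chi x * u x ord0 i.
Proof.
move=> Cu Dx.
have iu : locint u by move=> j; exact: C1_integrable_itv Cu sub.
have iK := damp_integrable u i iu.
have -> : damp_int u i = (fun x => \int[leb]_(s in (`]-oo, x]%classic : set T)) (derive1 chi s * u s ord0 i)).
  apply/funext => y; rewrite /damp_int Rintegral_itv_bndo_bndc//.
  by apply: integrableS iK => //; exact: measurable_itv.
have [||||] := @continuous_FTC1 _ (fun s => derive1 chi s * u s ord0 i) -oo%O x (x + 1).
- by rewrite ltrDl.
- by apply: integrableS iK => //; exact: measurable_itv.
- by rewrite ltNyr.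
- have [_ cu _] := C1_coord _ _ _ _ i Cu x Dx; exact: continuousM (cchi' x) cu.
- by [].
Qed.

Definition perturb (t : R) u : R -> 'rV[R]_n := fun x => u x + t *: damp u x.

Lemma perturb_derive t u x : C1 D u -> D x ->
  derivable (perturb t u) x 1 /\ derive1 (perturb t u) x = (1 - t * chi x) *: derive1 u x.
Proof.
move=> Cu Dx.
have pE : perturb t u = fun y => \row_i (u y ord0 i + t * (damp_int u i y - chi y * u y ord0 i)).
  by apply/funext => y; apply/rowP => i; rewrite !mxE.
have dE i : is_derive x 1 (fun y => u y ord0 i + t * (damp_int u i y - chi y * u y ord0 i))
   ((1 - t * chi x) * derive1 u x ord0 i).
  have [du _] := Cu x Dx; have [dui duiE] := derive1_coord _ _ u x i du.
  have [dI dIE] := damp_int_FTC u i x Cu Dx.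
  have h1 : is_derive x 1 (fun y => u y ord0 i) (derive1 u x ord0 i).
    by rewrite -duiE derive1E; exact: derivableP.
  have h2 : is_derive x 1 (damp_int u i) (derive1 chi x * u x ord0 i).
    by rewrite -dIE derive1E; exact: derivableP.
  have h3 : is_derive x 1 chi (derive1 chi x).
    by rewrite derive1E; apply: derivableP; exact: (smooth_derivable _ _ schi 0%N).
  have H := is_deriveD h1 (is_deriveZ t (is_deriveB h2 (is_deriveM h3 h1))).
  apply: (@is_derive_eq _ _ _ _ _ _ _ _ H).
  by rewrite /GRing.scale/=; ring.
rewrite pE; have [|d e] := derivable_row R n (fun i y => u y ord0 i + t * (damp_int u i y - chi y * u y ord0 i)) x.
  by move=> i; case: (dE i).
split => //; rewrite e; apply/rowP => i; rewrite !mxE derive1E.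
by case: (dE i).
Qed.

Lemma perturb_C1 t u : C1 D u -> C1 D (perturb t u).
Proof.
move=> Cu; apply: (C1_near R n D (perturb t u) (fun x => (1 - t * chi x) *: derive1 u x) oD).
  by move=> x Dx; exact: perturb_derive.
move=> x Dx; have [_ cu] := Cu x Dx; apply: cvgZ => //.
apply: cvgB; first exact: cvg_cst.
by apply: cvgM; [exact: cvg_cst|exact: cchi].
Qed.

End damping.

Lemma integrable_Rsum d (T : measurableType d) (R : realType) (mu : {measure set T -> \bar R})
    (D : set T) (n : nat) (f : 'I_n -> T -> R) : measurable D ->
  (forall i, mu.-integrable D (EFin \o f i)) ->
  mu.-integrable D (EFin \o (fun x => \sum_(i < n) f i x)).
Proof.
move=> mD fi.
have : mu.-integrable D (fun x => \sum_(i < n) (f i x)%:E)%E by apply: integrable_sum => // i _; exact: fi.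
by apply: eq_integrable => // x _ /=; rewrite sumEFin.
Qed.

Lemma Rintegral_sum d (T : measurableType d) (R : realType) (mu : {measure set T -> \bar R})
    (D : set T) (n : nat) (f : 'I_n -> T -> R) : measurable D ->
  (forall i, mu.-integrable D (EFin \o f i)) ->
  \int[mu]_(x in D) (\sum_(i < n) f i x) = \sum_(i < n) \int[mu]_(x in D) f i x.
Proof.
move=> mD fi; rewrite /Rintegral; under eq_integral do rewrite -sumEFin.
rewrite integral_sum//.
rewrite (eq_bigr (fun i => (\int[mu]_(x in D) f i x)%:E)) ?sumEFin// => i _.
by rewrite /Rintegral fineK//; apply: integrable_fin_num => //; exact: fi.
Qed.

Section relaxed_perturb.
Context (R : realType) (n : nat) (a b al be : R) (chi : R -> R).
Notation T := (measurableTypeR R).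
Notation D := (`]a, b[%classic).
Hypothesis (aal : a < al) (albe : al < be) (beb : be < b).
Hypothesis schi : smooth R chi.
Hypothesis chi_supp : forall x, ~ (al < x < be) -> chi x = 0.
Hypothesis chi01 : forall x, 0 <= chi x <= 1.
Implicit Types (u v w : R -> 'rV[R]_n).

Let sub : `[al, be] `<=` D.
Proof. by apply: subset_itv; rewrite bnd_simp. Qed.

Let oD : open (D : set R). Proof. exact: interval_open. Qed.
Let mD : measurable (D : set T). Proof. exact: measurable_itv. Qed.
Let mK : measurable (`[al, be]%classic : set T). Proof. exact: measurable_itv. Qed.
Let cchi : continuous chi. Proof. exact: smooth_continuous. Qed.
Let cchi' : continuous (derive1 chi).
Proof. by apply: smooth_continuous; exact: smooth_derive1. Qed.
Let supp0 x : ~ (al <= x <= be) -> chi x = 0.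
Proof. exact: (dampchi_supp R al be). Qed.
Let supp1 x : ~ (al <= x <= be) -> derive1 chi x = 0.
Proof. by apply: supp_derive1; exact: supp0. Qed.

Let patchD (k v : R -> R) : (forall x, ~ (al <= x <= be) -> k x = 0) ->
  (fun s => k s * v s) = (fun s => k s * v s) \_ `[al, be].
Proof.
move=> k0; apply/funext => x; rewrite patchE; case: ifPn => // /negP; rewrite inE/= in_itv/= => nx.
by rewrite k0 ?mul0r.
Qed.

Lemma supp_Rintegral (k v : R -> R) : (forall x, ~ (al <= x <= be) -> k x = 0) ->
  \int[leb]_(x in (D : set T)) (k x * v x) = \int[leb]_(x in (`[al, be]%classic : set T)) (k x * v x).
Proof.
move=> k0; rewrite {1}patchD// -Rintegral_mkcondr; congr (Rintegral _ _ _).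
exact: setIidr.
Qed.

Lemma supp_integrable (k v : R -> R) : (forall x, ~ (al <= x <= be) -> k x = 0) -> continuous k ->
  leb.-integrable (`[al, be]%classic : set T) (EFin \o v) ->
  leb.-integrable (D : set T) (EFin \o (fun x => k x * v x)).
Proof.
move=> k0 ck iv; rewrite patchD//.
have : leb.-integrable (setT : set T) (EFin \o (fun s => k s * v s) \_ `[al, be]).
  rewrite -restrict_EFin; apply/(integrable_mkcond _ _).1 => //.
  rewrite (_ : _ \o _ = EFin \o (fun s => v s * k s)); last first.
    by apply/funext => s /=; rewrite mulrC.
  have [M M0 HM] := supp_continuous_bounded _ _ _ _ ck k0.
  apply: (integrable_mul_bounded _ _ _ _ _ _ _ M) => //.
  by apply: measurable_funTS; exact: continuous_measurable_fun.
exact: integrableS.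
Qed.

Lemma C1_derive_integrable v i : C1 D v ->
  leb.-integrable (`[al, be]%classic : set T) (EFin \o (fun x => derive1 v x ord0 i)).
Proof.
move=> Cv; apply: continuous_compact_integrable; first exact: segment_compact.
apply: continuous_in_subspaceT => x /set_mem xab.
by have [] := C1_coord R n D v i Cv x (sub _ xab).
Qed.

Lemma C1_ibp v i : C1 D v ->
  \int[leb]_(x in (D : set T)) (chi x * derive1 v x ord0 i) =
  - \int[leb]_(x in (D : set T)) (derive1 chi x * v x ord0 i).
Proof.
move=> Cv; rewrite !supp_Rintegral//; apply/eqP; rewrite -addr_eq0 addrC.
have i1 : leb.-integrable (`[al, be]%classic : set T) (EFin \o (fun x => chi x * derive1 v x ord0 i)).
  apply: integrableS (supp_integrable _ _ supp0 cchi (C1_derive_integrable v i Cv)) => //.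
have i2 : leb.-integrable (`[al, be]%classic : set T) (EFin \o (fun x => derive1 chi x * v x ord0 i)).
  apply: integrableS (supp_integrable _ _ supp1 cchi' (C1_integrable_itv _ _ _ _ _ _ _ Cv sub)) => //.
rewrite -RintegralD//.
pose f x := chi x * v x ord0 i.
pose g x := derive1 chi x * v x ord0 i + chi x * derive1 v x ord0 i.
have df x : D x -> derivable f x 1 /\ derive1 f x = g x.
  move=> Dx; have [dv _] := Cv x Dx; have [dvi dE] := derive1_coord _ _ v x i dv.
  have h1 : is_derive x 1 (fun y => v y ord0 i) (derive1 v x ord0 i).
    by rewrite -dE derive1E; exact: derivableP.
  have h3 : is_derive x 1 chi (derive1 chi x).
    by rewrite derive1E; apply: derivableP; exact: (smooth_derivable _ _ schi 0%N).
  have [H HE] := is_deriveM h3 h1.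
  by split; [exact: H|rewrite derive1E HE /g /GRing.scale/=; ring].
have cf x : D x -> {for x, continuous f}.
  by move=> Dx; apply: differentiable_continuous; apply/derivable1_diffP; case: (df x Dx).
have Dal : D al by apply: sub; rewrite /= in_itv/= lexx ltW.
have Dbe : D be by apply: sub; rewrite /= in_itv/= lexx ltW.
have cg : {within `[al, be], continuous g}.
  apply: continuous_in_subspaceT => x /set_mem xab; have Dx := sub _ xab.
  have [_ c1 c2] := C1_coord R n D v i Cv x Dx.
  apply: cvgD; apply: cvgM => //; [exact: cchi'|exact: cchi].
have LR : derivable_oo_LRcontinuous f al be.
  split=> [x xab|  | ].
  - by case: (df x (sub _ (subset_itv_oo_cc xab))).
  - exact: cvg_at_right_filter (cf al Dal).
  - exact: cvg_at_left_filter (cf be Dbe).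
have fg : {in `]al, be[, derive1 f =1 g}.
  by move=> x xab; case: (df x (sub _ (subset_itv_oo_cc xab))).
have := @continuous_FTC2 _ g f al be albe cg LR fg.
rewrite /Rintegral => ->; rewrite /f !chi_supp ?mul0r.
- by rewrite -EFinB subrr.
- by rewrite ltxx.
- by rewrite ltxx andbF.
Qed.

Lemma damp_intB v u i x : locint R n al be v -> locint R n al be u ->
  damp_int R n chi v i x - damp_int R n chi u i x = damp_int R n chi (fun y => v y - u y) i x.
Proof.
move=> iv iu; rewrite /damp_int -RintegralB//; last 2 first.
- by apply: integrableS (damp_integrable R n al be chi schi chi_supp v i iv) => //; exact: measurable_itv.
- by apply: integrableS (damp_integrable R n al be chi schi chi_supp u i iu) => //; exact: measurable_itv.
by apply: eq_Rintegral => s _; rewrite !mxE mulrBr.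
Qed.

Lemma locintB v u : locint R n al be v -> locint R n al be u -> locint R n al be (fun y => v y - u y).
Proof.
move=> iv iu i; apply: eq_integrable (integrableB mK (iv i) (iu i)) => // s _ /=.
by rewrite !mxE EFinB.
Qed.

(** The local part of the difference is multiplied by 1 - t chi, which lies in [0, 1]; the nonlocal
    part is bounded in each of the n coordinates by a multiple of the L^1 distance on [al, be]. *)
Lemma perturb_dist (t M : R) v u x : 0 <= t <= 1 -> 0 <= M -> (forall x, `|derive1 chi x| <= M) ->
  locint R n al be v -> locint R n al be u ->
  enorm (perturb R n chi t v x - perturb R n chi t u x) <=
  enorm (v x - u x) + n%:R * (M * \int[leb]_(s in (`[al, be]%classic : set T)) enorm (v s - u s)).
Proof.
move=> /andP[t0 t1] M0 HM iv iu.
have iw := locintB v u iv iu.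
have -> : perturb R n chi t v x - perturb R n chi t u x =
  (1 - t * chi x) *: (v x - u x) + t *: \row_i damp_int R n chi (fun y => v y - u y) i x.
  by apply/rowP => i; rewrite !mxE -damp_intB//; ring.
apply: le_trans (enorm_triangle _ _ _ _) _; rewrite !enormZ; apply: lerD.
  rewrite ler_piMl ?enorm_ge0//; have /andP[c0 c1] := chi01 x.
  have tc : t * chi x <= 1 by rewrite mulr_ile1.
  have tc0 : 0 <= t * chi x by rewrite mulr_ge0.
  by rewrite ger0_norm; lra.
rewrite ger0_norm//; apply: (@le_trans _ _ (1 * enorm (\row_i damp_int R n chi (fun y => v y - u y) i x))).
  by rewrite ler_wpM2r ?enorm_ge0.
rewrite mul1r; apply: le_trans (enorm_le_sum _ _ _) _.
rewrite mulr_natl -[X in _ *+ X]card_ord -sumr_const; apply: ler_sum => i _.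
rewrite mxE; exact: (damp_int_bound R n al be).
Qed.

Lemma L1_locint u : L1 D u -> locint R n al be u.
Proof. by move=> iu i; apply: integrableS (iu i). Qed.

Lemma L1loc_delta (v : nat -> R -> 'rV[R]_n) u : cvg_L1loc D v u ->
  \int[leb]_(s in (`[al, be]%classic : set T)) enorm (v l s - u s) @[l --> \oo] --> (0 : R).
Proof.
move=> vu; rewrite /Rintegral; apply: fine_cvg.
exact: vu (segment_compact (a := al) (b := be)) sub.
Qed.

(** The nonlocal error bound is constant in x and K has finite measure, so it integrates to
    something that tends to 0 with the L^1 distance on [al, be]. *)
Lemma perturb_cvg (v : nat -> R -> 'rV[R]_n) u (t : R) : 0 <= t <= 1 ->
  (forall l, C1 D (v l)) -> L1 D u -> cvg_L1loc D v u ->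
  cvg_L1loc D (fun l => perturb R n chi t (v l)) (perturb R n chi t u).
Proof.
move=> t01 Cv Lu vu K cK KD.
have [M M0 HM] := damp_bound R al be chi schi chi_supp.
have mKK : measurable (K : set T) by apply: closed_measurable; apply: compact_closed => //; exact: Rhausdorff.
have iu := L1_locint u Lu.
have iv l : locint R n al be (v l) by move=> i; exact: C1_integrable_itv (Cv l) sub.
pose dl l := \int[leb]_(s in (`[al, be]%classic : set T)) enorm (v l s - u s).
have mcoord w i : L1 D w -> measurable_fun (K : set T) (fun x => w x ord0 i).
  by move=> /(_ i)/measurable_int/measurable_EFinP; exact: measurable_funS.
have mv l i : measurable_fun (D : set T) (fun x => v l x ord0 i).
  apply: open_continuous_measurable_fun => // x /set_mem Dx.
  by have [] := C1_coord _ _ _ _ i (Cv l) x Dx.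
have mu i : measurable_fun (D : set T) (fun x => u x ord0 i).
  by apply/measurable_EFinP; exact: measurable_int (Lu i).
have mpert w : locint R n al be w -> (forall i, measurable_fun (D : set T) (fun x => w x ord0 i)) ->
    forall i, measurable_fun (K : set T) (fun x => perturb R n chi t w x ord0 i).
  move=> lw mw i; apply: (@measurable_funS _ _ _ _ (D : set T)) => //.
  have -> : (fun x => perturb R n chi t w x ord0 i) =
      (fun x => w x ord0 i + t * (damp_int R n chi w i x - chi x * w x ord0 i)).
    by apply/funext => x; rewrite !mxE.
  apply: measurable_funD => //; apply: measurable_funM => //; apply: measurable_funB.
    exact: (damp_int_measurable R n a b al be).
  by apply: measurable_funM => //; apply: measurable_funTS; exact: continuous_measurable_fun.
have mEN w w' : (forall i, measurable_fun (K : set T) (fun x => w x ord0 i)) ->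
    (forall i, measurable_fun (K : set T) (fun x => w' x ord0 i)) ->
    measurable_fun (K : set T) (fun x => (enorm (w x - w' x : 'rV[R]_n))%:E).
  move=> mw mw'; apply/measurable_EFinP; apply: (enorm_measurable R n) => i.
  rewrite (_ : (fun x => _) = (fun x => w x ord0 i - w' x ord0 i)); last by apply/funext => x; rewrite !mxE.
  exact: measurable_funB.
have lK : (@lebesgue_measure R (K : set T) <= (b - a)%:E)%E.
  have ab : a <= b by apply: ltW; apply: (lt_trans aal); exact: lt_trans beb.
  by rewrite -(lebesgue_measure_oo _ _ _ ab); apply: le_measure; rewrite ?inE.
pose lKr := fine (@lebesgue_measure R (K : set T)).
have lKE : @lebesgue_measure R (K : set T) = lKr%:E.
  by rewrite fineK// ge0_fin_numE// (le_lt_trans lK)// ltry.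
apply: (@squeeze_cvge _ _ _ _ (cst 0%E) _
  (fun l => (\int[leb]_(x in (K : set T)) (enorm (v l x - u x))%:E + (n%:R * (M * dl l) * lKr)%:E)%E)).
- near=> l; apply/andP; split; first by apply: integral_ge0 => x _; rewrite lee_fin enorm_ge0.
  have -> : ((n%:R * (M * dl l) * lKr)%:E = \int[leb]_(x in (K : set T)) (n%:R * (M * dl l))%:E)%E.
    by rewrite integral_cst// EFinM -lKE.
  have c0 : 0 <= n%:R * (M * dl l).
    by rewrite !mulr_ge0//; apply: Rintegral_ge0 => x _; exact: enorm_ge0.
  rewrite -ge0_integralD//; last 2 first.
  + by move=> x _; rewrite lee_fin enorm_ge0.
  + apply: mEN => i; [exact: measurable_funS (mv l i)|exact: measurable_funS (mu i)].
  apply: ge0_le_integral => //.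
  + by move=> x _; rewrite lee_fin enorm_ge0.
  + by apply: mEN => i; apply: mpert.
  + apply: emeasurable_funD => //.
    by apply: mEN => i; [exact: measurable_funS (mv l i)|exact: measurable_funS (mu i)].
  + by move=> x _; rewrite -EFinD lee_fin; exact: perturb_dist.
- exact: cvg_cst.
- rewrite -[X in _ --> X]adde0; apply: cvgeD => //; first exact: vu.
  apply: cvg_EFin; first exact: nearW.
  have H := L1loc_delta v u vu.
  rewrite -(mul0r lKr); apply: cvgMr_tmp; rewrite -(mulr0 n%:R); apply: cvgMl_tmp.
  by rewrite -(mulr0 M); apply: cvgMl_tmp.
Unshelve. all: by end_near. Qed.

Section energy.
Context (F : 'rV[R]_n -> R) (q : 'rV[R]_n) (C : R).
Hypothesis F0 : forall p, 0 <= F p.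
Hypothesis cF : continuous F.
Hypothesis F_cvx : forall p (t : R), 0 <= t <= 1 -> F ((1 - t) *: p) <= (1 - t) * F p + t * F 0.
Hypothesis Fq : forall p, dot R n q p <= F p + C.

(** Convexity towards 0 gives F((1 - s) p) - F(p) <= s (F(0) - F(p)) <= s (F(0) + C - q.p). With s =
    t chi and p = u', the integral of the last term is t times this cost once the derivative is
    moved from u to chi. In this form the cost makes sense for u in L^1 and passes to the limit. *)
Definition damp_cost u : R := (F 0 + C) * \int[leb]_(x in (D : set T)) chi x +
  \sum_(i < n) q ord0 i * \int[leb]_(x in (D : set T)) (derive1 chi x * u x ord0 i).

Lemma perturb_energy v (t : R) : 0 <= t <= 1 -> C1 D v ->
  (\int[leb]_(x in (D : set T)) (F (derive1 (perturb R n chi t v) x))%:E <=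
   \int[leb]_(x in (D : set T)) (F (derive1 v x))%:E + (t * damp_cost v)%:E)%E.
Proof.
move=> /andP[t0 t1] Cv.
pose k x := t * (chi x * (F 0 + C - dot R n q (derive1 v x))).
have i1 : leb.-integrable (D : set T) (EFin \o chi).
  rewrite (_ : chi = (fun x => chi x * 1)); last by apply/funext => x; rewrite mulr1.
  apply: supp_integrable => //; apply: itv_continuous_integrable; exact: cst_continuous.
have i2 i : leb.-integrable (D : set T) (EFin \o (fun x => chi x * derive1 v x ord0 i)).
  by apply: supp_integrable => //; exact: C1_derive_integrable.
have kE : k = (fun x => t * ((F 0 + C) * chi x - \sum_(i < n) q ord0 i * (chi x * derive1 v x ord0 i))).
  apply/funext => x; rewrite /k /dot; congr (t * _); rewrite mulrBr mulrC; congr (_ - _).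
  by rewrite mulr_sumr; apply: eq_bigr => i _; ring.
have i3 : leb.-integrable (D : set T) (EFin \o (fun x => (F 0 + C) * chi x)).
  by apply: eq_integrable (integrableZl mD (F 0 + C) i1).
have i4 i : leb.-integrable (D : set T) (EFin \o (fun x => q ord0 i * (chi x * derive1 v x ord0 i))).
  by apply: eq_integrable (integrableZl mD (q ord0 i) (i2 i)).
have i5 : leb.-integrable (D : set T) (EFin \o (fun x => \sum_(i < n) q ord0 i * (chi x * derive1 v x ord0 i))).
  exact: integrable_Rsum.
have i6 : leb.-integrable (D : set T) (EFin \o (fun x => (F 0 + C) * chi x - \sum_(i < n) q ord0 i * (chi x * derive1 v x ord0 i))).
  by apply: eq_integrable (integrableB mD i3 i5).
have ik : leb.-integrable (D : set T) (EFin \o k).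
  by rewrite kE; apply: eq_integrable (integrableZl mD t i6).
have intk : (\int[leb]_(x in (D : set T)) (k x)%:E = (t * damp_cost v)%:E)%E.
  rewrite -[LHS]fineK; last exact: integrable_fin_num.
  congr EFin; rewrite -/(Rintegral leb (D : set T) k) kE RintegralZl// RintegralB//.
  congr (t * _); rewrite /damp_cost RintegralZl//; congr (_ + _).
  rewrite Rintegral_sum//.
  rewrite -sumrN; apply: eq_bigr => i _.
  by rewrite RintegralZl// C1_ibp// mulrN opprK.
have mFv : measurable_fun (D : set T) (fun x => F (derive1 v x)) by exact: C1_measurable.
have mFp : measurable_fun (D : set T) (fun x => F (derive1 (perturb R n chi t v) x)).
  by apply: C1_measurable; [exact: oD|exact: cF|exact: (perturb_C1 R n a b al be)].
have pt x : D x -> F (derive1 (perturb R n chi t v) x) <= F (derive1 v x) + k x.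
  move=> Dx; have [_ ->] := perturb_derive R n a b al be chi aal beb schi chi_supp t v x Cv Dx.
  have /andP[c0 c1] := chi01 x.
  have tc0 : 0 <= t * chi x by rewrite mulr_ge0.
  have tc1 : t * chi x <= 1 by rewrite mulr_ile1.
  have := F_cvx (derive1 v x) (t * chi x); rewrite tc0 tc1 => /(_ isT) h1.
  have h2 := Fq (derive1 v x).
  have h3 : t * chi x * (dot R n q (derive1 v x)) <= t * chi x * (F (derive1 v x) + C) by rewrite ler_wpM2l.
  rewrite /k; nra.
have [->|fin] := eqVneq (\int[leb]_(x in (D : set T)) (F (derive1 v x))%:E)%E +oo%E.
  by rewrite addye// leey.
have iFv : leb.-integrable (D : set T) (EFin \o (fun x => F (derive1 v x))).
  apply/integrableP; split; first exact/measurable_EFinP.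
  under eq_integral do rewrite gee0_abs ?lee_fin ?F0//.
  by rewrite ltey.
rewrite -intk -integralD//; apply: ge0_le_integral => //.
- by move=> x _; rewrite lee_fin.
- exact/measurable_EFinP.
- by apply: emeasurable_funD; [exact/measurable_EFinP|exact: measurable_int ik].
Qed.

Lemma damp_cost_cvg (v : nat -> R -> 'rV[R]_n) u : (forall l, C1 D (v l)) -> L1 D u ->
  cvg_L1loc D v u -> damp_cost (v l) @[l --> \oo] --> damp_cost u.
Proof.
move=> Cv Lu vu; apply: cvgD; first exact: cvg_cst.
have iu := L1_locint u Lu.
have iv l : locint R n al be (v l) by move=> i; exact: C1_integrable_itv (Cv l) sub.
have [M M0 HM] := damp_bound R al be chi schi chi_supp.
apply: cvg_big => [|i _]; first exact: add_continuous.
apply: cvgMl_tmp.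
apply/subr_cvg0 => /=.
have H := L1loc_delta v u vu.
apply: (@squeeze_cvgr _ _ _ _ (fun l => - (M * \int[leb]_(s in (`[al, be]%classic : set T)) enorm (v l s - u s)))
   (fun l => M * \int[leb]_(s in (`[al, be]%classic : set T)) enorm (v l s - u s))).
- near=> l; rewrite -ler_norml.
  have iD w : locint R n al be w -> leb.-integrable (D : set T) (EFin \o (fun x => derive1 chi x * w x ord0 i)).
    by move=> iw; apply: supp_integrable => //; exact: iw.
  rewrite -RintegralB//; [|exact: iD|exact: iD].
  have iw := locintB _ _ (iv l) iu.
  have E : \int[leb]_(x in (D : set T)) (derive1 chi x * v l x ord0 i - derive1 chi x * u x ord0 i) =
      \int[leb]_(x in (D : set T)) (derive1 chi x * (v l x - u x) ord0 i).
    by apply: eq_Rintegral => x _; rewrite !mxE mulrBr.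
  rewrite E supp_Rintegral//.
  have iw' : leb.-integrable (`[al, be]%classic : set T) (EFin \o (fun x => derive1 chi x * (v l x - u x) ord0 i)).
    by apply: integrableS (iD _ iw).
  apply: le_trans (le_normr_Rintegral mK iw') _.
  have iEu := enorm_integrable R n _ _ leb _ _ mK iw.
  rewrite -RintegralZl//; apply: le_Rintegral => //.
  + by apply: eq_integrable (integrable_norm iw').
  + by apply: eq_integrable (integrableZl mK M iEu).
  + by move=> s _; rewrite normrM ler_pM// enorm_coord.
- by rewrite -oppr0 -(mulr0 M); apply: cvgN; apply: cvgMl_tmp.
- by rewrite -(mulr0 M); apply: cvgMl_tmp.
Unshelve. all: by end_near. Qed.

Lemma relaxed_perturb u (t : R) : 0 <= t <= 1 -> L1 D u ->
  (relaxed D F (perturb R n chi t u) <= relaxed D F u + (t * damp_cost u)%:E)%E.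
Proof.
move=> t01 Lu; apply: relaxed_le => v Cv vu.
exists (fun l => perturb R n chi t (v l)), (fun l => t * damp_cost (v l)); split.
- by move=> l; exact: (perturb_C1 R n a b al be).
- exact: perturb_cvg.
- by apply: cvgMl_tmp; exact: damp_cost_cvg.
- by move=> l; exact: perturb_energy.
Qed.

End energy.

End relaxed_perturb.

(** * Adding a monotone profile in a fixed direction *)

Section relaxed_shift.
Context (R : realType) (n : nat) (a b : R) (sg : R -> R) (F : 'rV[R]_n -> R).
Notation T := (measurableTypeR R).
Notation D := (`]a, b[%classic).
Hypothesis ssg : smooth R sg.
Hypothesis sg' : forall x, 0 <= derive1 sg x.
Hypothesis F0 : forall p, 0 <= F p.
Hypothesis cF : continuous F.

(** The profile is nondecreasing, so only nonnegative multiples of p are added to the derivative and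
    [HF] applies. The added function does not depend on u, hence the same one is added along the
    whole approximating sequence. *)
Lemma relaxed_shift (u : R -> 'rV[R]_n) (p : 'rV[R]_n) (lam : R) (t : R) : 0 <= t -> 0 <= lam ->
  (forall q s, 0 <= s -> F (q + s *: p) <= F q + s * lam) ->
  (relaxed D F (fun x => (u x + t *: (sg x *: p))%R) <=
    relaxed D F u + (t * (lam * \int[leb]_(x in (D : set T)) derive1 sg x))%:E)%E.
Proof.
move=> t0 lam0 HF.
have oD : open (D : set R) by exact: interval_open.
have mD : measurable (D : set T) by exact: measurable_itv.
have csg' : continuous (derive1 sg) by apply: smooth_continuous; exact: smooth_derive1.
have isg : leb.-integrable (D : set T) (EFin \o derive1 sg).
  apply: integrableS (itv_continuous_integrable _ _ a b csg') => //.
  exact: subset_itv_oo_cc.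
apply: relaxed_le => v Cv vu.
exists (fun l x => v l x + t *: (sg x *: p)), (fun=> t * (lam * \int[leb]_(x in (D : set T)) derive1 sg x)).
have dw l x : D x -> derivable (fun x => v l x + t *: (sg x *: p)) x 1 /\
    derive1 (fun x => v l x + t *: (sg x *: p)) x = derive1 (v l) x + (t * derive1 sg x) *: p.
  move=> Dx; have [dv _] := Cv l x Dx.
  have dE i : is_derive x 1 (fun y => v l y ord0 i + t * (sg y * p ord0 i))
     (derive1 (v l) x ord0 i + t * derive1 sg x * p ord0 i).
    have [dvi dvE] := derive1_coord _ _ (v l) x i dv.
    have h1 : is_derive x 1 (fun y => v l y ord0 i) (derive1 (v l) x ord0 i).
      by rewrite -dvE derive1E; exact: derivableP.
    have h2 : is_derive x 1 sg (derive1 sg x).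
      by rewrite derive1E; apply: derivableP; exact: (smooth_derivable _ _ ssg 0%N).
    have H := is_deriveD h1 (is_deriveZ (t * p ord0 i) h2).
    have -> : (fun y => v l y ord0 i + t * (sg y * p ord0 i)) =
        (fun y => v l y ord0 i) + (t * p ord0 i) \*: sg.
      by apply/funext => y; rewrite /GRing.scale/=; change (v l y ord0 i + t * (sg y * p ord0 i) = v l y ord0 i + t * p ord0 i * sg y); ring.
    apply: (@is_derive_eq _ _ _ _ _ _ _ _ H).
    by rewrite /GRing.scale/=; ring.
  have -> : (fun x => v l x + t *: (sg x *: p)) = (fun y => \row_i (v l y ord0 i + t * (sg y * p ord0 i))).
    by apply/funext => y; apply/rowP => i; rewrite !mxE.
  have [|d e] := derivable_row R n (fun i y => v l y ord0 i + t * (sg y * p ord0 i)) x.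
    by move=> i; case: (dE i).
  split => //; rewrite e; apply/rowP => i; rewrite !mxE derive1E.
  by case: (dE i).
have Cw l : C1 D (fun x => v l x + t *: (sg x *: p)).
  apply: (C1_near R n D _ (fun x => derive1 (v l) x + (t * derive1 sg x) *: p) oD).
    by move=> x Dx; exact: dw.
  move=> x Dx; have [_ cv] := Cv l x Dx; apply: cvgD => //.
  by apply: cvgZr_tmp; apply: cvgM; [exact: cvg_cst|exact: csg'].
split; [exact: Cw| | |].
- move=> K cK KD; apply: cvg_trans (vu K cK KD); apply: near_eq_cvg; near=> l.
  by apply: eq_integral => x _; congr (enorm _)%:E; rewrite opprD addrACA subrr addr0.
- exact: cvg_cst.
move=> l; have mFv : measurable_fun (D : set T) (fun x => F (derive1 (v l) x)) by exact: C1_measurable.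
have mFw : measurable_fun (D : set T) (fun x => F (derive1 (fun x => v l x + t *: (sg x *: p)) x)) by exact: C1_measurable.
have -> : ((t * (lam * \int[leb]_(x in (D : set T)) derive1 sg x))%:E =
    \int[leb]_(x in (D : set T)) (t * lam * derive1 sg x)%:E)%E.
  rewrite mulrA -RintegralZl// fineK//; apply: integrable_fin_num => //.
  by apply: eq_integrable (integrableZl mD (t * lam) isg).
have msg : measurable_fun (D : set T) (fun x => t * lam * derive1 sg x).
  by apply: measurable_funM => //; apply/measurable_EFinP; exact: measurable_int isg.
rewrite -ge0_integralD//; last 4 first.
- by move=> x _; rewrite lee_fin.
- exact/measurable_EFinP.
- by move=> x _; rewrite lee_fin !mulr_ge0.
- exact/measurable_EFinP.
apply: ge0_le_integral => //.
- by move=> x _; rewrite lee_fin.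
- exact/measurable_EFinP.
- by apply: emeasurable_funD; exact/measurable_EFinP.
- move=> x Dx; have [_ ->] := dw l x Dx; rewrite -EFinD lee_fin.
  apply: le_trans (HF _ _ _) _; first by rewrite mulr_ge0.
  by rewrite lerD2l mulrAC.
Unshelve. all: by end_near. Qed.

End relaxed_shift.

(** * First-order conditions *)

Section L2.
Context (R : realType) (n : nat) (a b : R).
Notation T := (measurableTypeR R).
Notation D := (`]a, b[%classic).
Hypothesis ab : a < b.
Implicit Types (u v w h : R -> 'rV[R]_n) (f g : R -> R).

Let mD : measurable (D : set T). Proof. exact: measurable_itv. Qed.

Definition sq_int f := measurable_fun (D : set T) f /\
  leb.-integrable (D : set T) (EFin \o (fun x => f x ^+ 2)).

Lemma integrable_dominated f g : measurable_fun (D : set T) f ->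
  leb.-integrable (D : set T) (EFin \o g) -> (forall x, D x -> `|f x| <= g x) ->
  leb.-integrable (D : set T) (EFin \o f).
Proof.
move=> mf ig fg; apply: le_integrable ig => //; first exact/measurable_EFinP.
by move=> x Dx /=; rewrite lee_fin; apply: le_trans (fg x Dx) (ler_norm _).
Qed.

Lemma integrable_RD f g : leb.-integrable (D : set T) (EFin \o f) ->
  leb.-integrable (D : set T) (EFin \o g) -> leb.-integrable (D : set T) (EFin \o (fun x => f x + g x)).
Proof. by move=> fi gi; apply: eq_integrable (integrableD mD fi gi). Qed.

Lemma integrable_RZ (c : R) f : leb.-integrable (D : set T) (EFin \o f) ->
  leb.-integrable (D : set T) (EFin \o (fun x => c * f x)).
Proof. by move=> fi; apply: eq_integrable (integrableZl mD c fi). Qed.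

Lemma sq_intM f g : sq_int f -> sq_int g ->
  leb.-integrable (D : set T) (EFin \o (fun x => f x * g x)).
Proof.
move=> [mf fi] [mg gi]; apply: (integrable_dominated _ _ _ (integrable_RD _ _ fi gi)).
  exact: measurable_funM.
move=> x _; rewrite normrM -(real_normK (num_real (f x))) -(real_normK (num_real (g x))).
have := normr_ge0 (f x); have := normr_ge0 (g x); nra.
Qed.

Lemma sq_intD f g : sq_int f -> sq_int g -> sq_int (fun x => f x + g x).
Proof.
move=> sf sg; have [[mf fi] [mg gi]] := (sf, sg); split; first exact: measurable_funD.
have := integrable_RD _ _ (integrable_RD _ _ fi gi) (integrable_RZ 2 _ (sq_intM f g sf sg)).
by apply: eq_integrable => // x _ /=; congr EFin; ring.
Qed.

Lemma sq_intZ (c : R) f : sq_int f -> sq_int (fun x => c * f x).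
Proof.
move=> [mf fi]; split; first exact: measurable_funM.
by apply: eq_integrable (integrable_RZ (c ^+ 2) _ fi) => // x _ /=; rewrite exprMn.
Qed.

Lemma sq_intB f g : sq_int f -> sq_int g -> sq_int (fun x => f x - g x).
Proof.
move=> sf sg; rewrite (_ : (fun x => _) = (fun x => f x + -1 * g x)); last by apply/funext => x; ring.
by apply: sq_intD => //; exact: sq_intZ.
Qed.

Lemma sq_int_bounded f (C : R) : measurable_fun (D : set T) f ->
  (forall x, D x -> `|f x| <= C) -> sq_int f.
Proof.
move=> mf fC; split => //; apply: (bounded_integrable_oo _ _ _ _ (C ^+ 2)); first exact: ltW.
  exact: measurable_funX.
move=> x xab; rewrite normrX lerXn2r ?nnegrE//; last by apply: fC; rewrite /= in_itv.
by apply: le_trans (fC x _); rewrite /= ?in_itv.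
Qed.

Lemma sq_int_integrable f : sq_int f -> leb.-integrable (D : set T) (EFin \o f).
Proof.
move=> sf; have s1 : sq_int (cst 1) by apply: (sq_int_bounded _ 1) => // x _; rewrite normr1.
by have := sq_intM _ _ sf s1; apply: eq_integrable => // x _ /=; rewrite mulr1.
Qed.

Lemma L2P w : L2 D w <-> forall i, sq_int (fun x => w x ord0 i).
Proof.
split => [[mw iw] i|H].
  have mE : measurable_fun (D : set T) (fun x => enorm (w x) ^+ 2).
    by apply: measurable_funX; exact: enorm_measurable.
  have iE : leb.-integrable (D : set T) (EFin \o (fun x => enorm (w x) ^+ 2)).
    apply/integrableP; split; first exact/measurable_EFinP.
    by under eq_integral do rewrite gee0_abs ?lee_fin ?sqr_ge0//.
  split; first exact: mw.
  apply: (integrable_dominated (fun x => w x ord0 i ^+ 2) _ _ iE); first by apply: measurable_funX; exact: mw.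
  by move=> x _; rewrite normrX lerXn2r ?nnegrE ?enorm_ge0// enorm_coord.
split => [i|]; first by case: (H i).
have : leb.-integrable (D : set T) (EFin \o (fun x => \sum_(i < n) w x ord0 i ^+ 2)).
  by apply: integrable_Rsum => // i; case: (H i).
move=> /integrableP[_]; apply: le_lt_trans; rewrite le_eqVlt; apply/orP; left; apply/eqP.
apply: eq_integral => x _ /=; rewrite ger0_norm ?sumr_ge0//; last by move=> i _; exact: sqr_ge0.
rewrite enorm_sq; congr EFin; by apply: eq_bigr => i _; rewrite expr2.
Qed.

Lemma L2_L1 w : L2 D w -> L1 D w.
Proof. by move=> /L2P Lw i; exact: sq_int_integrable. Qed.

Lemma L2_fidelity w h : L2 D w -> L2 D h ->
  (\int[leb]_(x in (D : set T)) (enorm (w x - h x) ^+ 2)%:E =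
   (\sum_(i < n) \int[leb]_(x in (D : set T)) ((w x ord0 i - h x ord0 i) ^+ 2))%:E)%E.
Proof.
move=> /L2P Lw /L2P Lh; rewrite -Rintegral_sum//; last first.
  by move=> i; case: (sq_intB _ _ (Lw i) (Lh i)).
rewrite fineK; last first.
  apply: integrable_fin_num => //; apply: integrable_Rsum => // i.
  by case: (sq_intB _ _ (Lw i) (Lh i)).
apply: eq_integral => x _; congr EFin; rewrite enorm_sq; apply: eq_bigr => i _.
by rewrite !mxE expr2.
Qed.

Lemma relaxed_ge0 (F : 'rV[R]_n -> R) w : (forall p, 0 <= F p) -> (0 <= relaxed D F w)%E.
Proof.
move=> F0; apply: le_ereal_inf_tmp => _ [v _ <-].
have c0 : limn_einf (cst 0%E : nat -> \bar R) = 0%E.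
  by have [-> _] := cvg_limn_einf_sup (cvg_cst (0%E : \bar R)).
rewrite -c0 -[leRHS]adde0; apply: (limn_einf_add_le R _ _ (cst 0) 0); last exact: cvg_cst.
by move=> l; rewrite adde0; apply: integral_ge0 => x _; rewrite lee_fin.
Qed.

(** Comparison with w = 0, whose relaxed energy is at most F(0) (b - a). Finiteness allows
    [relaxed D F u] to be cancelled from both sides when energies are compared, and it is the
    starting point for the bounded variation of u. *)
Lemma minimizer_relaxed_fin (F : 'rV[R]_n -> R) (lambda : R) h u : (forall p, 0 <= F p) ->
  0 < lambda -> L2 D h -> is_minimizer D F lambda h u -> relaxed D F u \is a fin_num.
Proof.
move=> F0 l0 Lh [Lu mu].
have L0 : L2 D (fun=> (0 : 'rV[R]_n)%R).
  by apply/L2P => i; apply: (sq_int_bounded _ 0) => [|x _]; rewrite ?mxE ?normr0//; under eq_fun do rewrite mxE.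
have rel0 : (relaxed D F (fun=> (0 : 'rV[R]_n)%R) < +oo)%E.
  apply: (@le_lt_trans _ _ (F 0 * (b - a))%:E); last exact: ltry.
  apply: (@le_trans _ _ (limn_einf (cst (F 0 * (b - a))%:E : nat -> \bar R))); last first.
    by have [-> _] := cvg_limn_einf_sup (cvg_cst ((F 0 * (b - a))%:E : \bar R)).
  apply: ereal_inf_lbound; exists (fun _ _ => 0).
    split.
      move=> l x Dx; split; first exact: derivable_cst.
      have -> : derive1 (fun _ : R => (0 : 'rV[R]_n)%R) = cst 0 by apply/funext => y; exact: derive1_cst.
      exact: cvg_cst.
    move=> K cK KD; rewrite (_ : (fun l => _) = cst 0%E); first exact: cvg_cst.
    by apply/funext => l; apply: integral0_eq => x _; rewrite subrr enorm0.
  congr limn_einf; apply/funext => l.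
  under eq_integral do rewrite derive1_cst.
  by rewrite integral_cst//= EFinM (lebesgue_measure_oo _ _ _ (ltW ab)).
have := mu _ L0; rewrite /energy (L2_fidelity _ _ L0 Lh) (L2_fidelity _ _ Lu Lh) => H.
move: H (relaxed_ge0 F u F0) rel0 (relaxed_ge0 F (fun=> (0 : 'rV[R]_n)%R) F0).
move: (relaxed D F u) (relaxed D F (fun=> (0 : 'rV[R]_n)%R)) => x y.
case: x => [x||] //; case: y => [y||] // + _ _ _.
by rewrite gt0_muley ?lte_fin// -!EFinM -EFinD addye.
Qed.

(** The relaxed functional is controlled along u + t S only from above, by a term linear in t. The
    fidelity contributes t P + t^2 Q / 2 exactly, and dividing by t leaves a one-sided inequality in
    the limit. *)
Lemma first_order (F : 'rV[R]_n -> R) (lambda : R) h u S (B : R) : (forall p, 0 <= F p) ->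
  0 < lambda -> L2 D h -> is_minimizer D F lambda h u -> L2 D S ->
  (forall t, 0 < t -> t <= 1 -> (relaxed D F (fun x => (u x + t *: S x)%R) <= relaxed D F u + (t * B)%:E)%E) ->
  0 <= lambda * B + \sum_(i < n) \int[leb]_(x in (D : set T)) ((u x ord0 i - h x ord0 i) * S x ord0 i).
Proof.
move=> F0 l0 Lh mu LS HB; have rfin := minimizer_relaxed_fin F lambda h u F0 l0 Lh mu.
have [Lu min] := mu.
pose A := \sum_(i < n) \int[leb]_(x in (D : set T)) ((u x ord0 i - h x ord0 i) ^+ 2).
pose P := \sum_(i < n) \int[leb]_(x in (D : set T)) ((u x ord0 i - h x ord0 i) * S x ord0 i).
pose Q := \sum_(i < n) \int[leb]_(x in (D : set T)) (S x ord0 i ^+ 2).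
have Q0 : 0 <= Q by apply: sumr_ge0 => i _; apply: Rintegral_ge0 => x _; exact: sqr_ge0.
have key t : 0 < t -> t <= 1 -> 0 <= (lambda * B + P) + t * (Q / 2).
  move=> t0 t1.
  have /L2P sS := LS. have /L2P su := Lu. have /L2P sh := Lh.
  have Lw : L2 D (fun x => u x + t *: S x).
    apply/L2P => i; rewrite (_ : (fun x => _) = (fun x => u x ord0 i + t * S x ord0 i)).
      by apply: sq_intD => //; exact: sq_intZ.
    by apply/funext => x; rewrite !mxE.
  have fid : \sum_(i < n) \int[leb]_(x in (D : set T)) (((u x + t *: S x) ord0 i - h x ord0 i) ^+ 2) =
     A + 2 * t * P + t ^+ 2 * Q.
    rewrite /A /P /Q !mulr_sumr -!big_split; apply: eq_bigr => i _ /=.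
    have suh := sq_intB _ _ (su i) (sh i).
    rewrite -!RintegralZl//; last 2 first.
    - by case: (sS i).
    - exact: sq_intM.
    rewrite -!RintegralD//; last 4 first.
    - by apply: integrable_RD; [case: suh|apply: integrable_RZ; exact: sq_intM].
    - by apply: integrable_RZ; case: (sS i).
    - by case: suh.
    - by apply: integrable_RZ; exact: sq_intM.
    by apply: eq_Rintegral => x _; rewrite !mxE; ring.
  have := min _ Lw; rewrite /energy (L2_fidelity _ _ Lw Lh) (L2_fidelity _ _ Lu Lh) fid -/A => H.
  have {}H : (lambda%:E * relaxed D F u + 2^-1%:E * A%:E <=
     lambda%:E * (relaxed D F u + (t * B)%:E) + 2^-1%:E * (A + 2 * t * P + t ^+ 2 * Q)%:E)%E.
    apply: le_trans H _; apply: leeD => //; rewrite lee_pmul2l ?lte_fin//; exact: HB.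
  move: H; rewrite -(fineK rfin); set r := fine _; rewrite -!(EFinM, EFinD) lee_fin => H.
  have : 0 <= t * ((lambda * B + P) + t * (Q / 2)) by nra.
  by rewrite pmulr_rge0.
rewrite leNgt -/P; apply/negP => neg.
(* If lambda B + P were negative, this t would satisfy t (Q + 1) <= - (lambda B + P), so the term t
   Q / 2 could not compensate for it. The 1 added to Q keeps the denominator positive. *)
pose t := Num.min 1 (- (lambda * B + P) / (Q + 1)).
have t0 : 0 < t by rewrite lt_min ltr01 divr_gt0//; lra.
have t1 : t <= 1 by rewrite ge_min lexx.
have t2 : t * (Q + 1) <= - (lambda * B + P).
  by rewrite -ler_pdivlMr ?ge_min ?lexx ?orbT//; lra.
have := key t t0 t1; nra.
Qed.

End L2.

(** * The flux and its bound *)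

Section flux.
Context (R : realType) (n : nat) (a b : R).
Notation T := (measurableTypeR R).
Notation D := (`]a, b[%classic).
Hypothesis ab : a < b.
Variables (F : 'rV[R]_n -> R) (lambda : R) (h u : R -> 'rV[R]_n).
Hypothesis F0 : forall p, 0 <= F p.
Hypothesis cF : continuous F.
Hypothesis l0 : 0 < lambda.
Hypothesis Lh : L2 D h.
Hypothesis mu : is_minimizer D F lambda h u.

(** Extension by zero lets z be defined on all of R, with tails that are integrals over half-lines
    as in the Fubini lemma. *)
Definition flux_density i : R -> R := (fun x => u x ord0 i - h x ord0 i) \_ D.

(* The function z of the opening comment. *)
Definition flux (y : R) : 'rV[R]_n :=
  \row_i (- (lambda^-1 * \int[leb]_(x in (`]y, +oo[%classic : set T)) flux_density i x)).

Let mD : measurable (D : set T). Proof. exact: measurable_itv. Qed.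

Let Lu : L2 D u. Proof. by case: mu. Qed.

Lemma flux_density_integrable i : leb.-integrable (setT : set T) (EFin \o flux_density i).
Proof.
have /L2P su := Lu; have /L2P sh := Lh.
have H : leb.-integrable (D : set T) (EFin \o (fun x => u x ord0 i - h x ord0 i)).
  by apply: sq_int_integrable => //; exact: sq_intB.
rewrite /flux_density -restrict_EFin; apply/integrable_restrict => //.
by rewrite setTI.
Qed.

Lemma step_derive_ge0 (x : R) : 0 <= derive1 (step R) x.
Proof.
rewrite derive1E; have [_ ->] := is_derive_poly_exp R 1 x.
rewrite /poly_exp derivC subr0 mulr1; case: ifP => // _.
by rewrite hornerXn mulr_ge0 ?expR_ge0 ?sqr_ge0.
Qed.

(** The dilation steepens the profile towards the indicator of []y, +oo[], while its total increase,
    which determines the cost, stays at most 1. *)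
Definition ramp (y : R) (k : nat) (x : R) : R := step R (k.+1%:R * x + - (k.+1%:R * y)).

Lemma smooth_ramp y k : smooth R (ramp y k).
Proof. by apply: smooth_affine; exact: smooth_step. Qed.

Lemma ramp_derive_ge0 y k x : 0 <= derive1 (ramp y k) x.
Proof.
have dstep : derivable (step R) (k.+1%:R * x + - (k.+1%:R * y)) 1 by have [] := smooth_step R 1%N.
rewrite derive1E; have [_ ->] := is_derive_affine _ _ _ _ _ dstep.
by rewrite mulr_ge0// step_derive_ge0.
Qed.

Lemma ramp_cvg y x : ramp y k x @[k --> \oo] --> (\1_(`]y, +oo[%classic) x : R).
Proof.
rewrite indicE; have [yx|xy] := ltP y x.
  rewrite mem_set/= ?in_itv/= ?yx//; apply: step_cvg1.
  apply/cvgryPge => A; near=> k; rewrite -mulrBr -ler_pdivrMr ?subr_gt0//.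
  apply: le_trans (ltW (_ : _ < k%:R)) _; last by rewrite ler_nat.
  by near: k; exact: nbhs_infty_gtr.
rewrite memNset/= ?in_itv/= ?andbT; last by apply/negP; rewrite -leNgt.
rewrite (_ : (fun k => _) = cst 0); first exact: cvg_cst.
apply/funext => k; apply: step_le0; rewrite -mulrBr mulr_ge0_le0// subr_le0//.
Unshelve. all: by end_near. Qed.

Lemma ramp_integral y k : \int[leb]_(x in (D : set T)) derive1 (ramp y k) x <= 1.
Proof.
have sr := smooth_ramp y k.
have dr x : derivable (ramp y k) x 1 by have [] := sr 1%N.
have cr : continuous (derive1 (ramp y k)) by apply: smooth_continuous; exact: smooth_derive1.
have ir := itv_continuous_integrable _ _ a b cr.
have rc x : {for x, continuous (ramp y k)} by apply: smooth_continuous.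
have LR : derivable_oo_LRcontinuous (ramp y k) a b.
  split => [x _|| ]; [exact: dr|exact: cvg_at_right_filter (rc a)|exact: cvg_at_left_filter (rc b)].
have H := @continuous_FTC2 _ (derive1 (ramp y k)) (ramp y k) a b ab (continuous_subspaceT cr) LR (fun x _ => erefl).
rewrite Rintegral_itv_obnd_cbnd; last first.
  by apply: integrableS ir => //; apply: subset_itv; rewrite bnd_simp.
rewrite Rintegral_itv_bndo_bndc.
  rewrite /Rintegral H /= lerBlDr; apply: le_trans (step_le1 _ _) _; rewrite lerDl; exact: step_ge0.
by apply: integrableS ir => //; apply: subset_itvl; rewrite bnd_simp.
Qed.

(** In the limit k -> oo the first-order condition in the direction [ramp y k] times p reads 0 <=
    lambda lam + int_y^b (u - h).p, and the last integral equals - lambda z(y).p. *)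
Lemma flux_bound p (lam : R) y : 0 <= lam ->
  (forall q s, 0 <= s -> F (q + s *: p) <= F q + s * lam) -> dot R n p (flux y) <= lam.
Proof.
move=> lam0 Hp.
have /L2P su := Lu; have /L2P sh := Lh.
have sw i := sq_intB R a b _ _ (su i) (sh i).
pose J i k := \int[leb]_(x in (D : set T)) ((u x ord0 i - h x ord0 i) * ramp y k x).
have key k : 0 <= lambda * lam + \sum_(i < n) p ord0 i * J i k.
  have sr := smooth_ramp y k.
  have br i : sq_int R a b (fun x => (ramp y k x *: p) ord0 i).
    apply: (sq_int_bounded R a b ab _ `|p ord0 i|).
      rewrite (_ : (fun x => _) = (fun x => ramp y k x * p ord0 i)); last by apply/funext => x; rewrite mxE.
      apply: measurable_funM => //.
      by apply: measurable_funTS; apply: continuous_measurable_fun; exact: smooth_continuous.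
    move=> x _; rewrite mxE normrM ler_piMl// ger0_norm; [exact: step_le1|exact: step_ge0].
  have LS : L2 D (fun x => ramp y k x *: p) by apply/L2P.
  have := first_order R n a b ab F lambda h u _ _ F0 l0 Lh mu LS
    (fun t t0 _ => relaxed_shift R n a b (ramp y k) F sr (ramp_derive_ge0 y k) F0 cF u p lam t (ltW t0) lam0 Hp).
  move/le_trans; apply; apply: lerD.
    rewrite ler_pM2l// ler_piMr//; exact: ramp_integral.
  apply: ler_sum => i _; rewrite le_eqVlt; apply/orP; left; apply/eqP.
  rewrite /J -RintegralZl//; last first.
    apply: sq_intM => //; apply: (sq_int_bounded R a b ab _ 1).
      by apply: measurable_funTS; apply: continuous_measurable_fun; exact: smooth_continuous.
    by move=> x _; rewrite ger0_norm; [exact: step_le1|exact: step_ge0].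
  by apply: eq_Rintegral => x _; rewrite mxE; ring.
have cJ i : J i k @[k --> \oo] --> \int[leb]_(x in (`]y, +oo[%classic : set T)) flux_density i x.
  have iw := sq_int_integrable R a b ab _ (sw i).
  have [|x Dx|||_ H] := @Rintegral_dct _ T R leb D (fun k x => (u x ord0 i - h x ord0 i) * ramp y k x)
    (fun x => (u x ord0 i - h x ord0 i) * \1_(`]y, +oo[%classic) x) (fun x => `|u x ord0 i - h x ord0 i|) mD.
  - move=> k; apply: measurable_funM; first by case: (sw i).
    by apply: measurable_funTS; apply: continuous_measurable_fun; apply: smooth_continuous; exact: smooth_ramp.
  - by apply: cvgM; [exact: cvg_cst|exact: ramp_cvg].
  - exact: integrable_norm.
  - by move=> k x Dx; rewrite normrM ler_piMr// ger0_norm; [exact: step_le1|exact: step_ge0].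
  - move: H; rewrite Rintegral_indic setIC /flux_density.
    by rewrite -Rintegral_mkcondr.
have lim : lambda * lam + \sum_(i < n) p ord0 i * J i k @[k --> \oo] -->
   lambda * lam + \sum_(i < n) p ord0 i * \int[leb]_(x in (`]y, +oo[%classic : set T)) flux_density i x.
  apply: cvgD; first exact: cvg_cst.
  by apply: cvg_big => [|i _]; [exact: add_continuous|apply: cvgMl_tmp; exact: cJ].
have : 0 <= lambda * lam + \sum_(i < n) p ord0 i * \int[leb]_(x in (`]y, +oo[%classic : set T)) flux_density i x.
  rewrite -(cvg_lim _ lim)//; apply: limr_ge; first by apply/cvg_ex; eexists; exact: lim.
  by apply: nearW.
rewrite -(ler_pM2l l0 (dot R n p (flux y))) => H; rewrite -subr_ge0; apply: le_trans H _.
rewrite le_eqVlt; apply/orP; left; apply/eqP; congr (_ + _).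
rewrite /dot mulr_sumr -sumrN; apply: eq_bigr => i _; rewrite mxE.
by rewrite mulrN mulrN opprK mulrCA mulVKf// gt_eqF.
Qed.

End flux.

Section ae.
Context d (T : measurableType d) (R : realType) (mu : {measure set T -> \bar R}).

Lemma ae_imply (P Q : T -> Prop) : (forall x, P x -> Q x) ->
  {ae mu, forall x, P x} -> {ae mu, forall x, Q x}.
Proof. by move=> PQ; apply: filterS. Qed.

Lemma ae_and (P Q : T -> Prop) : {ae mu, forall x, P x} -> {ae mu, forall x, Q x} ->
  {ae mu, forall x, P x /\ Q x}.
Proof. by apply: filterS2 => x; split. Qed.

End ae.

Section tail.
Context (R : realType).
Notation T := (measurableTypeR R).

Lemma tail_continuous (g : R -> R) : leb.-integrable (setT : set T) (EFin \o g) ->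
  continuous (fun y => \int[leb]_(x in (`]y, +oo[%classic : set T)) g x).
Proof.
move=> ig y.
have iS (i : interval R) : leb.-integrable ([set` i] : set T) (EFin \o g).
  by apply: integrableS ig => //; exact: measurable_itv.
have y12 : y - 1 < y + 1 by lra.
have c1 := @parameterized_integral_continuous R (y - 1) (y + 1) g (ltW y12) (iS _).
have /(continuous_within_itvP _ y12) [c2 _ _] := c1.
have cy : y \in `]y - 1, y + 1[ by rewrite in_itv/=; apply/andP; split; lra.
have {c1 c2} := c2 y cy; rewrite /continuous_at => c3.
(* Near y the tail is a fixed tail minus an integral with variable upper end, which is known to be
   continuous. *)
have H : \int[leb]_(x in (`](y - 1), +oo[%classic : set T)) g x -
   parameterized_integral leb (y - 1) z g @[z --> y] -->
  \int[leb]_(x in (`](y - 1), +oo[%classic : set T)) g x - parameterized_integral leb (y - 1) y g.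
  by apply: cvgB; [exact: cvg_cst|exact: c3].
have E z : y - 1 < z -> \int[leb]_(x in (`](y - 1), +oo[%classic : set T)) g x -
   parameterized_integral leb (y - 1) z g = \int[leb]_(x in (`]z, +oo[%classic : set T)) g x.
  move=> yz; rewrite -(@Rintegral_itvB R g (BRight (y - 1)) +oo%O z)//.
    by rewrite /parameterized_integral !Rintegral_itv_obnd_cbnd ?iS.
  by rewrite bnd_simp ltW.
move: H; rewrite E; last lra.
move=> H; apply: cvg_trans H; apply: near_eq_cvg; near=> z; rewrite E//.
by near: z; apply: lt_nbhsr; lra.
Unshelve. all: by end_near. Qed.

Lemma tail_bounded (g : R -> R) y : leb.-integrable (setT : set T) (EFin \o g) ->
  `|\int[leb]_(x in (`]y, +oo[%classic : set T)) g x| <= \int[leb]_(x in (setT : set T)) `|g x|.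
Proof.
move=> ig; have mI : measurable (`]y, +oo[%classic : set T) by exact: measurable_itv.
apply: le_trans (le_normr_Rintegral mI _) _; first exact: integrableS ig.
rewrite [leLHS]Rintegral_mkcond; apply: le_Rintegral => //.
- rewrite -restrict_EFin; apply/integrable_restrict => //; rewrite setTI.
  by apply: integrable_norm; exact: integrableS ig.
- exact: integrable_norm.
- by move=> x _; rewrite patchE; case: ifP => // _; exact: normr_ge0.
Qed.

End tail.

(** * Pointwise representation by a distribution function *)

Section representation.
Context (R : realType) (n : nat) (a b : R).
Notation T := (measurableTypeR R).
Notation D := (`]a, b[%classic).
Hypothesis ab : a < b.
Variables (m : {finite_measure set T -> \bar R}) (nu : 'I_n -> R -> R).
Variables (u : R -> 'rV[R]_n) (Du : vmeasure R n).
Hypothesis Lu : L1 D u.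
Hypothesis inu : forall i, m.-integrable (setT : set T) (EFin \o nu i).
Hypothesis Dnu : forall i (A : set T), measurable A -> Du i A = (\int[m]_(x in A) (nu i x)%:E)%E.
Hypothesis distr : distr_derivative D u Du.

Let mD : measurable (D : set T). Proof. exact: measurable_itv. Qed.

(** The ray is open at x, so this function is left continuous and an atom of Du at x counts only to
    the right of x, in accordance with the intervals [x, y[. *)
Definition head i (x : R) : R := \int[m]_(y in (`]-oo, x[%classic : set T)) nu i y.

Lemma headE i x : fine (Du i (`]-oo, x[%classic : set T)) = head i x.
Proof. by rewrite Dnu//; exact: measurable_itv. Qed.

Lemma head_integrable i (g : R -> R) : leb.-integrable (setT : set T) (EFin \o g) ->
  leb.-integrable (setT : set T) (EFin \o (fun x => g x * head i x)).
Proof. by move=> ig; have := integrable_fubini_left _ leb m _ _ ig (inu i). Qed.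

Lemma test_integral i (psi : R -> R) : test_function D psi ->
  \int[leb]_(x in (D : set T)) (u x ord0 i * derive1 psi x) =
  \int[leb]_(x in (D : set T)) (head i x * derive1 psi x).
Proof.
move=> tpsi; have [_ ->//] := distr i.
have [M HM] := test_function_supp _ _ _ tpsi.
have [smo _ sub] := tpsi.
have dpsi x : derivable psi x 1 := smo 0%N x.
have cpsi' : continuous (derive1 psi).
  by move=> x; apply: differentiable_continuous; apply/derivable1_diffP; exact: (smo 1%N x).
rewrite (charge_integral_C1 _ _ _ _ _ dpsi cpsi' HM) opprK.
have psi0 x : ~ (a <= x <= b) -> psi x = 0.
  move=> nx; apply/eqP/negPn/negP => px; apply: nx.
  have /sub : closure [set x | psi x != 0] x by exact: subset_closure.
  by rewrite /= in_itv/= => /andP[h1 h2]; rewrite !ltW.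
have psi'0 := supp_derive1 _ _ _ _ psi0.
have ih : leb.-integrable (setT : set T) (EFin \o (fun x => derive1 psi x * head i x)).
  by apply: head_integrable; exact: supp_continuous_integrable cpsi' psi'0.
transitivity (\int[leb]_(x in (`[a, b]%classic : set T)) (derive1 psi x * head i x)).
  rewrite [RHS]Rintegral_mkcond; apply: eq_Rintegral => x _; rewrite headE patchE.
  by case: ifPn => // /negP; rewrite inE/= in_itv/= => /psi'0 ->; rewrite mul0r.
rewrite -Rintegral_itv_obnd_cbnd; last by apply: integrableS ih => //; exact: measurable_itv.
rewrite -Rintegral_itv_bndo_bndc; last by apply: integrableS ih => //; exact: measurable_itv.
by apply: eq_Rintegral => x _; rewrite mulrC.
Qed.

(** By [test_integral] the difference of u and [head] has vanishing distributional derivative on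
    D. *)
Lemma head_representation i : exists C : R,
  {ae (@lebesgue_measure R), forall x, `]a, b[%classic x -> u x ord0 i = C + head i x}.
Proof.
have i1 : leb.-integrable (setT : set T) (EFin \o (\1_D : R -> R)).
  exact: (@integrable_indic_itv R a b false true).
have ihD : leb.-integrable (D : set T) (EFin \o head i).
  have := head_integrable i _ i1 => /(integrableS measurableT mD (@subsetT _ _)).
  by apply: eq_integrable => // x xD /=; rewrite indicE xD mul1r.
have [|psi tpsi|C HC] := du_bois_reymond R a b (fun x => u x ord0 i - head i x) ab.
- by have := integrableB mD (Lu i) ihD; apply: eq_integrable.
- have [M HM] := test_function_supp _ _ _ tpsi.
  have [smo _ _] := tpsi.
  have cpsi' : continuous (derive1 psi).
    by move=> x; apply: differentiable_continuous; apply/derivable1_diffP; exact: (smo 1%N x).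
  have [N N0 HN] := supp_continuous_bounded _ _ _ _ cpsi' (supp_derive1 _ _ _ _ HM).
  have mpsi' : measurable_fun (D : set T) (derive1 psi) by apply: measurable_funTS; exact: continuous_measurable_fun.
  have bd f : leb.-integrable (D : set T) (EFin \o f) ->
    leb.-integrable (D : set T) (EFin \o (fun x => f x * derive1 psi x)).
    by move=> iF; apply: (integrable_mul_bounded _ _ _ _ _ _ _ N) => // x _.
  under eq_Rintegral do rewrite mulrBl.
  by rewrite RintegralB ?test_integral ?subrr//; [exact: bd (Lu i)|exact: bd].
- by exists C; apply: ae_imply HC => x Hx /Hx <-; rewrite subrK.
Qed.

Section cut.
Variables (chi : R -> R) (al be : R).
Hypothesis (aal : a < al) (albe : al < be) (beb : be < b).
Hypothesis schi : smooth R chi.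
Hypothesis chi_supp : forall x, ~ (al < x < be) -> chi x = 0.

Let chi_supp' x : ~ (al <= x <= be) -> chi x = 0.
Proof. by move=> nx; apply: chi_supp => /andP[h1 h2]; apply: nx; rewrite !ltW. Qed.

Let dchi x : derivable chi x 1. Proof. by have [] := schi 1%N. Qed.
Let cchi : continuous chi. Proof. exact: smooth_continuous. Qed.
Let cchi' : continuous (derive1 chi).
Proof. by apply: smooth_continuous; exact: smooth_derive1. Qed.
Let ichi' : leb.-integrable (setT : set T) (EFin \o derive1 chi).
Proof. exact: supp_continuous_integrable cchi' (supp_derive1 _ _ _ _ chi_supp'). Qed.

Let tchi : test_function D chi.
Proof.
apply: smooth_test_function schi chi_supp' _.
by apply: subset_itv; rewrite bnd_simp.
Qed.

Lemma nuchi_integrable i : m.-integrable (setT : set T) (EFin \o (fun y => nu i y * chi y)).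
Proof.
have [C C0 HC] := supp_continuous_bounded _ _ _ _ cchi chi_supp'.
by apply: (integrable_mul_bounded _ _ _ _ _ _ _ C) => //; exact: continuous_measurable_fun.
Qed.

Lemma cut_derive_integral i :
  \int[leb]_(x in (D : set T)) (derive1 chi x * u x ord0 i) =
  - \int[m]_(y in (setT : set T)) (nu i y * chi y).
Proof.
rewrite (C1_supp_Rintegral _ m _ _ _ _ (inu i) dchi cchi' chi_supp') opprK.
under eq_Rintegral do rewrite mulrC.
rewrite test_integral// Rintegral_mkcond; apply: eq_Rintegral => x _.
rewrite patchE mulrC; case: ifPn => // /negP; rewrite inE/= in_itv/= => nx.
rewrite (supp_derive1 _ _ _ _ chi_supp') ?mul0r// => /andP[h1 h2]; apply: nx.
by rewrite (lt_le_trans aal h1) (le_lt_trans h2 beb).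
Qed.

Lemma cut_FTC (x y : R) : y <= x -> \int[leb]_(s in (`]y, x[%classic : set T)) derive1 chi s = chi x - chi y.
Proof.
rewrite le_eqVlt => /predU1P[->|yx].
  by rewrite subrr set_itvoo0 Rintegral_set0.
have rc z : {for z, continuous chi} by apply: cchi.
have LR : derivable_oo_LRcontinuous chi y x.
  split => [z _|| ]; [exact: dchi|exact: cvg_at_right_filter (rc y)|exact: cvg_at_left_filter (rc x)].
have H := @continuous_FTC2 _ (derive1 chi) chi y x yx (continuous_subspaceT cchi') LR (fun x _ => erefl).
rewrite Rintegral_itv_obnd_cbnd; last by apply: integrableS ichi' => //; exact: measurable_itv.
rewrite Rintegral_itv_bndo_bndc; last by apply: integrableS ichi' => //; exact: measurable_itv.
by rewrite /Rintegral H.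
Qed.

(** Since u = C + [head] almost everywhere, this identifies [damp] with minus the integral of chi
    over []-oo, x[] against Du: the perturbation damps the measure Du itself, atoms included. *)
Lemma damp_int_head i (C x : R) :
  {ae (@lebesgue_measure R), forall x, `]a, b[%classic x -> u x ord0 i = C + head i x} ->
  damp_int R n chi u i x = chi x * (C + head i x) - \int[m]_(y in (`]-oo, x[%classic : set T)) (nu i y * chi y).
Proof.
move=> HC.
have mx : measurable (`]-oo, x[%classic : set T) by exact: measurable_itv.
have ihead : leb.-integrable (setT : set T) (EFin \o (fun s => derive1 chi s * head i s)) by exact: head_integrable.
transitivity (\int[leb]_(s in (`]-oo, x[%classic : set T)) (derive1 chi s * C + derive1 chi s * head i s)).
  have lu : locint R n al be u by exact: (L1_locint R n a b).
  congr fine; apply: ae_eq_integral => //.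
  - apply/measurable_EFinP; apply: measurable_funS (measurableT) (@subsetT _ _) _.
    by have /measurable_int/measurable_EFinP := damp_integrable R n al be chi schi chi_supp u i lu.
  - apply/measurable_EFinP; apply: measurable_funS (measurableT) (@subsetT _ _) _.
    apply: measurable_funD; last by have /measurable_int/measurable_EFinP := ihead.
    by apply: measurable_funM => //; exact: continuous_measurable_fun.
  - apply: ae_imply HC => s Hs _; congr EFin; rewrite -mulrDr.
    have [Ds|nDs] := pselect (`]a, b[%classic s); first by rewrite Hs.
    rewrite (supp_derive1 _ _ _ _ chi_supp') ?mul0r// => /andP[h1 h2]; apply: nDs.
    by rewrite /= in_itv/= (lt_le_trans aal h1) (le_lt_trans h2 beb).
have iC : leb.-integrable (setT : set T) (EFin \o (fun s => derive1 chi s * C)).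
  by apply: (integrable_mul_bounded _ _ _ _ _ _ _ `|C|).
rewrite RintegralD//; last 2 first.
- exact: integrableS iC.
- exact: integrableS ihead.
rewrite RintegralZr//; last exact: integrableS ichi'.
have -> : \int[leb]_(x in (`]-oo, x[%classic : set T)) derive1 chi x = chi x.
  have yx : Num.min x al - 1 <= x by rewrite lerBlDr (le_trans (_ : _ <= x)) ?ge_min ?lexx// lerDl.
  have low z : z <= Num.min x al - 1 -> ~ (al <= z <= be).
    move=> zy /andP[h _]; have : z < al by apply: le_lt_trans zy _; rewrite ltrBlDr ltr_pwDr// ge_min lexx orbT.
    by rewrite ltNge h.
  rewrite -[RHS]subr0 -[in RHS](chi_supp' _ (low _ (lexx _))) -(cut_FTC _ _ yx).
  rewrite [LHS]Rintegral_mkcond [RHS]Rintegral_mkcond; apply: eq_Rintegral => s _; rewrite !patchE.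
  have [sx|xs] := ltP s x; last first.
    by rewrite !memNset//= in_itv/= (ltNge s) xs ?andbF.
  rewrite mem_set/= ?in_itv//=; have [ys|sy] := ltP (Num.min x al - 1) s.
    by rewrite mem_set/= ?in_itv/= ?ys.
  rewrite memNset/= ?in_itv/= ?ltNge ?sy//.
  by rewrite (supp_derive1 _ _ _ _ chi_supp')//; exact: low.
(* Cutting chi' off at x brings the double integral into the form of [Rintegral_fubini]; the tail of
   [g] from y < x is chi(x) - chi(y). *)
pose g := (derive1 chi) \_ (`]-oo, x[%classic : set T).
have ig : leb.-integrable (setT : set T) (EFin \o g).
  rewrite /g -restrict_EFin; apply/integrable_restrict => //; rewrite setTI.
  exact: integrableS ichi'.
have -> : \int[leb]_(s in (`]-oo, x[%classic : set T)) (derive1 chi s * head i s) =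
    \int[leb]_(s in (setT : set T)) (g s * head i s).
  rewrite Rintegral_mkcond; apply: eq_Rintegral => s _; rewrite /g !patchE.
  by case: ifP => // _; rewrite mul0r.
rewrite (Rintegral_fubini _ leb m _ _ ig (inu i)).
have -> : \int[m]_(y in (setT : set T)) (nu i y * \int[leb]_(s in (`]y, +oo[%classic : set T)) g s) =
    \int[m]_(y in (`]-oo, x[%classic : set T)) (nu i y * chi x - nu i y * chi y).
  rewrite [RHS]Rintegral_mkcond; apply: eq_Rintegral => y _; rewrite patchE /g.
  rewrite -Rintegral_mkcondr; have [yx|xy] := ltP y x.
    rewrite mem_set/= ?in_itv//= -mulrBr -(cut_FTC _ _ (ltW yx)); congr (_ * Rintegral _ _ _).
    apply/seteqP; split => s /=; rewrite !in_itv/= andbT; first by case=> -> ->.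
    by case/andP.
  rewrite memNset/= ?in_itv/= ?ltNge ?xy// (_ : _ `&` _ = set0) ?Rintegral_set0 ?mulr0//.
  apply/seteqP; split => s //=; rewrite !in_itv/= andbT => -[ys sx].
  by move: (lt_trans ys sx); rewrite ltNge xy.
rewrite RintegralB//; last 2 first.
- apply: (integrable_mul_bounded _ _ _ _ _ _ _ `|chi x|) => //.
  exact: integrableS (inu i).
- exact: integrableS (nuchi_integrable i).
rewrite RintegralZr//; last exact: integrableS (inu i).
by rewrite /head mulrDr [in RHS]mulrC; ring.
Qed.

End cut.
End representation.

(** * The variational inequality on intervals *)

Section variational.
Context (R : realType) (n : nat) (a b : R).
Notation T := (measurableTypeR R).
Notation D := (`]a, b[%classic).
Hypothesis ab : a < b.
Variables (F : 'rV[R]_n -> R) (lambda : R) (h u : R -> 'rV[R]_n).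
Hypothesis F0 : forall p, 0 <= F p.
Hypothesis cF : continuous F.
Hypothesis F_cvx : forall p (t : R), 0 <= t <= 1 -> F ((1 - t) *: p) <= (1 - t) * F p + t * F 0.
Hypothesis l0 : 0 < lambda.
Hypothesis Lh : L2 D h.
Hypothesis mu : is_minimizer D F lambda h u.
Variables (m : {finite_measure set T -> \bar R}) (nu : 'I_n -> R -> R) (Du : vmeasure R n).
Hypothesis inu : forall i, m.-integrable (setT : set T) (EFin \o nu i).
Hypothesis Dnu : forall i (A : set T), measurable A -> Du i A = (\int[m]_(x in A) (nu i x)%:E)%E.
Hypothesis distr : distr_derivative D u Du.

Let mD : measurable (D : set T). Proof. exact: measurable_itv. Qed.
Let Lu : L2 D u. Proof. by case: mu. Qed.
Let Lu1 : L1 D u. Proof. exact: L2_L1. Qed.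
Notation z := (flux R n a b lambda h u).

Lemma flux_continuous i : continuous (fun y => z y ord0 i).
Proof.
rewrite (_ : (fun y => _) = (fun y => - (lambda^-1 * \int[leb]_(x in (`]y, +oo[%classic : set T)) flux_density R n a b h u i x))).
  move=> y; apply: cvgN; apply: cvgMl_tmp; apply: tail_continuous.
  exact: (flux_density_integrable R n a b ab F lambda).
by apply/funext => y; rewrite mxE.
Qed.

Lemma flux_bounded i : exists2 C : R, 0 <= C & forall y, `|z y ord0 i| <= C.
Proof.
have id := flux_density_integrable R n a b ab F lambda h u Lh mu i.
exists (lambda^-1 * \int[leb]_(x in (setT : set T)) `|flux_density R n a b h u i x|).
  by rewrite mulr_ge0 ?invr_ge0 ?(ltW l0)//; apply: Rintegral_ge0.
move=> y; rewrite mxE normrN normrM gtr0_norm ?invr_gt0// ler_pM2l ?invr_gt0//.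
exact: tail_bounded.
Qed.

Lemma flux_nu_integrable (q : 'rV[R]_n) i :
  m.-integrable (setT : set T) (EFin \o (fun x => nu i x * (z x ord0 i - q ord0 i))).
Proof.
have [C C0 HC] := flux_bounded i.
apply: (integrable_mul_bounded _ _ _ _ _ _ _ (C + `|q ord0 i|)) => //.
  apply: measurable_funB => //; apply: continuous_measurable_fun; exact: flux_continuous.
by move=> x _; apply: le_trans (ler_normB _ _) _; rewrite lerD2r.
Qed.

Section cut.
Variables (chi : R -> R) (al be : R) (q : 'rV[R]_n) (C : R).
Hypothesis (aal : a < al) (albe : al < be) (beb : be < b).
Hypothesis schi : smooth R chi.
Hypothesis chi_supp : forall x, ~ (al < x < be) -> chi x = 0.
Hypothesis chi01 : forall x, 0 <= chi x <= 1.
Hypothesis Fq : forall p, dot R n q p <= F p + C.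

(** The first-order condition in the direction [damp]. That direction is minus a primitive of chi
    Du, so Fubini moves the integration onto u - h, whose tail from y is - lambda z(y): this
    produces the pairing of z with Du. The pairing with q comes from [damp_cost]. *)
Lemma variational_cut :
  0 <= (F 0 + C) * \int[leb]_(x in (D : set T)) chi x +
   \int[m]_(x in (setT : set T)) ((\sum_(i < n) nu i x * (z x ord0 i - q ord0 i)) * chi x).
Proof.
have lu : locint R n al be u by exact: (L1_locint R n a b).
have [M M0 HM] := damp_bound R al be chi schi chi_supp.
have /L2P su := Lu; have /L2P sh := Lh.
have cchi : continuous chi by exact: smooth_continuous.
have sdamp i : sq_int R a b (fun x => damp R n chi u x ord0 i).
  rewrite (_ : (fun x => _) = (fun x => damp_int R n chi u i x - chi x * u x ord0 i)); last first.
    by apply/funext => x; rewrite mxE.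
  apply: sq_intB.
    apply: (sq_int_bounded R a b ab _ (M * \int[leb]_(s in (`[al, be]%classic : set T)) enorm (u s))).
      exact: (damp_int_measurable R n a b al be).
    by move=> x _; exact: damp_int_bound.
  have [mu_ iu] := su i; split.
    by apply: measurable_funM => //; apply: measurable_funTS; exact: continuous_measurable_fun.
  apply: (integrable_dominated R a b _ _ _ iu).
    apply: measurable_funX; apply: measurable_funM => //; apply: measurable_funTS; exact: continuous_measurable_fun.
  move=> x _; rewrite ger0_norm ?sqr_ge0// exprMn ler_piMl ?sqr_ge0// expr_le1//.
    by case/andP: (chi01 x).
  by case/andP: (chi01 x).
have LS : L2 D (damp R n chi u) by apply/L2P.
have H := first_order R n a b ab F lambda h u _ (damp_cost R n a b chi F q C u) F0 l0 Lh mu LS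
   (fun t t0 t1 => relaxed_perturb R n a b al be chi aal albe beb schi chi_supp chi01 F q C F0 cF F_cvx Fq u t (introT andP (conj (ltW t0) t1)) Lu1).
have idn i := flux_density_integrable R n a b ab F lambda h u Lh mu i.
have inc i := nuchi_integrable R n m nu inu chi al be schi chi_supp i.
have izc i : m.-integrable (setT : set T) (EFin \o (fun y => nu i y * chi y * z y ord0 i)).
  have [K K0 HK] := flux_bounded i; apply: (integrable_mul_bounded _ _ _ _ _ _ _ K) => //.
  apply: continuous_measurable_fun; exact: flux_continuous.
have E i : \int[leb]_(x in (D : set T)) ((u x ord0 i - h x ord0 i) * damp R n chi u x ord0 i) =
   lambda * \int[m]_(y in (setT : set T)) (nu i y * chi y * z y ord0 i).
  have [K HK] := head_representation R n a b ab m nu u Du Lu1 inu Dnu distr i.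
  transitivity (- \int[leb]_(x in (setT : set T)) (flux_density R n a b h u i x *
      \int[m]_(y in (`]-oo, x[%classic : set T)) (nu i y * chi y))).
    have iF := integrable_fubini_left _ leb m _ _ (idn i) (inc i).
    rewrite -[RHS]mulN1r -RintegralZl// [RHS](_ : _ = \int[leb]_(x in (D : set T)) (- 1 * ((u x ord0 i - h x ord0 i) * \int[m]_(y in (`]-oo, x[%classic : set T)) (nu i y * chi y)))); last first.
      rewrite [RHS]Rintegral_mkcond; apply: eq_Rintegral => x _; rewrite /flux_density !patchE.
      by case: ifP => // _; rewrite mul0r mulr0.
    congr fine; apply: ae_eq_integral => //.
    - apply/measurable_EFinP; apply: measurable_funM; last by case: (sdamp i).
      by case: (sq_intB _ _ _ _ _ (su i) (sh i)).
    - apply/measurable_EFinP; apply: measurable_funM => //.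
      have : measurable_fun (D : set T) (fun x => flux_density R n a b h u i x * \int[m]_(y in (`]-oo, x[%classic : set T)) (nu i y * chi y)).
        by apply: measurable_funTS; have /measurable_int/measurable_EFinP := iF.
      by apply: eq_measurable_fun => x xD; rewrite /flux_density patchE xD.
    - apply: (ae_imply _ _ _ _ _ _ _ HK) => x Hx Dx; congr EFin; rewrite mxE (damp_int_head R n a b m nu u Lu1 inu chi al be aal beb schi chi_supp i K x HK) (Hx Dx).
      ring.
  rewrite (Rintegral_fubini _ leb m _ _ (idn i) (inc i)).
  under eq_Rintegral => y _.
    rewrite (_ : _ * _ = - lambda * (nu i y * chi y * z y ord0 i)); last by rewrite mxE; field; rewrite gt_eqF.
    over.
  by rewrite RintegralZl// mulNr opprK.
have {H} : 0 <= lambda * ((F 0 + C) * \int[leb]_(x in (D : set T)) chi x +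
   \sum_(i < n) (- (q ord0 i * \int[m]_(y in (setT : set T)) (nu i y * chi y)) + \int[m]_(y in (setT : set T)) (nu i y * chi y * z y ord0 i))).
  apply: le_trans H _; rewrite le_eqVlt; apply/orP; left; apply/eqP.
  rewrite /damp_cost big_split/= !mulrDr addrA; congr (_ + _ + _).
    congr (_ * _); apply: eq_bigr => i _.
    by rewrite (cut_derive_integral R n a b m nu u Du inu Dnu distr chi al be) ?mulrN.
  by rewrite mulr_sumr; apply: eq_bigr => i _; exact: E.
rewrite pmulr_rge0// => /le_trans; apply; rewrite lerD2l le_eqVlt; apply/orP; left; apply/eqP.
have iqc i : m.-integrable (setT : set T) (EFin \o (fun y => q ord0 i * (nu i y * chi y))).
  by apply: eq_integrable (integrableZl measurableT (q ord0 i) (inc i)).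
transitivity (\sum_(i < n) \int[m]_(y in (setT : set T)) (nu i y * chi y * z y ord0 i - q ord0 i * (nu i y * chi y))).
  apply: eq_bigr => i _; rewrite -RintegralZl//; last exact: inc.
  by rewrite addrC; symmetry; apply: RintegralB.
rewrite -Rintegral_sum//; last by move=> i; apply: eq_integrable (integrableB measurableT (izc i) (iqc i)).
apply: eq_Rintegral => x _; rewrite mulr_suml; apply: eq_bigr => i _; ring.
Qed.

End cut.

Lemma variational_ineq (q : 'rV[R]_n) (C x xi : R) : (forall p, dot R n q p <= F p + C) ->
  a < x -> x < xi -> xi < b ->
  0 <= (F 0 + C) * (xi - x) +
    \int[m]_(y in (`[x, xi[%classic : set T)) (\sum_(i < n) nu i y * (z y ord0 i - q ord0 i)).
Proof.
move=> Fq ax xxi xib.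
(* The cut-offs extend to the left of x by 1/(k+1), and up to xi on the right; margins on both sides
   keep their supports strictly inside ]al, be[. *)
have [al [aal alx]] : exists al, a < al /\ al < x by exists ((a + x) / 2); split; lra.
have [be [xibe beb]] : exists be, xi < be /\ be < b by exists ((xi + b) / 2); split; lra.
have ig : m.-integrable (setT : set T) (EFin \o (fun y => \sum_(i < n) nu i y * (z y ord0 i - q ord0 i))).
  by apply: integrable_Rsum => // i; exact: flux_nu_integrable.
have i1 : leb.-integrable (D : set T) (EFin \o (cst 1 : R -> R)).
  by apply: (bounded_integrable_oo _ _ _ _ 1) => //; [exact: ltW|move=> t _; rewrite normr1].
have c1 := cutoff_Rintegral R leb _ _ x xi mD i1.
have c2 := cutoff_Rintegral R m _ _ x xi measurableT ig.
have L : (F 0 + C) * \int[leb]_(y in (D : set T)) (cst 1 y * cutoff R x xi k y) +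
    \int[m]_(y in (setT : set T)) ((\sum_(i < n) nu i y * (z y ord0 i - q ord0 i)) * cutoff R x xi k y) @[k --> \oo] -->
    (F 0 + C) * \int[leb]_(y in (D : set T)) (cst 1 y * \1_(`[x, xi[%classic) y) +
    \int[m]_(y in (setT : set T)) ((\sum_(i < n) nu i y * (z y ord0 i - q ord0 i)) * \1_(`[x, xi[%classic) y).
  by apply: cvgD; [apply: cvgM; [exact: cvg_cst|exact: c1]|exact: c2].
have E1 : \int[leb]_(y in (D : set T)) (cst 1 y * \1_(`[x, xi[%classic) y) = xi - x.
  rewrite Rintegral_indic (_ : _ `&` _ = `[x, xi[%classic).
    rewrite /Rintegral (eq_integral (cst 1%:E))// integral_cst; last exact: measurable_itv.
    by rewrite mul1e; have /= -> := lebesgue_measure_co _ _ _ (ltW xxi).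
  by apply: setIidr; apply: subset_itv; rewrite bnd_simp// ltW.
rewrite E1 Rintegral_indic setTI in L.
rewrite -(cvg_lim _ L)//; apply: limr_ge; first by apply/cvg_ex; eexists; exact: L.
near=> k.
have H := variational_cut (cutoff R x xi k) al be q C aal (lt_trans alx (lt_trans xxi xibe)) beb (smooth_cutoff R x xi k).
apply: le_trans (H _ _ Fq) _.
- move=> y ny; apply: cutoff_supp => /andP[xy yxi]; apply: ny; rewrite (le_lt_trans yxi xibe) andbT.
  apply: lt_le_trans xy; rewrite ltrBrDl -ltrBrDr.
  by near: k; apply: near_infty_natSinv_lt (PosNum _); rewrite subr_gt0.
- by move=> y; rewrite cutoff_ge0 cutoff_le1.
rewrite le_eqVlt; apply/orP; left; apply/eqP; rewrite /=; congr (_ * _ + _).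
by apply: eq_Rintegral => y _; rewrite mul1r.
Unshelve. all: by end_near. Qed.

End variational.

Section null_set.
Context (R : realType).
Notation T := (measurableTypeR R).
Variables (m : {finite_measure set T -> \bar R}) (a b K : R).
Notation D := (`]a, b[%classic).

(** The error K (xi - x) is absorbed into a charge: rho = - g m - K leb is nonpositive on short
    right intervals in D, hence by the covering lemma on subsets of N in D, where its Lebesgue part
    vanishes. *)
Lemma ae_ge0_on_null_set (N : set T) (g : R -> R) : a < b -> measurable N -> leb N = 0%E ->
  m.-integrable (setT : set T) (EFin \o g) -> 0 <= K ->
  (forall x xi, a < x -> x < xi -> xi < b ->
     0 <= K * (xi - x) + \int[m]_(y in (`[x, xi[%classic : set T)) g y) ->
  {ae m, forall x : T, (N `&` (D : set T)) x -> 0 <= g x}.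
Proof.
move=> ab mN N0 ig K0 Hg.
have mD : measurable (D : set T) by exact: measurable_itv.
have ig' : m.-integrable (setT : set T) (EFin \o (fun x => - g x)).
  by apply: eq_integrable (integrableN ig).
have iK : leb.-integrable (setT : set T) (EFin \o (fun x => - K * (\1_D x : R))).
  by apply: eq_integrable (integrableZl measurableT (- K) (@integrable_indic_itv R a b false true)).
pose c1 := induced_charge ig' : {charge set T -> \bar R}.
pose c2 := induced_charge iK : {charge set T -> \bar R}.
pose rho := cadd c1 c2 : {charge set T -> \bar R}.
have le0 B : measurable B -> B `<=` N `&` (D : set T) -> (\int[m]_(x in B) (- g x)%:E <= 0)%E.
  move=> mB BND.
  have -> : (\int[m]_(x in B) (- g x)%:E = rho B)%E.
    rewrite /rho/= /cadd/= /c2 /c1 /induced_charge/=.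
    rewrite (null_set_integral (mu := leb) mB) ?adde0//.
      by apply: measurable_funTS; exact: measurable_int iK.
    by apply: (subset_measure0 _ _ _ N0) => // x /BND[].
  apply: charge_le0_of_right_itv mB _ => x Bx e e0.
  have [Nx] := BND _ Bx; rewrite /= in_itv/= => /andP[ax xb].
  have [y [xy ye yb]] : exists y : R, [/\ x < y, y < x + e & y < b].
    exists (x + Num.min e (b - x) / 2); set z := Num.min _ _.
    have z0 : 0 < z by rewrite lt_min e0 subr_gt0.
    have ze : z <= e by rewrite ge_min lexx.
    have zb : z <= b - x by rewrite ge_min lexx orbT.
    by move: x Bx Nx ax xb @z z0 ze zb => x' _ _ ax xb z z0 ze zb; split; lra.
  exists y; split => //.
  have mI : measurable (`[x, y[%classic : set T) by exact: measurable_itv.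
  rewrite /rho/= /cadd/= /c2 /c1 /induced_charge/=.
  have i1 : m.-integrable (`[x, y[%classic : set T) (EFin \o (fun x => - g x)) by apply: (integrableS _ _ _ ig').
  have i2 : leb.-integrable (`[x, y[%classic : set T) (EFin \o (fun x => - K * (\1_D x : R))) by apply: (integrableS _ _ _ iK).
  rewrite -[X in (X + _)%E]fineK; last exact: integrable_fin_num i1.
  rewrite -[X in (_ + X)%E]fineK; last exact: integrable_fin_num i2.
  rewrite -EFinD lee_fin.
  have e1 : \int[m]_(x in (`[x, y[%classic : set T)) (- g x) = - \int[m]_(x in (`[x, y[%classic : set T)) g x.
    rewrite -[RHS]mulN1r -RintegralZl//; last exact: integrableS ig.
    by apply: eq_Rintegral => t _; rewrite mulN1r.
  have e2 : \int[leb]_(x in (`[x, y[%classic : set T)) (- K * (\1_D x : R)) = - K * (y - x).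
    transitivity (\int[leb]_(t in (`[x, y[%classic : set T)) (cst (- K) t)).
      apply: eq_Rintegral => t; rewrite inE/= in_itv/= => /andP[xt ty].
      by rewrite indicE mem_set ?mulr1//= in_itv/= (lt_le_trans ax xt) (lt_trans ty yb).
    rewrite /Rintegral (eq_integral (cst (- K)%:E))// integral_cst; last exact: measurable_itv.
    by have /= -> := lebesgue_measure_co _ _ _ (ltW xy).
  move: e1 e2; rewrite /Rintegral => -> ->.
  have := Hg _ _ ax xy yb; rewrite /Rintegral.
  by set I := fine _; lra.
have := ae_le0_of_le0_integral _ _ _ _ _ _ (measurableI _ _ mN mD) ig' le0.
by apply: ae_imply => x H Nx; have := H Nx; rewrite oppr_le0.
Qed.

End null_set.

Section countable_ae.
Context d (T : measurableType d) (R : realType) (mu : {measure set T -> \bar R}).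

Lemma ae_forall_countable (K : countType) (P : K -> T -> Prop) :
  (forall k, {ae mu, forall x, P k x}) -> {ae mu, forall x, forall k, P k x}.
Proof.
move=> HP.
have H : {ae mu, forall x, forall j : nat, if unpickle j is Some k then P k x else True}.
  apply: ae_foralln => j; case: (unpickle j) => [k|]; first exact: HP.
  exact: aeW.
by apply: ae_imply H => x Hx k; have := Hx (pickle k); rewrite pickleK.
Qed.

End countable_ae.

Section good_points.
Context (R : realType) (n : nat) (a b : R).
Notation T := (measurableTypeR R).
Notation D := (`]a, b[%classic).
Hypothesis ab : a < b.
Variables (F : 'rV[R]_n -> R) (lambda : R) (h u : R -> 'rV[R]_n).
Hypothesis F0 : forall p, 0 <= F p.
Hypothesis cF : continuous F.
Hypothesis F_cvx : forall p (t : R), 0 <= t <= 1 -> F ((1 - t) *: p) <= (1 - t) * F p + t * F 0.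
Hypothesis l0 : 0 < lambda.
Hypothesis Lh : L2 D h.
Hypothesis mu : is_minimizer D F lambda h u.
Variables (m : {finite_measure set T -> \bar R}) (nu : 'I_n -> R -> R) (Du : vmeasure R n).
Hypothesis inu : forall i, m.-integrable (setT : set T) (EFin \o nu i).
Hypothesis Dnu : forall i (A : set T), measurable A -> Du i A = (\int[m]_(x in A) (nu i x)%:E)%E.
Hypothesis distr : distr_derivative D u Du.
Notation z := (flux R n a b lambda h u).
Hypothesis Hq : forall th : R, 0 <= th -> th < 1 -> exists2 C : R, 0 <= C &
  forall y p, dot R n (th *: z y) p <= F p + C.
Variable N : set T.
Hypotheses (mN : measurable N) (N0 : leb N = 0%E).

(** The exceptional null set depends on q, so q ranges over the countable family (1 - 1/(k+1)) z(r)
    with r rational. Letting k -> oo and using the continuity of z then gives every y off a single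
    null set. *)
Lemma good_points_ae : {ae m, forall x : T, (N `&` (D : set T)) x ->
  forall y, 0 <= \sum_(i < n) nu i x * (z x ord0 i - z y ord0 i)}.
Proof.
have H : {ae m, forall x : T, forall k : rat * nat, (N `&` (D : set T)) x ->
    0 <= \sum_(i < n) nu i x * (z x ord0 i - (1 - k.2.+1%:R^-1) * z (ratr k.1) ord0 i)}.
  apply: ae_forall_countable => -[r k] /=.
  have k0 : 0 < k.+1%:R^-1 :> R by rewrite invr_gt0.
  have k1 : k.+1%:R^-1 <= 1 :> R by rewrite invf_le1// ler1n.
  have [|| C C0 HC] := Hq (1 - k.+1%:R^-1); first by rewrite subr_ge0.
    by rewrite gtrBl.
  have ig : m.-integrable (setT : set T) (EFin \o (fun x => \sum_(i < n) nu i x * (z x ord0 i - ((1 - k.+1%:R^-1) *: z (ratr r)) ord0 i))).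
    by apply: integrable_Rsum => // i; exact: (flux_nu_integrable R n a b ab F).
  have := ae_ge0_on_null_set R m a b (F 0 + C) N _ ab mN N0 ig (addr_ge0 (F0 _) C0)
    (fun x xi => variational_ineq R n a b ab F lambda h u F0 cF F_cvx l0 Lh mu m nu Du inu Dnu distr _ C x xi (HC (ratr r))).
  have E i : ((1 - k.+1%:R^-1) *: z (ratr r)) ord0 i = (1 - k.+1%:R^-1) * z (ratr r) ord0 i by rewrite mxE.
  apply: ae_imply => x Hx NDx; have := Hx NDx.
  by rewrite (eq_bigr (fun i => nu i x * (z x ord0 i - (1 - k.+1%:R^-1) * z (ratr r) ord0 i)))// => i _; rewrite E.
apply: ae_imply H => x Hx NDx.
pose c := \sum_(i < n) nu i x * z x ord0 i.
pose dd y := \sum_(i < n) nu i x * z y ord0 i.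
have cE y (t : R) : \sum_(i < n) nu i x * (z x ord0 i - t * z y ord0 i) = c - t * dd y.
  rewrite /c /dd mulr_sumr -sumrB; apply: eq_bigr => i _; ring.
have rats (r : rat) : dd (ratr r) <= c.
  rewrite leNgt; apply/negP => cd.
  have [k hk] : exists k : nat, k.+1%:R^-1 * `|dd (ratr r)| < dd (ratr r) - c.
    have p0 : 0 < (dd (ratr r) - c) / (`|dd (ratr r)| + 1) by rewrite divr_gt0// ?subr_gt0// ltr_wpDl.
    have [k _ /(_ k (leqnn k)) hk] := near_infty_natSinv_lt (PosNum p0).
    exists k; apply: le_lt_trans (_ : _ <= k.+1%:R^-1 * (`|dd (ratr r)| + 1)) _; first by rewrite ler_pM2l ?invr_gt0// lerDl.
    by move: hk; rewrite /= ltr_pdivlMr// ltr_wpDl.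
  have := Hx (r, k) NDx; rewrite /= cE mulrBl mul1r => H2.
  have : k.+1%:R^-1 * dd (ratr r) <= k.+1%:R^-1 * `|dd (ratr r)|.
    by rewrite ler_pM2l ?invr_gt0// ler_norm.
  by move: H2 hk; set A := _^-1 * dd _; set B := _^-1 * `| _ |; lra.
have cdd : continuous dd.
  move=> y; apply: cvg_big => [|i _]; first exact: add_continuous.
  by apply: cvgMl_tmp; exact: (flux_continuous R n a b ab F).
move=> y.
rewrite (eq_bigr (fun i => nu i x * (z x ord0 i - 1 * z y ord0 i))); last by move=> i _; rewrite mul1r.
rewrite cE mul1r subr_ge0 leNgt; apply/negP => cy.
have oS : open [set t | c < dd t].
  by apply: (open_comp (f := dd) (D := [set t | c < t])) => [t _|]; [exact: cdd|exact: open_gt].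
have [t [/= ct [r _ rt]]] := @dense_rat R [set t | c < dd t] (ex_intro _ y cy) oS.
by have := rats r; rewrite rt leNgt ct.
Qed.

End good_points.

(** * Comparison of the densities *)

Section density_point.
Context (R : realType) (n : nat).
Notation T := (measurableTypeR R).
Variables (m : {finite_measure set T -> \bar R}) (nu w : 'I_n -> R -> R).
Hypothesis inu : forall i, m.-integrable (setT : set T) (EFin \o nu i).
Hypothesis iw : forall i, m.-integrable (setT : set T) (EFin \o w i).

(* Freeze nu at a rational vector e: where |nu_i - e_i| <= dl, the hypothesis bounds
   the integrals of e . w - dl |w| over arbitrarily short right intervals. *)
Lemma ae_dot_le0 (A : set T) : measurable A ->
  {ae m, forall x : T, A x -> forall e, 0 < e -> exists y : R, [/\ (x : R) < y, y < (x : R) + e &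
     \sum_(i < n) nu i x * \int[m]_(t in (`[(x : R), y[%classic : set T)) w i t <= 0]} ->
  {ae m, forall x : T, A x -> \sum_(i < n) nu i x * w i x <= 0}.
Proof.
move=> mA [M [mM M0 HM]].
have mnu i : measurable_fun (setT : set T) (nu i) by apply/measurable_EFinP; exact: measurable_int (inu i).
have H : {ae m, forall x : T, forall k : {ffun 'I_n -> rat} * nat,
   (A `\` M) x -> (forall i, `|nu i x - ratr (k.1 i)| <= k.2.+1%:R^-1) ->
   \sum_(i < n) (ratr (k.1 i) * w i x - k.2.+1%:R^-1 * `|w i x|) <= 0}.
  apply: ae_forall_countable => -[e k] /=.
  set dl : R := k.+1%:R^-1; have dl0 : 0 <= dl by rewrite invr_ge0.
  (* M is a measurable null set covering the exceptional points. The set where the hypothesis holds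
     need not be measurable, whereas A without M is. *)
  pose B := (A `\` M) `&` \bigcap_i [set x : T | `|nu i x - ratr (e i)| <= dl].
  have mB : measurable B.
    apply: measurableI; first exact: measurableD.
    apply: fin_bigcap_measurable => // i _.
    rewrite (_ : [set x | _] = (setT `&` [set x : T | `|nu i x - ratr (e i)| <= dl])); last by rewrite setTI.
    apply: measurable_fun_ler => //; apply: measurableT_comp => //; exact: measurable_funB.
  have ii i : m.-integrable (setT : set T) (EFin \o (fun x => ratr (e i) * w i x - dl * `|w i x|)).
    have i1 := integrableZl measurableT (ratr (e i)) (iw i).
    have i2 := integrableZl measurableT dl (integrable_norm (iw i)).
    by apply: eq_integrable (integrableB measurableT i1 i2).
  have ig : m.-integrable (setT : set T) (EFin \o (fun x => \sum_(i < n) (ratr (e i) * w i x - dl * `|w i x|))).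
    by apply: integrable_Rsum.
  have HB : forall x, B x -> forall e0, 0 < e0 -> exists y : R, [/\ x < y, y < x + e0 &
     \int[m]_(t in (`[x, y[%classic : set T)) (\sum_(i < n) (ratr (e i) * w i t - dl * `|w i t|)) <= 0].
    move=> x [[Ax nMx] He] e0 e00.
    have good : forall e, 0 < e -> exists y : R, [/\ (x : R) < y, y < (x : R) + e &
     \sum_(i < n) nu i x * \int[m]_(t in (`[(x : R), y[%classic : set T)) w i t <= 0].
      by apply: contrapT => ng; apply: nMx; apply: HM => /(_ Ax).
    have [y [xy ye Hy]] := good e0 e00; exists y; split => //.
    have mI : measurable (`[x, y[%classic : set T) by exact: measurable_itv.
    have iwS i : m.-integrable (`[x, y[%classic : set T) (EFin \o w i) by apply: (integrableS _ _ _ (iw i)).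
    rewrite Rintegral_sum//; last by move=> i; apply: (integrableS _ _ _ (ii i)).
    apply: le_trans Hy; apply: ler_sum => i _.
    have iw1 : m.-integrable (`[x, y[%classic : set T) (EFin \o (fun t => ratr (e i) * w i t)).
      by apply: eq_integrable (integrableZl mI (ratr (e i)) (iwS i)).
    have iw2 : m.-integrable (`[x, y[%classic : set T) (EFin \o (fun t => `|w i t|)).
      by apply: eq_integrable (integrable_norm (iwS i)).
    have iw3 : m.-integrable (`[x, y[%classic : set T) (EFin \o (fun t => dl * `|w i t|)).
      by apply: eq_integrable (integrableZl mI dl iw2).
    rewrite (RintegralB mI iw1 iw3) (RintegralZl _ mI (iwS i)) (RintegralZl _ mI iw2).
    have := He i Logic.I; rewrite /= ler_norml => /andP[h1 h2].
    have := le_normr_Rintegral mI (iwS i).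
    set J := \int[m]_(t in _) w i t; set J' := \int[m]_(t in _) `|w i t| => JJ.
    have : `|(nu i x - ratr (e i)) * J| <= dl * J'.
      by rewrite normrM ler_pM// ler_norml h1.
    rewrite ler_norml => /andP[h3 h4]; nra.
  have := ae_le0_of_right_itv R m B _ mB ig HB.
  by apply: ae_imply => x Hx AMx He; apply: Hx; split => // i _; exact: He.
have H2 : {ae m, forall x : T, ~ M x} by exists M; split => // x /=; rewrite notK.
move: (ae_and _ _ _ _ _ _ H H2); apply: ae_imply => x [{}H nMx] Ax.
(* Freezing nu costs dl |w| under the integral, and returning from the rational vector to nu(x)
   costs the same once more; hence the factor 2. *)
have key (k : nat) : \sum_(i < n) nu i x * w i x <= 2 * k.+1%:R^-1 * \sum_(i < n) `|w i x|.
  have dl0 : 0 < k.+1%:R^-1 :> R by rewrite invr_gt0.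
  have ex i : exists r : rat, `|nu i x - ratr r| <= k.+1%:R^-1.
    have lt2 : nu i x - k.+1%:R^-1 < nu i x + k.+1%:R^-1 by rewrite ltrD2l gt0_cp.
    have [r rin] := rat_in_itvoo lt2; exists r; rewrite ler_norml.
    move: rin; rewrite in_itv/=; set dl := _^-1; set q := ratr r => /andP[h1 h2]; apply/andP; split; lra.
  pose e : {ffun 'I_n -> rat} := [ffun i => projT1 (cid (ex i))].
  have He i : `|nu i x - ratr (e i)| <= k.+1%:R^-1 by rewrite ffunE; case: cid.
  have := H (e, k) (conj Ax nMx) He; rewrite /= sumrB -mulr_sumr => h1.
  have : \sum_(i < n) nu i x * w i x - \sum_(i < n) ratr (e i) * w i x <= k.+1%:R^-1 * \sum_(i < n) `|w i x|.
    rewrite -sumrB mulr_sumr; apply: ler_sum => i _; rewrite -mulrBl.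
    by apply: le_trans (ler_norm _) _; rewrite normrM ler_wpM2r.
  by move: h1; rewrite -mulrA; set Z := _^-1 * _; set S1 := \sum_(i < n) _; set S2 := \sum_(i < n) _ => h1 h2; lra.
rewrite leNgt; apply/negP; set S := \sum_(i < n) _ => S0.
pose W := \sum_(i < n) `|w i x|.
have W0 : 0 <= W by apply: sumr_ge0.
have p0 : 0 < S / (2 * W + 1) by rewrite divr_gt0// ltr_wpDl// mulr_ge0.
have [k _ /(_ k (leqnn k)) hk] := near_infty_natSinv_lt (PosNum p0).
have := key k; rewrite -/S -/W; move: hk; rewrite /= ltr_pdivlMr; last by rewrite ltr_wpDl// mulr_ge0.
have : 0 < k.+1%:R^-1 :> R by rewrite invr_gt0.
by set dl := _^-1; nra.
Qed.

End density_point.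

(** * Sign of increments to the right of a maximum point of the flux *)

Section flux_difference.
Context (R : realType) (n : nat).
Notation T := (measurableTypeR R).

Lemma head_left_continuous (m : {finite_measure set T -> \bar R}) (nu : 'I_n -> R -> R) i (x : R) :
  m.-integrable (setT : set T) (EFin \o nu i) ->
  head R n m nu i y @[y --> x^'-] --> head R n m nu i x.
Proof.
move=> inu; apply/cvg_at_leftP => y [yx cy].
have hE t : head R n m nu i t = \int[m]_(s in (setT : set T)) (nu i s * \1_(`]-oo, t[%classic) s).
  by rewrite Rintegral_indic setTI.
rewrite hE; under eq_fun do rewrite hE.
have mnu : measurable_fun (setT : set T) (nu i) by apply/measurable_EFinP; exact: measurable_int inu.
have [|s _|||//] := @Rintegral_dct _ T R m setT (fun k s => nu i s * \1_(`]-oo, y k[%classic) s)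
  (fun s => nu i s * \1_(`]-oo, x[%classic) s) (fun s => `|nu i s|) measurableT.
- move=> k; apply: measurable_funM => //; apply: measurable_indic; exact: measurable_itv.
- apply: cvgM; first exact: cvg_cst.
  have [sx|xs] := ltP s x.
    apply: cvg_near_cst; near=> k; rewrite !indicE !mem_set//= in_itv//=.
    by near: k; apply: cvgr_gt cy _ sx.
  apply: cvg_near_cst; apply: nearW => k; rewrite !indicE !memNset//= in_itv/=; apply/negP; rewrite -leNgt//.
  by apply: le_trans xs; exact/ltW.
- exact: integrable_norm.
- by move=> k s _; rewrite normrM ler_piMr// indicE; case: (_ \in _); rewrite ?normr1 ?normr0.
Unshelve. all: by end_near. Qed.

Lemma Rintegral_gt0_itv (G : R -> R) (x y : R) : x < y ->
  leb.-integrable (`]x, y]%classic : set T) (EFin \o G) -> (forall s, x < s <= y -> 0 < G s) ->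
  0 < \int[leb]_(s in (`]x, y]%classic : set T)) G s.
Proof.
move=> xy iG G0.
have mI : measurable (`]x, y]%classic : set T) by exact: measurable_itv.
have ge0 : 0 <= \int[leb]_(s in (`]x, y]%classic : set T)) G s.
  by apply: Rintegral_ge0 => s; rewrite /= in_itv/= => /G0/ltW.
rewrite lt_neqAle ge0 andbT eq_sym; apply/eqP => i0.
have e0 : (\int[leb]_(s in (`]x, y]%classic : set T)) `|(G s)%:E| = 0)%E.
  rewrite -[LHS]fineK; last by apply: integrable_fin_num => //; exact: integrable_norm iG.
  congr EFin; rewrite -[RHS]i0; congr fine; apply: eq_integral => s; rewrite inE/= in_itv/= => /G0 Gs.
  by rewrite ger0_norm// ltW.
have [M [mM M0 HM]] := (ae_eq_integral_abs leb mI (measurable_int _ iG)).1 e0.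
have sub : `]x, y]%classic `<=` M.
  move=> s sI; apply: HM => /(_ sI)/= [] Gs0; move: sI; rewrite /= in_itv/= => /G0; by rewrite Gs0 ltxx.
have := subset_measure0 mI mM sub M0.
have /= -> := @lebesgue_measure_itv R `]x, y].
by rewrite lte_fin xy -EFinB => -[] /eqP; rewrite subr_eq0 gt_eqF.
Qed.

Variables (a b lambda : R) (h u : R -> 'rV[R]_n).
Notation D := (`]a, b[%classic).
Hypothesis l0 : 0 < lambda.
Hypothesis id : forall i, leb.-integrable (setT : set T) (EFin \o flux_density R n a b h u i).
Notation z := (flux R n a b lambda h u).

Lemma fluxB i (x y : R) : x <= y ->
  z y ord0 i - z x ord0 i = lambda^-1 * \int[leb]_(s in (`]x, y]%classic : set T)) flux_density R n a b h u i s.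
Proof.
move=> xy; rewrite !mxE.
have iS (j : interval R) : leb.-integrable ([set` j] : set T) (EFin \o flux_density R n a b h u i).
  by apply: (integrableS _ _ _ (id i)) => //; exact: measurable_itv.
have H := @Rintegral_itvB R (flux_density R n a b h u i) (BRight x) +oo%O y (iS _).
rewrite -H ?bnd_simp//; ring.
Qed.

Variables (m : {finite_measure set T -> \bar R}) (nu nuh : 'I_n -> R -> R) (c d : R) (K : 'I_n -> R).
Hypothesis inu : forall i, m.-integrable (setT : set T) (EFin \o nu i).
Hypothesis inuh : forall i, m.-integrable (setT : set T) (EFin \o nuh i).
Notation V i s := (K i + head R n m nu i s - head R n m nuh i s).
Hypothesis cdD : `]c, d[ `<=` D.
Hypothesis uhV : forall i, {ae leb, forall x : T, (`]c, d[%classic : set T) x -> u x ord0 i - h x ord0 i = V i x}.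

(** The hypothesis says that y -> nu(x).z(y) is maximal at x, and its derivative is nu(x).V / lambda
    almost everywhere in ]c, d[. From the left the sign of the derivative passes to V(x) by left
    continuity; across a possible jump at x it is available only at points y close to x. The
    increment of V from x to y is the integral of nu - nuh over [x, y[. *)
Lemma good_point_right (x : R) : c < x < d ->
  (forall y, 0 <= \sum_(i < n) nu i x * (z x ord0 i - z y ord0 i)) ->
  forall e, 0 < e -> exists y, [/\ x < y, y < x + e &
    \sum_(i < n) nu i x * \int[m]_(t in (`[x, y[%classic : set T)) (nu i t - nuh i t) <= 0].
Proof.
move=> /andP[cx xd] Hx e e0.
pose G s := \sum_(i < n) nu i x * V i s.
have iV i (x1 y1 : R) : c < x1 -> y1 < d -> leb.-integrable (`]x1, y1]%classic : set T) (EFin \o (fun s => V i s)) /\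
   \int[leb]_(s in (`]x1, y1]%classic : set T)) flux_density R n a b h u i s = \int[leb]_(s in (`]x1, y1]%classic : set T)) V i s.
  move=> cx1 yd1; have mI : measurable (`]x1, y1]%classic : set T) by exact: measurable_itv.
  have ind (v : 'I_n -> R -> R) : m.-integrable (setT : set T) (EFin \o v i) -> leb.-integrable (`]x1, y1]%classic : set T) (EFin \o head R n m v i).
    move=> iv; have i1 : leb.-integrable (setT : set T) (EFin \o (\1_(`]x1, y1]%classic) : R -> R)).
      exact: (@integrable_indic_itv R x1 y1 false false).
    have := integrable_fubini_left _ leb m _ _ i1 iv => /(integrableS measurableT mI (@subsetT _ _)).
    by apply: eq_integrable => // s sI /=; rewrite indicE sI mul1r.
  have iK : leb.-integrable (`]x1, y1]%classic : set T) (EFin \o (cst (K i) : R -> R)).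
    have cK : continuous (cst (K i) : R -> R) by move=> s; exact: cst_continuous.
    apply: integrableS (itv_continuous_integrable R (cst (K i)) x1 y1 cK) => //.
    by apply: subset_itvr; rewrite bnd_simp.
  have iVV : leb.-integrable (`]x1, y1]%classic : set T) (EFin \o (fun s => V i s)).
    by apply: eq_integrable (integrableB mI (integrableD mI iK (ind _ (inu i))) (ind _ (inuh i))).
  split => //; congr fine; apply: ae_eq_integral => //.
  - by apply: measurable_funTS; exact: measurable_int (id i).
  - exact: measurable_int iVV.
  - apply: ae_imply (uhV i) => s Hs; rewrite /= in_itv/= => /andP[xs sy].
    have sU : `]c, d[%classic s by rewrite /= in_itv/= (lt_trans cx1 xs) (le_lt_trans sy yd1).
    by rewrite /flux_density patchE mem_set ?Hs//; exact: cdD.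
have iG (x1 y1 : R) : c < x1 -> y1 < d -> leb.-integrable (`]x1, y1]%classic : set T) (EFin \o G) /\
   \int[leb]_(s in (`]x1, y1]%classic : set T)) G s = \sum_(i < n) nu i x * \int[leb]_(s in (`]x1, y1]%classic : set T)) flux_density R n a b h u i s.
  move=> cx1 yd1; have mI : measurable (`]x1, y1]%classic : set T) by exact: measurable_itv.
  have iVi i : leb.-integrable (`]x1, y1]%classic : set T) (EFin \o (fun s => nu i x * V i s)).
    by have [H _] := iV i _ _ cx1 yd1; apply: eq_integrable (integrableZl mI (nu i x) H).
  split; first by apply: integrable_Rsum.
  rewrite Rintegral_sum//; apply: eq_bigr => i _.
  by have [H ->] := iV i _ _ cx1 yd1; rewrite RintegralZl.
have cG : G s @[s --> x^'-] --> G x.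
  apply: cvg_big => [|i _]; first exact: add_continuous.
  apply: cvgMl_tmp; apply: cvgB; last exact: head_left_continuous.
  by apply: cvgD; [exact: cvg_cst|exact: head_left_continuous].
(* If G(x) < 0, left continuity makes G negative on some ]y, x], so that nu(x).z decreases strictly
   from y to x, against its maximality at x. *)
have Gx0 : 0 <= G x.
  rewrite leNgt; apply/negP => Gx.
  have : \forall s \near x^'-, G s < 0 by apply: (cvgr_lt (G x)).
  move=> [r /= r0 Hr].
  pose y := Num.max (x - r / 2) ((c + x) / 2).
  have yx : y < x by rewrite gt_max; apply/andP; split; lra.
  have cy : c < y by rewrite lt_max; apply/orP; right; lra.
  have [iGy Ey] := iG y x cy xd.
  have mI : measurable (`]y, x]%classic : set T) by exact: measurable_itv.
  have iGN : leb.-integrable (`]y, x]%classic : set T) (EFin \o (fun s => - G s)) by apply: eq_integrable (integrableN iGy).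
  have := Rintegral_gt0_itv _ y x yx iGN.
  have -> : \int[leb]_(s in (`]y, x]%classic : set T)) (- G s) = - \int[leb]_(s in (`]y, x]%classic : set T)) G s.
    by rewrite -[RHS]mulN1r -RintegralZl//; apply: eq_Rintegral => s _; rewrite mulN1r.
  rewrite Ey oppr_gt0 ltNge => H.
  have /negP[] : ~~ (0 <= \sum_(i < n) nu i x * \int[leb]_(s in (`]y, x]%classic : set T)) flux_density R n a b h u i s).
    apply: H => s /andP[ys]; rewrite le_eqVlt => /predU1P[->|sx]; first by rewrite oppr_gt0.
    rewrite oppr_gt0; apply: Hr => //=; rewrite gtr0_norm ?subr_gt0//.
    by move: ys; rewrite gt_max => /andP[h1 _]; lra.
  have := Hx y; rewrite -(pmulr_rge0 _ l0); set A := (X in 0 <= X -> _) => A0; apply: le_trans A0 _.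
  rewrite /A mulr_sumr le_eqVlt; apply/orP; left; apply/eqP; apply: eq_bigr => i _.
  by rewrite (fluxB _ _ _ (ltW yx)); field; rewrite gt_eqF.
(* If G were positive at all points shortly to the right of x, then nu(x).z would increase strictly
   there, again contradicting maximality. *)
have [y [xy ye yd Gy]] : exists y, [/\ x < y, y < x + e, y < d & G y <= 0].
  apply: contrapT => ny.
  have [y [xy ye yd]] : exists y, [/\ x < y, y < x + e & y < d].
    exists (x + Num.min e (d - x) / 2); set w := Num.min _ _.
    have w0 : 0 < w by rewrite lt_min e0 subr_gt0.
    have we : w <= e by rewrite ge_min lexx.
    have wd : w <= d - x by rewrite ge_min lexx orbT.
    by clearbody w; split; lra.
  have [iGy Ey] := iG x y cx yd.
  have := Rintegral_gt0_itv _ x y xy iGy; rewrite Ey ltNge => H.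
  have /negP[] : ~~ (\sum_(i < n) nu i x * \int[leb]_(s in (`]x, y]%classic : set T)) flux_density R n a b h u i s <= 0).
    apply: H => s /andP[xs sy]; rewrite ltNge; apply/negP => Gs; apply: ny; exists s; split => //.
    - exact: le_lt_trans ye.
    - exact: le_lt_trans yd.
  have := Hx y; rewrite -(pmulr_rge0 _ l0) -oppr_le0; set A := (X in X <= 0 -> _) => A0; apply: le_trans A0.
  rewrite /A mulr_sumr -sumrN le_eqVlt; apply/orP; left; apply/eqP; apply: eq_bigr => i _.
  rewrite -[z x ord0 i - _]opprB (fluxB _ _ _ (ltW xy)); field; rewrite gt_eqF//.
exists y; split => //.
have : G y - G x <= 0 by rewrite subr_le0 (le_trans Gy).
rewrite /G -sumrB; apply: le_trans; rewrite le_eqVlt; apply/orP; left; apply/eqP; apply: eq_bigr => i _.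
rewrite -mulrBr; congr (_ * _).
have hB (v : 'I_n -> R -> R) : m.-integrable (setT : set T) (EFin \o v i) ->
    head R n m v i y - head R n m v i x = \int[m]_(t in (`[x, y[%classic : set T)) v i t.
  move=> iv.
  have e1 : (`]-oo, y[%classic : set T) = (`]-oo, x[%classic : set T) `|` (`[x, y[%classic : set T).
    by apply/seteqP; split => t /=; rewrite !in_itv/=;
      [by case: (ltP t x) => tx ty; [left|right]|case=> [tx|/andP[]//]; exact: lt_trans tx xy].
  rewrite /head e1 Rintegral_setU//; try exact: measurable_itv.
  - by rewrite addrAC subrr add0r.
  - by apply: (integrableS _ _ _ iv) => //; rewrite -e1; exact: measurable_itv.
  - by apply/disj_setPS => t []; rewrite /= !in_itv/= => tx /andP[xt]; move: (lt_le_trans tx xt); rewrite ltxx.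
rewrite RintegralB//; try exact: measurable_itv.
- rewrite -(hB nu (inu i)) -(hB nuh (inuh i)); ring.
- by apply: (integrableS _ _ _ (inu i)) => //; exact: measurable_itv.
- by apply: (integrableS _ _ _ (inuh i)) => //; exact: measurable_itv.
Qed.

End flux_difference.

(** * A common density for finitely many charges *)

Section dominating.
Context d (T : measurableType d) (R : realType) (N : nat) (rho : 'I_N -> {charge set T -> \bar R}).

Let hP i := projT1 (cid (Hahn_decomposition (rho i))).
Let hN i := projT1 (cid (projT2 (cid (Hahn_decomposition (rho i))))).
Let hPN i : hahn_decomposition (rho i) (hP i) (hN i) :=
  projT2 (cid (projT2 (cid (Hahn_decomposition (rho i))))).

Definition variation i : {measure set T -> \bar R} := charge_variation (hPN i).

(** [msum] is indexed by naturals; [insub] sends an index below N back to its ordinal, and [mzero]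
    only fills the indices outside the range of summation. *)
Definition variation_sum : set T -> \bar R :=
  msum (fun k => if insub k is Some i then variation i else mzero) N.

HB.instance Definition _ := Measure.on variation_sum.

Lemma variation_sumE A : variation_sum A = (\sum_(i < N) variation i A)%E.
Proof. by apply: eq_bigr => i _; rewrite valK. Qed.

Let vsum_fin : fin_num_fun variation_sum.
Proof.
move=> A mA; rewrite variation_sumE sum_fin_num; apply/allP => _ /mapP[i _ ->].
have : charge_variation (hPN i) A \is a fin_num by rewrite fin_numD !fin_num_measure.
by [].
Qed.

HB.instance Definition _ := @Measure_isFinite.Build d T R variation_sum vsum_fin.

Lemma common_density : exists (m : {finite_measure set T -> \bar R}) (nu : 'I_N -> T -> R),
  (forall i, m.-integrable setT (EFin \o nu i)) /\
  (forall i A, measurable A -> rho i A = (\int[m]_(x in A) (nu i x)%:E)%E).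
Proof.
pose m : {finite_measure set T -> \bar R} := variation_sum.
have dom i : rho i `<< m.
  apply/null_content_dominatesP => A mA mA0.
  apply/eqP; rewrite -abse_eq0 eq_le abse_ge0 andbT.
  have v0 : (variation i A = 0)%E.
    apply/eqP; rewrite eq_le measure_ge0 andbT -[X in (_ <= X)%E]mA0 /m /= variation_sumE (bigD1 i)//=.
    by rewrite leeDl// sume_ge0.
  by apply: le_trans (abse_charge_variation (hPN i) mA) _; rewrite -v0.
have E i : EFin \o (fun x => fine (Radon_Nikodym (rho i) m x)) = Radon_Nikodym (rho i) m.
  by apply/funext => x /=; rewrite fineK// Radon_Nikodym_fin_num.
exists m, (fun i x => fine (Radon_Nikodym (rho i) m x)); split => [i|i A mA].
  by rewrite E; exact: Radon_Nikodym_integrable.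
rewrite (Radon_Nikodym_integral (dom i) mA); apply: eq_integral => x _.
by rewrite fineK// Radon_Nikodym_fin_num.
Qed.

End dominating.

(** * Total variation in terms of a density *)

Section total_variation.
Context (R : realType) (n : nat).
Notation T := (measurableTypeR R).
Variable (m : {finite_measure set T -> \bar R}).
Implicit Types (nu : 'I_n -> R -> R) (B E N : set T).

Definition rowf nu (x : R) : 'rV[R]_n := \row_i nu i x.

Section one_density.
Variable nu : 'I_n -> R -> R.
Hypothesis inu : forall i, m.-integrable (setT : set T) (EFin \o nu i).

Lemma rowf_integrable B : measurable B -> m.-integrable B (EFin \o (fun x => enorm (rowf nu x))).
Proof.
move=> mB; apply: enorm_integrable => // i.
apply: (@eq_integrable _ _ _ m B mB (EFin \o nu i)) => [x _|]; first by rewrite /= mxE.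
exact: integrableS (inu i).
Qed.

(** With v the integral of nu over B, |v|^2 is the integral of v.nu, at most |v| times the integral
    of |nu|. *)
Lemma enorm_Rintegral_le B : measurable B ->
  enorm (\row_i \int[m]_(x in B) nu i x) <= \int[m]_(x in B) enorm (rowf nu x).
Proof.
move=> mB; set v := \row_i _.
have inuB i : m.-integrable B (EFin \o nu i) by exact: integrableS (inu i).
have iB := rowf_integrable B mB.
have [->|v0] := eqVneq v 0; first by rewrite enorm0; apply: Rintegral_ge0 => x _; exact: enorm_ge0.
have v1 := enorm_gt0 _ _ _ v0.
rewrite -(ler_pM2l v1) -expr2 enorm_sq.
have -> : dot R n v v = \int[m]_(x in B) dot R n v (rowf nu x).
  rewrite Rintegral_sum//; last first.
    move=> i; apply: (@eq_integrable _ _ _ m B mB (EFin \o (fun x => v ord0 i * nu i x))) => [x _|]; first by rewrite /= [rowf _ _ _ _]mxE.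
    by apply: eq_integrable (integrableZl mB (v ord0 i) (inuB i)).
  apply: eq_bigr => i _; rewrite {2}/v mxE -RintegralZl//.
  by apply: eq_Rintegral => x _; rewrite [rowf _ _ _ _]mxE.
rewrite -RintegralZl//; apply: le_Rintegral => //.
- apply: integrable_Rsum => // i.
  apply: (@eq_integrable _ _ _ m B mB (EFin \o (fun x => v ord0 i * nu i x))) => [x _|]; first by rewrite /= [rowf _ _ _ _]mxE.
  by apply: eq_integrable (integrableZl mB (v ord0 i) (inuB i)).
- by apply: eq_integrable (integrableZl mB (enorm v) iB).
- by move=> x _; exact: dot_enorm.
Qed.

End one_density.

(** The converse of [enorm_Rintegral_le] on a set where nu is nearly constant: the integral of |nu|
    is at most (|e| + dl) m(B), and the norm of the integral is at least (|e| - dl) m(B). *)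
Lemma Rintegral_enorm_le nu B (e : 'rV[R]_n) (dl : R) : (forall i, m.-integrable (setT : set T) (EFin \o nu i)) -> measurable B -> 0 <= dl ->
  (forall x, B x -> enorm (rowf nu x - e) <= dl) ->
  \int[m]_(x in B) enorm (rowf nu x) <= enorm (\row_i \int[m]_(x in B) nu i x) + 2 * dl * fine (m B).
Proof.
move=> inu mB dl0 He.
have mBf : m B \is a fin_num by exact: fin_num_measure.
have icst (k : R) : m.-integrable B (EFin \o (cst k)) by exact: finite_measure_integrable_cst.
have Icst (k : R) : \int[m]_(x in B) (cst k x) = k * fine (m B).
  by rewrite /Rintegral (eq_integral (cst k%:E))// integral_cst// fineM.
have iB := rowf_integrable nu inu B mB.
have inuB i : m.-integrable B (EFin \o nu i) by exact: integrableS (inu i).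
have ie i : m.-integrable B (EFin \o (fun x => nu i x - e ord0 i)).
  by apply: eq_integrable (integrableB mB (inuB i) (icst (e ord0 i))).
have up : \int[m]_(x in B) enorm (rowf nu x) <= (enorm e + dl) * fine (m B).
  rewrite -Icst; apply: le_Rintegral => // x Bx.
  by rewrite -[rowf nu x](subrK e) addrC (le_trans (enorm_triangle _ _ _ _))// lerD2l He.
have low : enorm e * fine (m B) <= enorm (\row_i \int[m]_(x in B) nu i x) + dl * fine (m B).
  have m0 : 0 <= fine (m B) by rewrite fine_ge0.
  rewrite -[fine (m B) in leLHS]ger0_norm// mulrC -enormZ.
  have -> : fine (m B) *: e = (\row_i \int[m]_(x in B) nu i x) - (\row_i \int[m]_(x in B) (nu i x - e ord0 i)).
    apply/rowP => i; rewrite !mxE (RintegralB mB (inuB i) (icst (e ord0 i))) Icst; ring.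
  apply: le_trans (enorm_triangle _ _ _ _) _; rewrite lerD2l -scaleN1r enormZ normrN1 mul1r -Icst.
  have iw : m.-integrable B (EFin \o (fun x => enorm (rowf nu x - e))).
    apply: enorm_integrable => // i.
    by apply: (@eq_integrable _ _ _ m B mB _ _ _ (ie i)) => x _; rewrite /= !mxE.
  apply: (@le_trans _ _ (\int[m]_(x in B) enorm (rowf nu x - e))); last exact: le_Rintegral.
  have ieT i : m.-integrable (setT : set T) (EFin \o (fun x => nu i x - e ord0 i)).
    have ic : m.-integrable (setT : set T) (EFin \o (cst (e ord0 i))) by exact: finite_measure_integrable_cst.
    by apply: eq_integrable (integrableB measurableT (inu i) ic).
  have := enorm_Rintegral_le (fun i x => nu i x - e ord0 i) ieT B mB.
  move/le_trans; apply; rewrite le_eqVlt; apply/orP; left; apply/eqP; apply: eq_Rintegral => x _.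
  by congr enorm; apply/rowP => i; rewrite !mxE.
lra.
Qed.

(** On a null set the absolutely continuous part vanishes, so the singular part is the restriction
    of Du to it. The freedom to enlarge the null set lets a single one serve u and h. *)
Lemma singular_part_restrict (Du us : vmeasure R n) : singular_part Du us ->
  exists N, [/\ measurable N, leb N = 0%E & forall N', measurable N' -> leb N' = 0%E -> N `<=` N' ->
    forall i A, measurable A -> us i A = Du i (A `&` N')].
Proof.
move=> [[g Lg Hg] [N [mN N0 HN]]]; exists N; split => // N' mN' N'0 NN' i A mA.
have mAN : measurable (A `&` N') by exact: measurableI.
rewrite Hg// (null_set_integral (mu := leb))//; last 2 first.
- by apply: measurable_funTS; exact: measurable_int (Lg i).
- exact: (subset_measure0 mAN mN' (@subIsetr _ _ _) N'0).
rewrite add0e -{1}(setUIDK A N') chargeU//; last 2 first.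
- exact: measurableD.
- by rewrite setDE setIACA setICr setI0.
rewrite [X in (_ + X)%E]HN ?adde0//; first exact: measurableD.
by apply/seteqP; split => x //= [[_ nN'] Nx]; apply: nN'; exact: NN'.
Qed.

(** Both sides are compared with the integral of |nuH| over the part of E in N. It bounds every
    partition sum for [us] piece by piece; conversely, a partition of E into sets where nuH is
    nearly constant recovers it from [hs] up to eps. *)
Lemma total_variation_le (Du us Dh hs : vmeasure R n) (nuU nuH : 'I_n -> R -> R) N E :
  (forall i, m.-integrable (setT : set T) (EFin \o nuU i)) ->
  (forall i, m.-integrable (setT : set T) (EFin \o nuH i)) ->
  measurable N -> measurable E ->
  (forall i A, measurable A -> us i A = (\int[m]_(x in A `&` N) (nuU i x)%:E)%E) ->
  (forall i A, measurable A -> hs i A = (\int[m]_(x in A `&` N) (nuH i x)%:E)%E) ->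
  {ae m, forall x : T, (N `&` E) x -> enorm (rowf nuU x) <= enorm (rowf nuH x)} ->
  (total_variation_measure us E <= total_variation_measure hs E)%E.
Proof.
move=> iU iH mN mE usE hsE UH.
have mnorm nu : (forall i, m.-integrable (setT : set T) (EFin \o nu i)) -> measurable_fun (setT : set T) (fun x => (enorm (rowf nu x))%:E).
  by move=> inu; exact: measurable_int (rowf_integrable nu inu setT measurableT).
apply: (@le_trans _ _ (\int[m]_(x in E `&` N) (enorm (rowf nuH x))%:E)%E).
  apply: ge_ereal_sup => _ [B [mB tB BE] <-].
  have EB : E `&` N = \bigcup_k (B k `&` N) by rewrite -setI_bigcupl BE.
  rewrite EB ge0_integral_bigcup; last 4 first.
  - by move=> k; exact: measurableI.
  - by apply: measurable_funTS; exact: mnorm.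
  - by move=> x _; rewrite lee_fin enorm_ge0.
  - exact: trivIset_setIr.
  apply: lee_nneseries => [k _ _|k _]; first by rewrite lee_fin enorm_ge0.
  have mBN : measurable (B k `&` N) by exact: measurableI.
  apply: (@le_trans _ _ (\int[m]_(x in B k `&` N) (enorm (rowf nuU x))%:E)%E).
    rewrite -[leRHS]fineK; last by apply: integrable_fin_num => //; exact: rowf_integrable.
    rewrite lee_fin; apply: le_trans (enorm_Rintegral_le nuU iU _ mBN).
    rewrite le_eqVlt; apply/orP; left; apply/eqP; congr enorm; apply/rowP => i; rewrite !mxE.
    by rewrite usE.
  apply: ae_ge0_le_integral => //.
  - by move=> x _; rewrite lee_fin enorm_ge0.
  - by apply: measurable_funTS; exact: mnorm.
  - by move=> x _; rewrite lee_fin enorm_ge0.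
  - by apply: measurable_funTS; exact: mnorm.
  - apply: ae_imply UH => x Hx [Bx Nx]; rewrite lee_fin; apply: Hx; split => //.
    by rewrite -BE; exists k.
apply/lee_addgt0Pr => eps eps0.
pose M := fine (m (setT : set T)).
have M0 : 0 <= M by rewrite fine_ge0.
(* A coordinate error dl is a Euclidean error at most n dl, and [Rintegral_enorm_le] doubles it: the
   total error is at most 2 n dl M <= eps. The additive constants keep the denominator positive. *)
pose dl := eps / (2 * n%:R * (M + 1) + 1).
have dl0 : 0 < dl by rewrite divr_gt0// ltr_wpDl// !mulr_ge0// addr_ge0.
(* An enumeration of the rational vectors; indices that encode no vector give 0. *)
pose e (k : nat) : 'rV[R]_n := if unpickle k is Some f then \row_i ratr ((f : {ffun 'I_n -> rat}) i) else 0.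
pose C k := E `&` \bigcap_i [set x : T | `|nuH i x - e k ord0 i| <= dl].
have mC k : measurable (C k).
  apply: measurableI => //; apply: fin_bigcap_measurable => // i _.
  rewrite (_ : [set x | _] = (setT `&` [set x : T | `|nuH i x - e k ord0 i| <= dl])); last by rewrite setTI.
  apply: measurable_fun_ler => //; apply: measurableT_comp => //; apply: measurable_funB => //.
  by apply/measurable_EFinP; exact: measurable_int (iH i).
have CE : \bigcup_k C k = E.
  apply/seteqP; split => [x [k _ []]//|x Ex].
  have ex i : exists r : rat, `|nuH i x - ratr r| <= dl.
    have lt2 : nuH i x - dl < nuH i x + dl by rewrite ltrD2l gt0_cp.
    have [r rin] := rat_in_itvoo lt2; exists r; rewrite ler_norml.
    move: rin; rewrite in_itv/=; set q := ratr r => /andP[h1 h2]; apply/andP; split; lra.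
  pose f : {ffun 'I_n -> rat} := [ffun i => projT1 (cid (ex i))].
  exists (pickle f) => //; split => // i _; rewrite /= /e pickleK mxE ffunE; by case: cid.
pose B := seqDU C.
have mB k : measurable (B k) by exact: seqDU_measurable.
have tB : trivIset setT B by exact: trivIset_seqDU.
have BE : \bigcup_k B k = E by rewrite -seqDU_bigcup_eq.
have EB : E `&` N = \bigcup_k (B k `&` N) by rewrite -setI_bigcupl BE.
rewrite EB ge0_integral_bigcup; last 4 first.
- by move=> k; exact: measurableI.
- by apply: measurable_funTS; exact: mnorm.
- by move=> x _; rewrite lee_fin enorm_ge0.
- exact: trivIset_setIr.
apply: (@le_trans _ _ (\sum_(0 <= k <oo) ((enorm (\row_i fine (hs i (B k))))%:E + (2 * (n%:R * dl))%:E * m (B k `&` N)))%E).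
  apply: lee_nneseries => [k _ _|k _]; first by apply: integral_ge0 => x _; rewrite lee_fin enorm_ge0.
  have mBN : measurable (B k `&` N) by exact: measurableI.
  rewrite -[leLHS]fineK; last by apply: integrable_fin_num => //; exact: rowf_integrable.
  rewrite -[X in (_ * X)%E]fineK ?fin_num_measure// -EFinM -EFinD lee_fin.
  have Hk : forall x, (B k `&` N) x -> enorm (rowf nuH x - e k) <= n%:R * dl.
    move=> x [[[_ Cx] _] _]; apply: le_trans (enorm_le_sum _ _ _) _.
    rewrite -[n in n%:R](card_ord n) mulr_natl -sumr_const; apply: ler_sum => i _.
    by rewrite !mxE; exact: Cx.
  have ndl : 0 <= n%:R * dl by rewrite mulr_ge0// ltW.
  have := Rintegral_enorm_le nuH _ (e k) _ iH mBN ndl Hk.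
  move/le_trans; apply; rewrite lerD2r le_eqVlt; apply/orP; left; apply/eqP; congr enorm; apply/rowP => i; rewrite !mxE.
  by rewrite hsE.
have c0 : 0 <= 2 * (n%:R * dl) by apply: mulr_ge0 => //; apply: mulr_ge0 => //; exact: ltW.
rewrite nneseriesD; last 2 first.
- by move=> k _ _; rewrite lee_fin enorm_ge0.
- by move=> k _ _; apply: mule_ge0; [rewrite lee_fin; exact: c0|exact: measure_ge0].
apply: leeD; first by apply: ereal_sup_ubound; exists B.
rewrite nneseriesZl//.
rewrite -measure_semi_bigcup//; last first.
- by apply: bigcup_measurable => k _; exact: measurableI.
- exact: trivIset_setIr.
- by move=> k; exact: measurableI.
rewrite -EB; apply: (@le_trans _ _ ((2 * (n%:R * dl))%:E * M%:E)%E).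
  apply: lee_wpmul2l; first by rewrite lee_fin; exact: c0.
  rewrite /M fineK ?fin_num_measure//; apply: le_measure; rewrite ?inE//; exact: measurableI.
rewrite -EFinM lee_fin /dl.
rewrite (_ : _ * M = eps * ((2 * n%:R * M) / (2 * n%:R * (M + 1) + 1))); last by ring.
rewrite -[leRHS]mulr1 ler_pM2l// ler_pdivrMr ?mul1r; last by rewrite ltr_wpDl// !mulr_ge0// addr_ge0.
have : 0 <= n%:R :> R by []. nra.
Qed.

End total_variation.

Section singular_comparison.
Context (R : realType) (n : nat) (a b : R).
Notation T := (measurableTypeR R).
Notation D := (`]a, b[%classic).
Hypothesis ab : a < b.
Variables (lambda : R) (h u : R -> 'rV[R]_n) (f : R -> R) (phi : 'rV[R]_n -> R).
Hypothesis l0 : 0 < lambda.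
Hypothesis Lh : L2 D h.
Hypothesis f_ge0 : forall t, 0 <= t -> 0 <= f t.
Hypothesis f_convex : convex_function (`[0, +oo[%classic : set R) f.
Hypothesis f_nd : forall s t, 0 <= s -> s <= t -> f s <= f t.
Hypothesis f_growth : linear_growth f.
Hypothesis aphi : anisotropy phi.
Hypothesis mu : is_minimizer D (f \o phi) lambda h u.
Notation F := (f \o phi).
Notation z := (flux R n a b lambda h u).

Let F0 : forall p, 0 <= F p. Proof. exact: F_ge0. Qed.
Let cF : continuous F. Proof. exact: F_continuous. Qed.
Let F_cvx : forall p (t : R), 0 <= t <= 1 -> F ((1 - t) *: p) <= (1 - t) * F p + t * F 0.
Proof. exact: F_scale. Qed.

(** C does not depend on y: [F_lower] is applied to theta L phi(p), which dominates theta z(y).p for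
    every y at once. *)
Lemma flux_subgradient (th : R) : 0 <= th -> th < 1 -> exists2 C : R, 0 <= C &
  forall y p, dot R n (th *: z y) p <= F p + C.
Proof.
move=> th0 th1; have [C C0 HC] := F_lower R n f phi f_ge0 f_convex f_growth aphi th th0 th1.
exists C => // y p; apply: le_trans (HC p); rewrite dotZl dotC ler_wpM2l//.
apply: (flux_bound R n a b ab F lambda h u F0 cF l0 Lh mu).
  by rewrite mulr_ge0 ?(anisotropy_ge0 _ _ _ aphi)// (recession_ge0 _ _ f_convex).
move=> q s s0; have := F_add R n f phi f_convex f_nd f_growth aphi q (s *: p).
by rewrite (anisotropyZ _ _ _ aphi)// mulrCA.
Qed.

Variables (c d : R).
Hypothesis cd : c < d.
Hypothesis cdD : `]c, d[ `<=` D.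
Variables (m : {finite_measure set T -> \bar R}) (nuU nuH : 'I_n -> R -> R) (Du Dh : vmeasure R n).
Hypothesis inuU : forall i, m.-integrable (setT : set T) (EFin \o nuU i).
Hypothesis DnuU : forall i (A : set T), measurable A -> Du i A = (\int[m]_(x in A) (nuU i x)%:E)%E.
Hypothesis inuH : forall i, m.-integrable (setT : set T) (EFin \o nuH i).
Hypothesis DnuH : forall i (A : set T), measurable A -> Dh i A = (\int[m]_(x in A) (nuH i x)%:E)%E.
Hypothesis distrU : distr_derivative D u Du.
Hypothesis distrH : distr_derivative `]c, d[ h Dh.

Lemma density_le (N : set T) : measurable N -> leb N = 0%E ->
  {ae m, forall x : T, (N `&` (`]c, d[%classic : set T)) x -> enorm (rowf R n nuU x) <= enorm (rowf R n nuH x)}.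
Proof.
move=> mN N0.
have [Lu _] := mu.
have mU : measurable (`]c, d[%classic : set T) by exact: measurable_itv.
have mD : measurable (D : set T) by exact: measurable_itv.
have LhU : L1 `]c, d[ h by move=> i; apply: integrableS (L2_L1 _ _ _ _ ab _ Lh i).
have Ku i := cid (head_representation R n a b ab m nuU u Du (L2_L1 _ _ _ _ ab _ Lu) inuU DnuU distrU i).
have Kh i := cid (head_representation R n c d cd m nuH h Dh LhU inuH DnuH distrH i).
pose K i := projT1 (Ku i) - projT1 (Kh i).
have HV i : {ae leb, forall x : T, (`]c, d[%classic : set T) x ->
    u x ord0 i - h x ord0 i = K i + head R n m nuU i x - head R n m nuH i x}.
  apply: ae_imply (ae_and _ _ _ _ _ _ (projT2 (Ku i)) (projT2 (Kh i))) => x [H1 H2] Ux.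
  by rewrite (H1 (cdD _ Ux)) (H2 Ux) /K; ring.
have good := good_points_ae R n a b ab F lambda h u F0 cF F_cvx l0 Lh mu m nuU Du inuU DnuU distrU flux_subgradient N mN N0.
have iw i : m.-integrable (setT : set T) (EFin \o (fun x => nuU i x - nuH i x)).
  by apply: eq_integrable (integrableB measurableT (inuU i) (inuH i)).
have id i := flux_density_integrable R n a b ab F lambda h u Lh mu i.
have := ae_dot_le0 R n m nuU (fun i x => nuU i x - nuH i x) inuU iw (N `&` `]c, d[%classic) (measurableI _ _ mN mU).
have H : {ae m, forall x : T, (N `&` (`]c, d[%classic : set T)) x -> forall e, 0 < e -> exists y : R, [/\ (x : R) < y, y < (x : R) + e &
     \sum_(i < n) nuU i x * \int[m]_(t in (`[(x : R), y[%classic : set T)) (nuU i t - nuH i t) <= 0]}.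
  apply: ae_imply good => x Hx [Nx Ux].
  exact: (good_point_right R n a b lambda h u l0 id m nuU nuH c d K inuU inuH cdD HV x Ux (Hx (conj Nx (cdD _ Ux)))).
move=> /(_ H); apply: ae_imply => x Hx NUx.
have : dot R n (rowf R n nuU x) (rowf R n nuU x - rowf R n nuH x) <= 0.
  by apply: le_trans (Hx NUx); rewrite le_eqVlt; apply/orP; left; apply/eqP; apply: eq_bigr => i _; rewrite !mxE.
rewrite dotBr subr_le0 -enorm_sq => H1.
have := le_trans H1 (dot_enorm _ _ _ _).
have := enorm_ge0 _ _ (rowf R n nuU x); rewrite le_eqVlt => /predU1P[<- _|p0]; first exact: enorm_ge0.
by rewrite expr2 ler_pM2l.
Qed.

End singular_comparison.

Lemma singular_total_variation_le (R : realType) (n : nat) (a b : R) (lambda : R)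
    (h u : R -> 'rV[R]_n) (f : R -> R) (phi : 'rV[R]_n -> R) (c d : R) :
  a < b -> 0 < lambda -> L2 `]a, b[ h -> (forall t, 0 <= t -> 0 <= f t) ->
  convex_function (`[0, +oo[%classic : set R) f ->
  (forall s t, 0 <= s -> s <= t -> f s <= f t) -> linear_growth f -> anisotropy phi ->
  is_minimizer `]a, b[ (f \o phi) lambda h u ->
  c < d -> `]c, d[ `<=` `]a, b[ ->
  forall Du us Dh hs : vmeasure R n,
    distr_derivative `]a, b[ u Du -> singular_part Du us ->
    distr_derivative `]c, d[ h Dh -> singular_part Dh hs ->
    forall E : set (measurableTypeR R), measurable E -> E `<=` `]c, d[ ->
      (total_variation_measure us E <= total_variation_measure hs E)%E.
Proof.
move=> ab l0 Lh f_ge0 f_cvx f_nd f_gr aphi mu cd cdD Du us Dh hs dU sU dH sH E mE EU.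
(* The 2n components of Du and Dh form one family, so that both measures get densities with respect
   to the same m. *)
pose rho (k : 'I_(n + n)) := match fintype.split k with inl i => Du i | inr i => Dh i end.
have [m [nu [inu Hnu]]] := common_density _ _ _ _ rho.
have rl i : rho (lshift n i) = Du i by rewrite /rho; have /= -> := unsplitK (inl i : 'I_n + 'I_n).
have rr i : rho (rshift n i) = Dh i by rewrite /rho; have /= -> := unsplitK (inr i : 'I_n + 'I_n).
pose nuU i := nu (lshift n i). pose nuH i := nu (rshift n i).
have HU i A : measurable A -> Du i A = (\int[m]_(x in A) (nuU i x)%:E)%E by rewrite -rl; exact: Hnu.
have HH i A : measurable A -> Dh i A = (\int[m]_(x in A) (nuH i x)%:E)%E by rewrite -rr; exact: Hnu.
have [N1 [mN1 N10 H1]] := singular_part_restrict _ _ _ _ sU.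
have [N2 [mN2 N20 H2]] := singular_part_restrict _ _ _ _ sH.
pose N := N1 `|` N2.
have mN : measurable N by exact: measurableU.
have N0 : leb N = 0%E by rewrite measureU0.
apply: (total_variation_le _ _ m Du us Dh hs nuU nuH N) => //.
- by move=> i; exact: inu.
- by move=> i; exact: inu.
- move=> i A mA; rewrite (H1 N mN N0 (@subsetUl _ _ _))// HU//; exact: measurableI.
- move=> i A mA; rewrite (H2 N mN N0 (@subsetUr _ _ _))// HH//; exact: measurableI.
have := density_le R n a b ab lambda h u f phi l0 Lh f_ge0 f_cvx f_nd f_gr aphi mu c d cd cdD m nuU nuH Du Dh
  (fun i => inu _) HU (fun i => inu _) HH dU dH N mN N0.
by apply: ae_imply => x Hx [Nx Ex]; apply: Hx; split => //; exact: EU.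
Qed.

(** * Bounded variation of the minimizer *)

Section gaps.
Context (R : realType).

(** The open intervals from l(x) to r(x) are disjoint and each contains a rational number. *)
Lemma countable_gaps (J : set R) (l r : R -> R) : (forall x, J x -> l x < r x) ->
  (forall x y, J x -> J y -> x < y -> r x <= l y) -> countable J.
Proof.
move=> lr rl; apply/pcard_injP.
have ex x : exists q : rat, J x -> l x < ratr q < r x.
  have [/lr lrx|nJ] := pselect (J x); last by exists 0.
  by have [q] := rat_in_itvoo lrx; rewrite in_itv/= => qin; exists q.
pose g x := projT1 (cid (ex x)).
have gP x : J x -> l x < ratr (g x) < r x by rewrite /g; case: cid.
exists (fun x => pickle (g x)) => x y; rewrite !inE => Jx Jy /(pcan_inj pickleK) gxy.
have lt_neq x1 y1 : J x1 -> J y1 -> x1 < y1 -> g x1 = g y1 -> False.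
  move=> Jx1 Jy1 xy e; have /andP[_ h1] := gP _ Jx1; have /andP[h2 _] := gP _ Jy1.
  by have := lt_trans h1 (le_lt_trans (rl _ _ Jx1 Jy1 xy) h2); rewrite e ltxx.
have [xy|yx|//] := ltgtP x y; exfalso; first exact: (lt_neq x y).
exact: (lt_neq y x).
Qed.

End gaps.

(** * The measure of a function monotone off a null set *)

Section monotone_measure.
Context (R : realType) (a b M : R) (S : set R) (G : R -> R).
Notation T := (measurableTypeR R).
Notation D := (`]a, b[%classic).
Hypothesis ab : a < b.
Hypothesis M0 : 0 <= M.
Hypothesis nullS : {ae leb, forall x : T, (D : set T) x -> S x}.
Hypothesis ndG : forall x y, S x -> S y -> x <= y -> G x <= G y.
Hypothesis GM : forall x, S x -> `|G x| <= M.

Let above x := [set G s | s in [set s | S s /\ x < s]] `|` [set M].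

(* The constant M keeps the set nonempty to the right of S. *)
Definition upper_envelope (x : R) : R := inf (above x).

Let above_lb x : has_inf (above x).
Proof.
split; first by exists M; right.
exists (- M) => _ [[s [Ss _] <-]|->].
  by have := GM _ Ss; rewrite ler_norml => /andP[].
by rewrite ge0_cp.
Qed.

Let ue_le x s : S s -> x < s -> upper_envelope x <= G s.
Proof.
move=> Ss xs; apply: ge_inf; first by case: (above_lb x).
by left; exists s.
Qed.

Let ue_ge x s : S s -> s <= x -> G s <= upper_envelope x.
Proof.
move=> Ss sx; apply: lb_le_inf; first by case: (above_lb x).
move=> _ [[t [St xt] <-]|->]; first by apply: ndG => //; exact: le_trans (ltW xt).
by apply: le_trans (ler_norm _) (GM _ Ss).
Qed.

Let ue_nd : {homo upper_envelope : x y / x <= y}.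
Proof.
move=> x y xy; apply: lb_le_inf; first by case: (above_lb y).
move=> _ [[t [St yt] <-]|->]; first by apply: ue_le => //; exact: le_lt_trans yt.
by apply: ge_inf; [case: (above_lb x)|right].
Qed.

Let ue_rc : right_continuous upper_envelope.
Proof.
move=> x; apply/cvgrPdist_le => e e0.
have [y xy Hy] : exists2 y, x < y & upper_envelope y <= upper_envelope x + e.
  have [_ [[s [Ss xs] <-]|->] Hs] := inf_adherent e0 (above_lb x).
    exists ((x + s) / 2); first lra.
    by apply: le_trans (ltW Hs); apply: ue_le => //; lra.
  exists (x + 1); first lra.
  apply: le_trans (ltW Hs); apply: ge_inf; [by case: (above_lb (x + 1))|by right].
near=> z; rewrite ler0_norm ?subr_le0; last by apply: ue_nd; apply: ltW; near: z; exact: nbhs_right_gt.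
rewrite opprB lerBlDl; apply: le_trans Hy; apply: ue_nd; apply: ltW; near: z; exact: nbhs_right_lt.
Unshelve. all: by end_near. Qed.

HB.instance Definition _ := isCumulative.Build R _ R upper_envelope ue_nd ue_rc.

Let ls : {measure set T -> \bar R} := lebesgue_stieltjes_measure upper_envelope.

Let ls_itv x y : x <= y -> ls (`]x, y]%classic : set T) = (upper_envelope y - upper_envelope x)%:E.
Proof.
move=> xy; rewrite /ls/= /lebesgue_stieltjes_measure /measure_extension measurable_mu_extE/=; last exact: is_ocitv.
by rewrite wlength_itv_bnd.
Qed.

Let mD : measurable (D : set T). Proof. exact: measurable_itv. Qed.

Let lsD : (ls (D : set T) < +oo)%E.
Proof.
apply: (@le_lt_trans _ _ (ls (`]a, b]%classic : set T))); last by rewrite ls_itv ?ltry// ltW.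
by apply: le_measure; rewrite ?inE//; apply: subset_itvl; rewrite bnd_simp.
Qed.

(** G is monotone only on S, but its right-continuous envelope defines a Lebesgue-Stieltjes measure.
    Inside the interval, K + nu(]-oo, x[) is the left limit of the envelope; G and this left limit
    agree with the envelope off countably many points, hence almost everywhere. *)
Lemma monotone_measure : exists (nu : {finite_measure set T -> \bar R}) (K : R),
  (forall A : set T, A `&` (D : set T) = set0 -> nu A = 0%E) /\
  {ae leb, forall x : T, (D : set T) x -> G x = K + fine (nu (`]-oo, x[%classic : set T))}.
Proof.
pose nu : {finite_measure set T -> \bar R} := mfrestr mD lsD.
have nuE (A : set T) : nu A = ls (A `&` (D : set T)) by [].
exists nu, (upper_envelope a); split => [A AD|]; first by rewrite nuE AD measure0.
pose F x := upper_envelope a + fine (nu (`]-oo, x[%classic : set T)).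
have mI (i : interval R) : measurable ([set` i] : set T) by exact: measurable_itv.
have Fle x y : a < x -> x < y -> y < b -> upper_envelope x <= F y.
  move=> ax xy yb; rewrite /F -lerBlDl -lee_fin fineK ?fin_num_measure// -ls_itv ?(ltW ax)//.
  rewrite nuE; apply: le_measure; rewrite ?inE//; first exact: measurableI.
  move=> t /=; rewrite !in_itv/= => /andP[-> tx]; rewrite (le_lt_trans tx xy); split => //=.
  by rewrite (le_lt_trans tx)// (lt_trans xy).
have leF x : a < x -> F x <= upper_envelope x.
  move=> ax; rewrite /F -lerBrDl -lee_fin fineK ?fin_num_measure// -ls_itv ?(ltW ax)//.
  rewrite nuE; apply: le_measure; rewrite ?inE//; first exact: measurableI.
  by move=> t /=; rewrite !in_itv/= => -[tx /andP[-> _]]; rewrite ltW.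
(* In [J1] the gap is between G and the envelope, in [J2] between the left limit of the envelope and
   its value. Gaps at distinct points are disjoint, so both sets are countable. *)
pose J1 := [set x | S x /\ G x < upper_envelope x].
pose J2 := [set x | (D x) /\ F x < upper_envelope x].
have c1 : countable J1.
  by apply: (countable_gaps R J1 G upper_envelope) => [x []//|x y [Sx _] [Sy _] xy]; exact: ue_le.
have c2 : countable J2.
  apply: (countable_gaps R J2 F upper_envelope) => [x []//|x y []].
  by move=> Dx _ [Dy _] xy; move: Dx Dy; rewrite /= !in_itv/= => /andP[ax _] /andP[_ yb]; exact: Fle.
have mJ J : countable J -> {ae leb, forall x : T, ~ J x}.
  move=> cJ; exists J; split; last by move=> x /= /contrapT.
    exact: countable_measurable.
  exact: countable_lebesgue_measure0.
apply: ae_imply (ae_and _ _ _ _ _ _ nullS (ae_and _ _ _ _ _ _ (mJ _ c1) (mJ _ c2))) => x [DS [n1 n2]] Dx.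
have Sx := DS Dx.
have ax : a < x by move: Dx; rewrite /= in_itv/= => /andP[].
have e1 : G x = upper_envelope x.
  by apply/eqP; rewrite eq_le ue_ge// leNgt; apply/negP => h; apply: n1.
rewrite e1 -/(F x); apply/eqP; rewrite eq_le leF// andbT leNgt; apply/negP => h; apply: n2.
by split.
Qed.

End monotone_measure.

Section monotone_difference.
Context (R : realType) (a b : R).
Notation T := (measurableTypeR R).
Notation D := (`]a, b[%classic).
Hypothesis ab : a < b.

Lemma test_derive0 (psi : R -> R) (x : R) : test_function D psi -> ~ D x -> derive1 psi x = 0.
Proof.
move=> [_ _ sub] nDx; rewrite derive1E (@near_eq_derive _ _ _ psi (cst 0)) ?derive_cst//.
have : ~ closure [set x | psi x != 0] x by move=> /sub.
have oC : open (~` closure [set x | psi x != 0]) by apply: closed_openC; exact: closed_closure.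
move=> nc; have : nbhs x (~` closure [set x | psi x != 0]) by exact: open_nbhs_nbhs.
apply: filterS => y ny; apply/eqP/negPn/negP => py; apply: ny; exact: subset_closure.
Qed.

Lemma distr_of_representation (w : R -> R) (nu : {charge set T -> \bar R}) (K : R) :
  leb.-integrable (D : set T) (EFin \o w) ->
  measurable_fun (D : set T) (fun x : R => fine (nu (`]-oo, x[%classic : set T))) ->
  {ae leb, forall x : T, (D : set T) x -> w x = K + fine (nu (`]-oo, x[%classic : set T))} ->
  forall psi, test_function D psi ->
    \int[leb]_(x in (D : set T)) (w x * derive1 psi x) = - charge_integral nu psi.
Proof.
move=> iw mnu Hw psi tpsi.
have mD : measurable (D : set T) by exact: measurable_itv.
have [M HM] := test_function_supp _ _ _ tpsi.
have [smo _ sub] := tpsi.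
have dpsi x : derivable psi x 1 := smo 0%N x.
have cpsi' : continuous (derive1 psi).
  by move=> x; apply: differentiable_continuous; apply/derivable1_diffP; exact: (smo 1%N x).
have psi'0 := supp_derive1 _ _ _ _ HM.
have ipsi' := supp_continuous_integrable _ _ _ _ cpsi' psi'0.
have [C C0 HC] := supp_continuous_bounded _ _ _ _ cpsi' psi'0.
have mpsi' : measurable_fun (D : set T) (derive1 psi) by apply: measurable_funTS; exact: continuous_measurable_fun.
have iwp : leb.-integrable (D : set T) (EFin \o (fun x => w x * derive1 psi x)).
  by apply: (integrable_mul_bounded _ _ _ _ _ _ _ C) => // x _.
rewrite (charge_integral_C1 _ _ _ _ _ dpsi cpsi' HM) opprK.
have -> : \int[leb]_(x in (setT : set T)) (derive1 psi x * fine (nu `]-oo, x[%classic)) =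
   \int[leb]_(x in (D : set T)) (derive1 psi x * fine (nu `]-oo, x[%classic)).
  rewrite [RHS]Rintegral_mkcond; apply: eq_Rintegral => x _; rewrite patchE.
  by case: ifPn => // /negP; rewrite inE => nDx; rewrite (test_derive0 psi)// mul0r.
(* The integral of psi' over D is zero, so the additive constant K leaves no trace in the
   distributional derivative. *)
have I0 : \int[leb]_(x in (D : set T)) (K * derive1 psi x) = 0.
  rewrite RintegralZl//; last exact: integrableS ipsi'.
  have -> : \int[leb]_(x in (D : set T)) derive1 psi x = \int[leb]_(x in (`]a, +oo[%classic : set T)) derive1 psi x.
    rewrite Rintegral_mkcond [RHS]Rintegral_mkcond; apply: eq_Rintegral => x _; rewrite !patchE.
    case: ifPn => [|/negP]; rewrite inE => xD.
      by rewrite mem_set//; move: xD; rewrite /= !in_itv/= => /andP[->].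
    by case: ifP => // _; rewrite (test_derive0 psi).
  rewrite (Rintegral_derive1_tail _ _ _ _ _ dpsi cpsi' HM).
  suff -> : psi a = 0 by rewrite oppr0 mulr0.
  apply/eqP/negPn/negP => pa; have : D a by apply: sub; exact: subset_closure.
  by rewrite /= in_itv/= ltxx.
have iK : leb.-integrable (D : set T) (EFin \o (fun x => K * derive1 psi x)).
  by apply: eq_integrable (integrableZl mD K (integrableS measurableT mD (@subsetT _ _) ipsi')).
have -> : \int[leb]_(x in (D : set T)) (w x * derive1 psi x) =
   \int[leb]_(x in (D : set T)) (w x * derive1 psi x - K * derive1 psi x).
  by rewrite (RintegralB mD iwp iK) I0 subr0.
congr fine; apply: ae_eq_integral => //.
- by have := measurable_int _ (integrableB mD iwp iK).
- by apply/measurable_EFinP; exact: measurable_funM.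
- by apply: ae_imply Hw => x Hx Dx; rewrite /= (Hx Dx); congr EFin; ring.
Qed.

Lemma monotone_difference_charge (M : R) (S : set R) (P w : R -> R) :
  0 <= M -> {ae leb, forall x : T, (D : set T) x -> S x} ->
  (forall x y, S x -> S y -> x <= y -> P x <= P y) ->
  (forall x y, S x -> S y -> x <= y -> P x - w x <= P y - w y) ->
  (forall x, S x -> `|P x| <= M) -> (forall x, S x -> `|P x - w x| <= M) ->
  leb.-integrable (D : set T) (EFin \o w) ->
  exists nu : {charge set T -> \bar R}, (forall A : set T, measurable A -> A `&` D = set0 -> nu A = 0%E) /\
   forall psi, test_function D psi ->
    \int[leb]_(x in (D : set T)) (w x * derive1 psi x) = - charge_integral nu psi.
Proof.
move=> M0 nS ndP ndQ PM QM iw.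
have [mP [KP [HP1 HP2]]] := monotone_measure R a b M S P ab M0 nS ndP PM.
have [mQ [KQ [HQ1 HQ2]]] := monotone_measure R a b M S (fun x => P x - w x) ab M0 nS ndQ QM.
pose nu : {charge set T -> \bar R} := cadd (charge_of_finite_measure mP) (cscale (-1) (charge_of_finite_measure mQ)).
have nuE A : nu A = (mP A - mQ A)%E by rewrite /nu/= /cadd/= cscaleN1.
exists nu; split; first by move=> A mA AD; rewrite nuE HP1// HQ1// sube0.
have mI x : measurable (`]-oo, x[%classic : set T) by exact: measurable_itv.
have fB x : fine (nu (`]-oo, x[%classic : set T)) = fine (mP (`]-oo, x[%classic : set T)) - fine (mQ (`]-oo, x[%classic : set T)).
  by rewrite nuE fineB ?fin_num_measure.
have mD : measurable (D : set T) by exact: measurable_itv.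
have mhead (m : {finite_measure set T -> \bar R}) : measurable_fun (D : set T) (fun x : R => fine (m (`]-oo, x[%classic : set T))).
  have i1 : leb.-integrable (setT : set T) (EFin \o (\1_D : R -> R)).
    exact: (@integrable_indic_itv R a b false true).
  have k1 : m.-integrable (setT : set T) (EFin \o (cst 1 : R -> R)) by exact: finite_measure_integrable_cst.
  have := integrable_fubini_left _ leb m _ _ i1 k1.
  move=> /measurable_int/measurable_EFinP/(@measurable_funTS _ _ _ _ D).
  apply: eq_measurable_fun => x xD; rewrite indicE xD mul1r /Rintegral (eq_integral (cst 1%E))//.
  by rewrite integral_cst// mul1e.
apply: (distr_of_representation w nu (KP - KQ)) => //.
  rewrite (_ : (fun x => _) = (fun x => fine (mP (`]-oo, x[%classic : set T)) - fine (mQ (`]-oo, x[%classic : set T)))).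
    exact: measurable_funB.
  by apply/funext => x; exact: fB.
apply: ae_imply (ae_and _ _ _ _ _ _ HP2 HQ2) => x [H1 H2] Dx.
rewrite fB; have := H1 Dx; have := H2 Dx; set p := fine _; set q := fine _; lra.
Qed.

End monotone_difference.

Section ae_subsequence.
Context d (T : measurableType d) (R : realType) (mu : {measure set T -> \bar R}).

(** The sum of the series is integrable, hence finite almost everywhere, and each term is dominated
    by a tail of the series. *)
Lemma ae_cvg0_of_summable (g : nat -> T -> \bar R) :
  (forall k, measurable_fun setT (g k)) -> (forall k x, (0 <= g k x)%E) ->
  (\sum_(0 <= k <oo) \int[mu]_x g k x < +oo)%E ->
  {ae mu, forall x, g k x @[k --> \oo] --> 0%E}.
Proof.
move=> mg g0 sumg.
have ig : mu.-integrable setT (fun x => \sum_(0 <= k <oo) g k x)%E.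
  apply/integrableP; split; first by apply: ge0_emeasurable_sum => // k x _ _; exact: g0.
  rewrite (eq_integral (fun x => \sum_(0 <= k <oo) g k x)%E); last first.
    by move=> x _; rewrite gee0_abs//; exact: nneseries_ge0.
  by rewrite integral_nneseries.
have := integrable_ae measurableT ig.
apply: ae_imply => x /(_ Logic.I) xfin.
have xlt : (\sum_(0 <= k <oo) g k x < +oo)%E by rewrite ltey_eq xfin.
have tail := nneseries_tail_cvg xlt (fun k _ => g0 k x).
apply: (squeeze_cvge _ (cvg_cst 0%E) tail); apply: nearW => k.
rewrite g0/=; apply: le_trans (nneseries_lim_ge k.+1 _); first by rewrite big_nat1.
by move=> j _ _; exact: g0.
Qed.

End ae_subsequence.

Section bounded_derivatives.
Context (R : realType) (a b M : R).
Notation T := (measurableTypeR R).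
Notation D := (`]a, b[%classic).
Hypothesis ab : a < b.
Variables (v : nat -> R -> R) (w : R -> R).
Hypothesis dv : forall l x, D x -> derivable (v l) x 1 /\ {for x, continuous (derive1 (v l))}.
Hypothesis iv : forall l, leb.-integrable (D : set T) (EFin \o derive1 (v l)).
Hypothesis vM : forall l, \int[leb]_(x in (D : set T)) `|derive1 (v l) x| <= M.
Hypothesis vw : {ae leb, forall x : T, (D : set T) x -> v l x @[l --> \oo] --> w x}.
Hypothesis iw : leb.-integrable (D : set T) (EFin \o w).

Let mD : measurable (D : set T). Proof. exact: measurable_itv. Qed.

Let var l (x : R) : R := \int[leb]_(s in (`]a, x]%classic : set T)) `|derive1 (v l) s|.

Let iabs l (i : interval R) : [set` i] `<=` D -> leb.-integrable ([set` i] : set T) (EFin \o (fun s => `|derive1 (v l) s|)).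
Proof.
move=> sub; have iN : leb.-integrable (D : set T) (EFin \o (fun s => `|derive1 (v l) s|)) by exact: integrable_norm (iv l).
by apply: (integrableS _ _ _ iN) => //; exact: measurable_itv.
Qed.

Let subD (x y : R) : a <= x -> y < b -> `]x, y] `<=` D.
Proof. by move=> ax yb; apply: subset_itv; rewrite bnd_simp. Qed.

Let var_ge0 l x : 0 <= var l x. Proof. exact: Rintegral_ge0. Qed.

Let varB l x y : D x -> D y -> x <= y ->
  var l y - var l x = \int[leb]_(s in (`]x, y]%classic : set T)) `|derive1 (v l) s|.
Proof.
rewrite /= !in_itv/= => /andP[ax xb] /andP[ay yb] xy.
rewrite /var -(@Rintegral_itvB R _ (BRight a) (BRight y) x) ?bnd_simp ?(ltW ax)//.
by apply: iabs; apply: subD.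
Qed.

Let varM l x : D x -> var l x <= M.
Proof.
rewrite /= in_itv/= => /andP[ax xb]; apply: le_trans (vM l).
have sub : `]a, x]%classic `<=` D by apply: subD.
have mI : measurable (`]a, x]%classic : set T) by exact: measurable_itv.
rewrite /var [leLHS]Rintegral_mkcond [leRHS]Rintegral_mkcond; apply: le_Rintegral.
- exact: measurableT.
- rewrite -restrict_EFin; apply/integrable_restrict; rewrite ?setTI//; exact: iabs.
- rewrite -restrict_EFin; apply/integrable_restrict; rewrite ?setTI//; exact: integrable_norm (iv l).
- move=> s _; rewrite !patchE; case: ifPn => [|_]; last by case: ifP => _; [exact: normr_ge0|exact: lexx].
  by rewrite inE => /sub Ds; rewrite mem_set.
Qed.

Let vB l x y : D x -> D y -> x <= y -> `|v l y - v l x| <= var l y - var l x.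
Proof.
move=> Dx Dy; rewrite le_eqVlt => /predU1P[->|xy]; first by rewrite !subrr normr0.
rewrite varB ?(ltW xy)//.
move: (Dx) (Dy); rewrite /= !in_itv/= => /andP[ax xb] /andP[ay yb].
have sub : `[x, y] `<=` D by apply: subset_itv; rewrite bnd_simp.
have cg : {within `[x, y], continuous (derive1 (v l))}.
  by apply: continuous_in_subspaceT => s /set_mem sxy; have [] := dv l s (sub _ sxy).
have cv s : D s -> {for s, continuous (v l)}.
  by move=> Ds; apply: differentiable_continuous; apply/derivable1_diffP; exact: (dv l s Ds).1.
have LR : derivable_oo_LRcontinuous (v l) x y.
  split=> [s sxy|  | ].
  - exact: (dv l s (sub _ (subset_itv_oo_cc sxy))).1.
  - exact: cvg_at_right_filter (cv x Dx).
  - exact: cvg_at_left_filter (cv y Dy).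
have H := @continuous_FTC2 _ (derive1 (v l)) (v l) x y xy cg LR (fun _ _ => erefl).
have mI : measurable (`]x, y]%classic : set T) by exact: measurable_itv.
have iI : leb.-integrable (`]x, y]%classic : set T) (EFin \o derive1 (v l)).
  by apply: (integrableS _ _ _ (iv l)) => //; apply: subD => //; exact: ltW.
have -> : v l y - v l x = \int[leb]_(s in (`]x, y]%classic : set T)) derive1 (v l) s.
  by rewrite Rintegral_itv_obnd_cbnd// /Rintegral H.
exact: le_normr_Rintegral.
Qed.

(** P is a pointwise lower limit of the variation functions, taken in place of a limit along a
    selected subsequence. Inequalities [var l x <= var l y + c l] with c convergent pass to it, and
    the monotonicity of P and that of P - w are both of this form: take c = 0 for the first and c l
    = v l x - v l y for the second. *)
Let limit_variation : exists2 P : R -> R, (forall x, D x -> 0 <= P x <= M) &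
  (forall x y (c : nat -> R) (C : R), D x -> D y -> (forall l, var l x <= var l y + c l) ->
     c l @[l --> \oo] --> C -> P x <= P y + C).
Proof.
have le_einf (x y : nat -> \bar R) : (forall l, (x l <= y l)%E) -> (limn_einf x <= limn_einf y)%E.
  by move=> xy; rewrite -[leRHS]adde0; apply: (limn_einf_add_le R _ _ (cst 0)); [move=> l; rewrite adde0|exact: cvg_cst].
have einf_cst (c : R) : limn_einf (cst c%:E : nat -> \bar R) = c%:E.
  by have [-> _] := cvg_limn_einf_sup (cvg_cst (c%:E : \bar R)).
pose E x := limn_einf (fun l => (var l x)%:E).
have E0 x : (0%:E <= E x)%E by rewrite -(einf_cst 0); apply: le_einf => l; rewrite lee_fin.
have EM x : D x -> (E x <= M%:E)%E by move=> Dx; rewrite -(einf_cst M); apply: le_einf => l; rewrite lee_fin varM.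
have Efin x : D x -> E x \is a fin_num.
  by move=> Dx; rewrite ge0_fin_numE//; exact: le_lt_trans (EM x Dx) (ltry _).
have EB x y (c : nat -> R) (C : R) : (forall l, var l x <= var l y + c l) -> c l @[l --> \oo] --> C ->
    (E x <= E y + C%:E)%E.
  by move=> xy cC; apply: (limn_einf_add_le R _ _ c) => // l; rewrite -EFinD lee_fin.
clearbody E; exists (fun x => fine (E x)) => [x Dx|x y c C Dx Dy xy cC].
  by rewrite fine_ge0 ?E0//= -lee_fin (fineK (Efin x Dx)) EM.
by rewrite -lee_fin EFinD (fineK (Efin x Dx)) (fineK (Efin y Dy)); exact: EB xy cC.
Qed.

Lemma charge_of_bounded_derivatives :
  exists nu : {charge set T -> \bar R}, (forall A : set T, measurable A -> A `&` D = set0 -> nu A = 0%E) /\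
   forall psi, test_function D psi ->
    \int[leb]_(x in (D : set T)) (w x * derive1 psi x) = - charge_integral nu psi.
Proof.
pose S := [set x | D x /\ v l x @[l --> \oo] --> w x].
have M0 : 0 <= M by apply: le_trans (vM 0%N); exact: Rintegral_ge0.
have wB x y : S x -> S y -> x <= y -> `|w y - w x| <= M.
  move=> [Dx cx] [Dy cy] xy.
  have c : `|v l y - v l x| @[l --> \oo] --> `|w y - w x| by apply: cvg_norm; exact: cvgB.
  rewrite -(cvg_lim _ c)//; apply: limr_le; first by apply/cvg_ex; eexists; exact: c.
  apply: nearW => l; apply: le_trans (vB l x y Dx Dy xy) _.
  by have := varM l y Dy; have := var_ge0 l x; lra.
(* Between any two points of S the limit w varies by at most M, so its value at a single point
   bounds it on S. *)
have [C C0 HC] : exists2 C, 0 <= C & forall x, S x -> `|w x| <= C.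
  have [[s Ss]|nS] := pselect (exists s, S s); last first.
    by exists 0 => // x Sx; exfalso; apply: nS; exists x.
  exists (`|w s| + M); first exact: addr_ge0.
  move=> x Sx; rewrite -[w x](subrK (w s)) addrC; apply: le_trans (ler_normD _ _) _; rewrite lerD2l.
  by have [sx|xs] := leP s x; [exact: wB|rewrite distrC; apply: wB => //; exact: ltW].
have [P P0M PB] := limit_variation.
apply: (monotone_difference_charge R a b ab (M + C) S P w).
- exact: addr_ge0.
- by apply: ae_imply vw => x Hx Dx; split => //; exact: Hx.
- move=> x y [Dx _] [Dy _] xy; rewrite -[leRHS]addr0; apply: (PB x y (cst 0)) => //; last exact: cvg_cst.
  by move=> l; rewrite addr0 -subr_ge0; apply: le_trans (vB l x y Dx Dy xy).
- move=> x y [Dx cx] [Dy cy] xy.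
  rewrite lerBlDr -addrA [- _ + _]addrC; apply: (PB x y (fun l => v l x - v l y)) => //; last exact: cvgB.
  move=> l; have := le_trans (ler_norm _) (vB l x y Dx Dy xy).
  by set A := var l y; set B := var l x; lra.
- move=> x [Dx _]; have /andP[P0 PM] := P0M x Dx; rewrite ger0_norm//; exact: ler_wpDr.
- move=> x Sx; have /andP[P0 PM] := P0M x Sx.1; apply: le_trans (ler_normB _ _) _; rewrite ger0_norm//; apply: lerD => //; exact: HC.
- exact: iw.
Qed.

End bounded_derivatives.

(** * Finite relaxed energy implies bounded variation *)

Section relaxed_BV.
Context (R : realType) (n : nat) (a b : R).
Notation T := (measurableTypeR R).
Notation D := (`]a, b[%classic).
Hypothesis ab : a < b.

Let mD : measurable (D : set T). Proof. exact: measurable_itv. Qed.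
Let oD : open (D : set R). Proof. exact: interval_open. Qed.

Lemma limn_einf_lt_frequently (x : nat -> \bar R) (M : \bar R) : (limn_einf x < M)%E ->
  forall N, exists2 l, (N <= l)%N & (x l < M)%E.
Proof.
move=> xM N.
have h : (einfs x N <= limn_einf x)%E.
  rewrite limn_einf_lim (cvg_lim _ (@cvg_einfs_sup _ x))//.
  by apply: ereal_sup_ubound; exists N.
have [_ [l /= Nl <-] lM] := ereal_inf_lt (le_lt_trans h xM).
by exists l.
Qed.

Lemma cvg0_eventually_lt (x : nat -> \bar R) (e : R) : 0 < e -> x l @[l --> \oo] --> 0%E ->
  \forall l \near \oo, (x l < e%:E)%E.
Proof.
move=> e0 /fine_cvgP[xfin xcvg].
have H : \forall l \near \oo, (fine \o x) l < e by exact: (cvgr_lt 0 xcvg).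
near=> l; rewrite -[x l]fineK; last by near: l.
by rewrite lte_fin; near: l.
Unshelve. all: by end_near. Qed.

(** A compact exhaustion of ]a, b[ starting from the midpoint, since convergence of the
    approximating sequence is known on compact sets only. *)
Let K (k : nat) : set R := `[a + (b - a) / 2 * k.+1%:R^-1, b - (b - a) / 2 * k.+1%:R^-1]%classic.

Let KD k : K k `<=` D.
Proof.
have p : 0 < (b - a) / 2 * k.+1%:R^-1 by rewrite mulr_gt0 ?invr_gt0// divr_gt0// subr_gt0.
by apply: subset_itv; rewrite bnd_simp ?ltrDl// gtrBl.
Qed.

Let K_eventually x : D x -> \forall k \near \oo, K k x.
Proof.
rewrite /= in_itv/= => /andP[ax xb].
have h : 0 < (b - a) / 2 by rewrite divr_gt0// subr_gt0.
have e0 : 0 < Num.min (x - a) (b - x) / ((b - a) / 2) by rewrite divr_gt0// lt_min !subr_gt0 ax.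
near=> k; have : k.+1%:R^-1 < Num.min (x - a) (b - x) / ((b - a) / 2).
  by near: k; exact: (near_infty_natSinv_lt (PosNum e0)).
rewrite ltr_pdivlMr// mulrC lt_min => /andP[h1 h2].
by rewrite /K /= in_itv/= -lerBrDl (ltW h1) lerBrDl -lerBrDr ltW.
Unshelve. all: by end_near. Qed.

Variables (F : 'rV[R]_n -> R) (c C : R) (u : R -> 'rV[R]_n).
Hypothesis F0 : forall p, 0 <= F p.
Hypothesis cF : continuous F.
Hypothesis c0 : 0 < c.
Hypothesis Fc : forall p, c * enorm p <= F p + C.
Hypothesis Lu : L1 D u.

Let energy_bound (v : R -> 'rV[R]_n) (M : R) : C1 D v ->
  (\int[leb]_(x in (D : set T)) (F (derive1 v x))%:E < M%:E)%E ->
  leb.-integrable (D : set T) (EFin \o (fun x => enorm (derive1 v x))) /\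
  \int[leb]_(x in (D : set T)) enorm (derive1 v x) <= (M + `|C| * (b - a)) / c.
Proof.
move=> Cv EM.
have mF : measurable_fun (D : set T) (fun x => F (derive1 v x)) by exact: C1_measurable.
have iF : leb.-integrable (D : set T) (EFin \o (fun x => F (derive1 v x))).
  apply/integrableP; split; first exact/measurable_EFinP.
  under eq_integral do rewrite gee0_abs ?lee_fin//.
  exact: lt_trans EM (ltry _).
have iC : leb.-integrable (D : set T) (EFin \o (cst `|C| : R -> R)).
  by apply: (bounded_integrable_oo _ _ _ _ `|C|) => //; [exact: ltW|move=> t _; rewrite normr_id].
have iFC : leb.-integrable (D : set T) (EFin \o (fun x => c^-1 * (F (derive1 v x) + `|C|))).
  exact: (integrable_RZ R a b c^-1 _ (integrable_RD R a b _ _ iF iC)).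
have le x : enorm (derive1 v x) <= c^-1 * (F (derive1 v x) + `|C|).
  rewrite ler_pdivlMl//; apply: le_trans (Fc _) _; rewrite lerD2l; exact: ler_norm.
have mv : measurable_fun (D : set T) (fun x => enorm (derive1 v x)).
  apply: enorm_measurable => i; apply: open_continuous_measurable_fun => // x /set_mem Dx.
  by have [] := C1_coord R n D v i Cv x Dx.
have ie : leb.-integrable (D : set T) (EFin \o (fun x => enorm (derive1 v x))).
  apply: (integrable_dominated R a b _ _ mv iFC) => x _.
  by rewrite ger0_norm ?enorm_ge0.
split => //.
apply: (@le_trans _ _ (\int[leb]_(x in (D : set T)) (c^-1 * (F (derive1 v x) + `|C|)))).
  by apply: le_Rintegral.
rewrite RintegralZl//; last exact: (integrable_RD R a b _ _ iF iC).
rewrite mulrC ler_pM2r ?invr_gt0// RintegralD//; apply: lerD.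
  by rewrite -lee_fin fineK ?integrable_fin_num// ltW.
rewrite /Rintegral (eq_integral (cst `|C|%:E))// integral_cst//.
by have /= -> := lebesgue_measure_oo _ _ _ (ltW ab).
Qed.

Lemma BV_of_relaxed_lt : (relaxed D F u < +oo)%E -> BV D u.
Proof.
move=> /ereal_inf_lt[_ [v [Cv vu] <-] Ev]; split; first exact: Lu.
have [M EM] : exists M : R, (limn_einf (fun l => \int[leb]_(x in (D : set T)) (F (derive1 (v l) x))%:E) < M%:E)%E.
  move: Ev; case: (limn_einf _) => [r _|//|_]; last by exists 0; exact: ltNyr.
  by exists (r + 1); rewrite lte_fin ltrDl.
(* The energy bound holds for infinitely many l and the L^1 bound on [K k] for all large l, so some
   l satisfies both. The geometric rate makes the distances summable, which yields convergence
   almost everywhere. *)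
have ex k : exists l, (\int[leb]_(x in (D : set T)) (F (derive1 (v l) x))%:E < M%:E)%E /\
    (\int[leb]_(x in (K k : set T)) (enorm (v l x - u x))%:E <= (1 / (2 ^ k.+1)%:R)%:E)%E.
  have e0 : 0 < 1 / (2 ^ k.+1)%:R :> R by rewrite divr_gt0// ltr0n expn_gt0.
  have [N _ HN] := cvg0_eventually_lt _ _ e0 (vu (K k) (@segment_compact _ _ _) (KD k)).
  have [l Nl lM] := limn_einf_lt_frequently _ _ EM N.
  by exists l; split => //; apply: ltW; exact: HN.
have [s sP] := choice ex.
have sE k := (sP k).1. have sK k := (sP k).2.
have mK k : measurable (K k : set T) by exact: measurable_itv.
have Lv k i : measurable_fun (D : set T) (fun x => v (s k) x ord0 i).
  apply: open_continuous_measurable_fun => // x /set_mem Dx.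
  by have [] := C1_coord R n D (v (s k)) i (Cv (s k)) x Dx.
pose g k (x : T) : \bar R := ((fun x => (enorm (v (s k) x - u x))%:E) \_ (K k)) x.
have mg k : measurable_fun setT (g k).
  apply/measurable_restrict => //; rewrite setTI.
  apply/measurable_EFinP; apply: enorm_measurable => i.
  have : measurable_fun (D : set T) (fun x => v (s k) x ord0 i - u x ord0 i).
    by apply: measurable_funB => //; apply/measurable_EFinP; exact: measurable_int (Lu i).
  move=> /(measurable_funS mD (KD k)); apply: eq_measurable_fun => x _; by rewrite !mxE.
have g0 k x : (0 <= g k x)%E by rewrite /g patchE; case: ifP => // _; rewrite lee_fin enorm_ge0.
have sumg : (\sum_(0 <= k <oo) \int[leb]_x g k x < +oo)%E.
  apply: le_lt_trans (ltry 1); apply: le_trans (epsilon_trick0 xpredT ler01).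
  apply: lee_nneseries => [k _ _|k _]; first exact: integral_ge0.
  by rewrite /g -integral_mkcond.
have aeg := ae_cvg0_of_summable _ _ _ leb g mg g0 sumg.
have aev i : {ae leb, forall x : T, (D : set T) x -> v (s k) x ord0 i @[k --> \oo] --> u x ord0 i}.
  apply: ae_imply aeg => x Hx Dx; apply/subr_cvg0.
  move/fine_cvgP: Hx => [_ gfin].
  apply: norm_cvg0; apply: (squeeze_cvgr _ (cvg_cst 0) gfin).
  near=> k; rewrite normr_ge0/= /g patchE mem_set; last by near: k; exact: K_eventually.
  by apply: le_trans (enorm_coord _ _ (v (s k) x - u x) i); rewrite !mxE.
pose A := (M + `|C| * (b - a)) / c.
have H i : exists nu : {charge set T -> \bar R}, (forall B : set T, measurable B -> B `&` D = set0 -> nu B = 0%E) /\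
   forall psi, test_function D psi ->
    \int[leb]_(x in (D : set T)) (u x ord0 i * derive1 psi x) = - charge_integral nu psi.
  have dE k x : D x -> derivable (fun y => v (s k) y ord0 i) x 1 /\ derive1 (fun y => v (s k) y ord0 i) x = derive1 (v (s k)) x ord0 i.
    by move=> Dx; apply: derive1_coord; have [] := Cv (s k) x Dx.
  have cE k x : D x -> {for x, continuous (derive1 (fun y => v (s k) y ord0 i))}.
    move=> Dx; have nD : nbhs x (D : set R) by exact: open_nbhs_nbhs.
    have [_ _ cv] := C1_coord R n D (v (s k)) i (Cv (s k)) x Dx.
    rewrite /prop_for /continuous_at (dE k x Dx).2.
    apply: cvg_trans cv; apply: near_eq_cvg.
    by apply: filterS nD => y Dy; rewrite (dE k y Dy).2.
  have iv k : leb.-integrable (D : set T) (EFin \o derive1 (fun y => v (s k) y ord0 i)).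
    have [ie _] := energy_bound _ _ (Cv (s k)) (sE k).
    apply: (integrable_dominated R a b _ _ _ ie) => [|x Dx]; last by rewrite (dE k x Dx).2 enorm_coord.
    by apply: open_continuous_measurable_fun => // x /set_mem Dx; exact: cE.
  apply: (charge_of_bounded_derivatives R a b A ab (fun k x => v (s k) x ord0 i) (fun x => u x ord0 i)).
  - move=> k x Dx; split; [exact: (dE k x Dx).1|exact: cE].
  - exact: iv.
  - move=> k; have [ie HA] := energy_bound _ _ (Cv (s k)) (sE k).
    apply: le_trans HA; apply: le_Rintegral => //; first exact: integrable_norm (iv k).
    by move=> x Dx; rewrite (dE k x Dx).2 enorm_coord.
  - exact: aev.
  - exact: Lu.
exists (fun i => projT1 (cid (H i))) => i; case: cid => nu [H1 H2] /=; split => //.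
Unshelve. all: by end_near. Qed.

End relaxed_BV.

(** The partition consisting of E and empty sets shows that the supremum runs over a nonempty
    family. *)
Lemma total_variation_ge0 (R : realType) (n : nat) (m : vmeasure R n) (E : set (measurableTypeR R)) :
  measurable E -> (0 <= total_variation_measure m E)%E.
Proof.
move=> mE; apply: (@le_trans _ _ (\sum_(0 <= k <oo) (enorm (\row_i fine (m i (bigcup2 E set0 k))))%:E)%E).
  by apply: nneseries_ge0 => k _ _; rewrite lee_fin enorm_ge0.
apply: ereal_sup_ubound; exists (bigcup2 E set0) => //; split.
- by move=> k; rewrite /bigcup2; do 2 (case: ifP => _ //); exact: measurable0.
- by rewrite -trivIset_bigcup2 setI0.
- by rewrite bigcup2E setU0.
Qed.

Theorem theorem1p2 (R : realType) (n : nat) (hn : (1 <= n)%N)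
    (a b : R) (hab : a < b) (lambda : R) (hlambda : 0 < lambda)
    (h : R -> 'rV[R]_n) (hh : L2 `]a, b[ h)
    (f : R -> R)
    (f_ge0 : forall t, 0 <= t -> 0 <= f t)
    (f_convex : convex_function (`[0, +oo[%classic : set R) f)
    (f_nondecreasing : forall s t, 0 <= s -> s <= t -> f s <= f t)
    (f_growth : linear_growth f)
    (phi : 'rV[R]_n -> R)
    (phi_anisotropy : anisotropy phi) (phi_coercive : coercive phi)
    (u : R -> 'rV[R]_n)
    (hu : is_minimizer `]a, b[ (f \o phi) lambda h u)
    (c d : R) (hcd : c < d) (hU : `]c, d[ `<=` `]a, b[)
    (h_BV : BV `]c, d[ h) :
  BV `]a, b[ u /\
  forall Du us Dh hs : vmeasure R n,
    distr_derivative `]a, b[ u Du -> singular_part Du us ->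
    distr_derivative `]c, d[ h Dh -> singular_part Dh hs ->
    forall E : set (measurableTypeR R), measurable E -> E `<=` `]c, d[ ->
      (total_variation_measure us E
       <= ((cplus phi / cminus phi) ^+ 2)%:E * total_variation_measure hs E)%E.
Proof.
have F_nonneg : forall p, 0 <= (f \o phi) p by exact: F_ge0.
have F_cont : continuous (f \o phi : 'rV[R]_n -> R) by exact: F_continuous.
split.
  have [k k0 [C HC]] := F_growth_below R n f phi f_growth phi_anisotropy phi_coercive.
  apply: (BV_of_relaxed_lt R n a b hab (f \o phi) k C u F_nonneg F_cont k0 HC).
    by apply: L2_L1 => //; case: hu.
  have := minimizer_relaxed_fin R n a b hab (f \o phi) lambda h u F_nonneg hlambda hh hu.
  by rewrite ltey_eq => ->.
move=> Du us Dh hs dU sU dH sH E mE EU.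
apply: le_trans (singular_total_variation_le R n a b lambda h u f phi c d hab hlambda hh f_ge0 f_convex
  f_nondecreasing f_growth phi_anisotropy hu hcd hU Du us Dh hs dU sU dH sH E mE EU) _.
rewrite -[leLHS]mul1e lee_wpmul2r ?total_variation_ge0// lee_fin.
exact: ratio_ge1.
Qed.
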